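(* Let $n\ge2$, $1<p<\infty$, let $\Omega\subset\mathbb{R}^n$ be a bounded John domain, and let $\beta\in\mathbb{R}$ satisfy $$\beta p>-(n-\dim_A(\partial\Omega)).$$ Then there is a constant $C$ such that for every $f\in L^p(\Omega,d^{\beta p})$ with $\int_\Omega f\,d^{\beta p}\,dx=0$, $$\|f\|_{L^p(\Omega,d^{\beta p})}\le C\|\nabla f\|_{L^p(\Omega,d^{(\beta+1)p})}.$$
   Context: Notation: $d(x)=\mathrm{dist}(x,\partial\Omega)$. For a weight $\omega$ (measurable, a.e. positive), $\|f\|_{L^p(\Omega,\omega)}=(\int_\Omega|f|^p\omega\,dx)^{1/p}$. $\nabla f$ is the distributional gradient; the right-hand side is understood as $+\infty$ if $\nabla f$ is not a function in $L^p(\Omega,d^{(\beta+1)p})$. John domain: a bounded domain $\Omega\subset\mathbb{R}^n$ is a John domain if there are constants $0<a_0\le b_0<\infty$ and a point $x_0\in\Omega$ such that for each $x\in\Omega\setminus\{x_0\}$ there is a rectifiable curve $\gamma_x$ in $\Omega$ from $x$ to $x_0$, parametrized by arc length on $[0,L_x]$, $L_x=\mathrm{length}(\gamma_x)$, $\gamma_x(0)=x$, with $L_x\le b_0$ and $\mathrm{dist}(\gamma_x(\tau),\partial\Omega)\ge \frac{a_0}{L_x}\tau$ for all $\tau\in[0,L_x]$. Assouad dimension: for $E\subset\mathbb{R}^n$ and $r>0$, $N_r(E)$ is the least number of open balls of radius $r$ needed to cover $E$; $\dim_A(E)$ is the infimum of all $\lambda\ge0$ for which there is $C>0$ such that $\sup_{x\in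 E}N_r(B_R(x)\cap E)\le C(R/r)^\lambda$ for all $0<r<R$. *)

(* Defs.v *)
From HB Require Import structures.
From mathcomp Require Import all_boot all_order all_algebra.
From mathcomp Require Import all_classical all_reals all_analysis.
From mathcomp Require Import measurable_realfun.
Set Implicit Arguments.
Unset Strict Implicit.
Unset Printing Implicit Defensive.
Import Order.TTheory GRing.Theory Num.Theory numFieldNormedType.Exports.
Local Open Scope classical_set_scope.
Local Open Scope ring_scope.

(* 'M[R]_(m, n) carries the Borel sigma-algebra of its (product) topology. *)
Section borel_matrix.
Variables (R : realType) (m n : nat).
HB.instance Definition _ := @isMeasurable.Build (sigma_display (@open 'M[R]_(m, n)))
  'M[R]_(m, n) <<s @open 'M[R]_(m, n) >> (@sigma_algebra0 _ setT _)
  (@sigma_algebraC _ _) (@sigma_algebra_bigcup _ setT _).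
End borel_matrix.

Section sigma_finite_pack.
Context d (T : measurableType d) (R : realType).
Variables (mu : {measure set T -> \bar R}) (mu_sfin : sigma_finite setT mu).

Definition sigma_finite_pack of sigma_finite setT mu : set T -> \bar R := mu.

HB.instance Definition _ := Measure.on (sigma_finite_pack mu_sfin).
HB.instance Definition _ := Measure_isSigmaFinite.Build _ _ _
  (sigma_finite_pack mu_sfin) mu_sfin.

End sigma_finite_pack.

Section lebesgue_rV.
Variable R : realType.

Definition rV_cons n (z : R * 'rV[R]_n) : 'rV[R]_n.+1 := row_mx z.1%:M z.2.

(* Lebesgue measure on the Borel sets of R^n, as an iterated product measure;
   see lebesgue_rV_box for its values on boxes. *)
Fixpoint lebesgue_rV n : set 'rV[R]_n -> \bar R :=
  match n with
  | 0 => \d_(0 : 'rV[R]_0)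
  | n.+1 => pushforward (lebesgue_measure \x (@lebesgue_rV n))%E (@rV_cons n)
  end.

Lemma open_measurable_rV n (U : set 'rV[R]_n) : open U -> measurable U.
Proof. exact: sub_sigma_algebra. Qed.

Lemma rV_cons0 n (z : R * 'rV[R]_n) : rV_cons z 0 ord0 = z.1.
Proof.
rewrite /rV_cons (_ : ord0 = lshift n (ord0 : 'I_1)); last exact/val_inj.
by apply: etrans (row_mxEl _ _ _ _) _; rewrite mxE eqxx mulr1n.
Qed.

Lemma rV_consS n (z : R * 'rV[R]_n) (i : 'I_n) :
  rV_cons z 0 (lift ord0 i) = z.2 0 i.
Proof.
rewrite /rV_cons (_ : lift ord0 i = rshift 1 i); last exact/val_inj.
exact: row_mxEr.
Qed.

Lemma rV_ballE n (x y : 'rV[R]_n) e : 0 < e ->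
  ball x e y <-> forall i, ball (x 0 i) e (y 0 i).
Proof.
move=> e0; split => [[_ h] i|h]; first exact: h.
by split => // i j; rewrite ord1.
Qed.

Lemma measurable_rV_cons n : measurable_fun setT (@rV_cons n).
Proof.
apply: (@measurability _ _ _ _ _ _ (@open 'rV[R]_n.+1)) => //.
move=> _ [U oU <-]; rewrite setTI.
pose B (qk : 'rV[rat]_n.+1 * nat) : set 'rV[R]_n.+1 :=
  ball (map_mx ratr qk.1 : 'rV[R]_n.+1) (qk.2.+1%:R^-1).
have -> : U = \bigcup_(qk in [set qk | B qk `<=` U]) B qk.
  apply/seteqP; split => [x Ux|x [qk /= h]]; last exact: h.
  have /nbhs_ballP[e /= e0 xeU] : nbhs x U by exact: open_nbhs_nbhs.
  pose k := Num.truncn (2 / e).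
  have ke : k.+1%:R^-1 < e / 2.
    by rewrite -[ltRHS]invf_div ltf_pV2 ?posrE// ?divr_gt0// truncnS_gt.
  have /choice[q qP] : forall i, exists q : rat, ball (x 0 i) k.+1%:R^-1 (ratr q).
    move=> i; have [||y [xy [q _ qy]]] := @dense_rat R (ball (x 0 i) k.+1%:R^-1).
    - by exists (x 0 i); apply: ballxx.
    - exact: ball_open.
    - by exists q; rewrite qy.
  have xB : B (\row_i q i, k) x.
    by apply/rV_ballE => // i; rewrite !mxE; exact/ball_sym/qP.
  exists (\row_i q i, k) => //= y By; apply: xeU; rewrite [e]splitr.
  apply: ball_triangle (le_ball (ltW ke) By).
  exact/(le_ball (ltW ke))/ball_sym.
rewrite preimage_bigcup bigcup_mkcond.
apply: countable_bigcupT_measurable; first exact: countableP.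
move=> [q k]; case: ifPn => // _.
have k0 : 0 < k.+1%:R^-1 :> R by [].
have -> : @rV_cons n @^-1` B (q, k) =
   ball (ratr (q 0 ord0) : R) k.+1%:R^-1 `*`
   ball (map_mx ratr (col' 0 q) : 'rV[R]_n) k.+1%:R^-1.
  apply/seteqP; split => [z /rV_ballE h|z [h1 /rV_ballE h2]].
    split; first by have := h k0 ord0; rewrite rV_cons0 mxE.
    apply/rV_ballE => // i; have := h k0 (lift ord0 i).
    by rewrite rV_consS !mxE.
  apply/rV_ballE => // i; case: (unliftP ord0 i) => [j ->|->].
    by rewrite rV_consS; have := h2 k0 j; rewrite !mxE.
  by rewrite rV_cons0 mxE.
by apply: measurableX; [apply: open_measurable|apply: open_measurable_rV];
  exact: ball_open.
Qed.

Lemma measurable_rV_coord n (i : 'I_n) :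
  measurable_fun setT (fun x : 'rV[R]_n => x 0 i).
Proof.
apply: (measurability _ (RGenOpens.measurableE R)) => _ [_ [a [b ->]] <-].
rewrite setTI; apply: open_measurable_rV; apply: open_comp; last exact: interval_open.
by move=> x _; exact: coord_continuous.
Qed.

Lemma measurable_rV_box n (A : 'I_n -> set R) :
  (forall i, measurable (A i)) ->
  measurable [set x : 'rV[R]_n | forall i, A i (x 0 i)].
Proof.
move=> mA; rewrite [X in measurable X](_ : _ =
  \bigcap_(i in [set: 'I_n]) ((fun x : 'rV[R]_n => x 0 i) @^-1` A i)).
  apply: fin_bigcap_measurable => // i _.
  by rewrite -[X in measurable X]setTI; exact: measurable_rV_coord.
by apply/seteqP; split => x /= h i; [move=> _|]; exact: h.
Qed.


Lemma rV_cons_box n (A : 'I_n.+1 -> set R) :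
  @rV_cons n @^-1` [set x | forall i, A i (x 0 i)] =
  A ord0 `*` [set x : 'rV[R]_n | forall i, A (lift ord0 i) (x 0 i)].
Proof.
apply/seteqP; split => [z /= h|z [/= h1 h2] i].
  by split => [|i]; [rewrite -(rV_cons0 z)|rewrite -(rV_consS z)]; exact: h.
by case: (unliftP ord0 i) => [j ->|->]; rewrite ?rV_consS ?rV_cons0.
Qed.

Definition box_formula n (mu : set 'rV[R]_n -> \bar R) :=
  forall A : 'I_n -> set R, (forall i, measurable (A i)) ->
   mu [set x : 'rV[R]_n | forall i, A i (x 0 i)] =
   (\prod_(i < n) lebesgue_measure (A i))%E.

Lemma box_formula_sigma_finite n (mu : set 'rV[R]_n -> \bar R) :
  box_formula mu -> sigma_finite setT mu.
Proof.
move=> box.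
exists (fun k => [set x : 'rV[R]_n | forall i, `[- k%:R, k%:R]%classic (x 0 i)]).
  apply/esym; apply/seteqP; split => // x _.
  exists (Num.truncn (\sum_i `|x 0 i|)).+1 => //= i.
  rewrite in_itv/= -ler_norml ltW//.
  have := truncnS_gt (\sum_i `|x 0 i|).
  apply: le_lt_trans.
  by rewrite (bigD1 i)//= lerDl sumr_ge0.
move=> k; split; first exact: (measurable_rV_box (A := fun=> `[- k%:R, k%:R]%classic)).
rewrite (box (fun=> `[- k%:R, k%:R]%classic))// -ge0_fin_numE; last by apply: prode_ge0 => i _; exact: measure_ge0.
apply: prode_fin_num => i _; rewrite lebesgue_measure_itv/=.
by case: ifPn.
Qed.

Let lebesgue_rV_ex n : exists mu : {sigma_finite_measure set 'rV[R]_n -> \bar R},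
  @lebesgue_rV n = mu /\ box_formula mu.
Proof.
elim: n => [|n [mu [muE box]]].
  exists \d_(0 : 'rV[R]_0); split => // A mA.
  by rewrite big_ord0 [LHS]diracE mem_set//; case.
pose P : {measure set (measurableTypeR R * 'rV[R]_n) -> \bar R} := (lebesgue_measure \x mu)%E.
pose nu0 : {measure set 'rV[R]_n.+1 -> \bar R} :=
  measure_function_pushforward__canonical__measure_function_Measure P
    (@measurable_rV_cons n).
have boxnu : box_formula nu0.
  move=> A mA; rewrite /nu0/= /pushforward rV_cons_box /P/=.
  rewrite product_measure1E//; [|exact: mA|exact: (measurable_rV_box (A := fun i => A (lift ord0 i)))].
  by rewrite big_ord_recl (box (fun i => A (lift ord0 i))).

exists (sigma_finite_pack (box_formula_sigma_finite boxnu)); split => //.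
by rewrite /= -muE.
Qed.

Let lebesgue_rV0 n : lebesgue_rV (set0 : set 'rV[R]_n) = 0%E.
Proof. by have [mu [-> _]] := lebesgue_rV_ex n; rewrite measure0. Qed.

Let lebesgue_rV_ge0 n (A : set 'rV[R]_n) : (0 <= lebesgue_rV A)%E.
Proof. by have [mu [-> _]] := lebesgue_rV_ex n; exact: measure_ge0. Qed.

Let lebesgue_rV_sigma_additive n : semi_sigma_additive (@lebesgue_rV n).
Proof.
by have [mu [-> _]] := lebesgue_rV_ex n; exact: measure_semi_sigma_additive.
Qed.

HB.instance Definition _ n := isMeasure.Build _ _ _ (@lebesgue_rV n)
  (@lebesgue_rV0 n) (@lebesgue_rV_ge0 n) (@lebesgue_rV_sigma_additive n).

Lemma lebesgue_rV_box n : box_formula (@lebesgue_rV n).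
Proof. by have [mu [-> box]] := lebesgue_rV_ex n. Qed.

HB.instance Definition _ n := Measure_isSigmaFinite.Build _ _ _
  (@lebesgue_rV n) (box_formula_sigma_finite (@lebesgue_rV_box n)).

End lebesgue_rV.

Section weighted_poincare.
Context {R : realType} {n : nat}.
Implicit Types (x y : 'rV[R]_n) (E Omega : set 'rV[R]_n).

(* The library norm `|x| on 'rV[R]_n is the sup norm; it has the same topology
   and bounded sets as enorm, but distances and lengths below are Euclidean. *)
Definition enorm x : R := Num.sqrt (\sum_(i < n) x 0 i ^+ 2).

Definition eball x (r : R) : set 'rV[R]_n := [set y | enorm (y - x) < r].

Definition boundary E : set 'rV[R]_n := closure E `\` E°.

Definition bdist Omega x : R := inf [set enorm (x - y) | y in boundary Omega].

Definition dist_weight Omega (a : R) x : R := bdist Omega x `^ a.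

Definition curve_length (gamma : R -> 'rV[R]_n) (a b : R) : \bar R :=
  ereal_sup [set (\sum_(0 <= k < size s)
      enorm (gamma (nth b s k) - gamma (nth b (a :: s) k)))%:E
    | s in itv_partition a b].

(* gamma is a rectifiable curve in Omega of length L, parametrized by arc length
   on [0, L]. *)
Definition arclength_curve Omega (gamma : R -> 'rV[R]_n) (L : R) : Prop :=
  [/\ 0 <= L,
      {within `[0, L]%classic, continuous gamma},
      forall t, 0 <= t <= L -> Omega (gamma t) &
      forall t, 0 <= t <= L -> curve_length gamma 0 t = t%:E].

Definition bounded_john_domain Omega : Prop :=
  [/\ open Omega, connected Omega, bounded_set Omega &
    exists (a0 b0 : R) (x0 : 'rV[R]_n), [/\ 0 < a0, a0 <= b0, Omega x0 &
      forall x, Omega x -> x <> x0 ->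
        exists (gamma : R -> 'rV[R]_n) (L : R),
          [/\ arclength_curve Omega gamma L, gamma 0 = x, gamma L = x0,
              L <= b0 &
              forall tau, 0 <= tau <= L ->
                a0 / L * tau <= bdist Omega (gamma tau)]]].

(* +oo if no finite cover exists. *)
Definition covering_number (r : R) E : \bar R :=
  ereal_inf [set k%:R%:E | k in [set k : nat |
    exists c : 'I_k -> 'rV[R]_n, E `<=` \bigcup_i eball (c i) r]].

Definition assouad_dim E : \bar R :=
  ereal_inf [set lambda%:E | lambda in [set lambda : R | 0 <= lambda /\
    exists2 C : R, 0 < C & forall r rho : R, 0 < r -> r < rho ->
      (ereal_sup [set covering_number r (eball x rho `&` E) | x in E]
       <= (C * (rho / r) `^ lambda)%:E)%E]].

Definition wLpnorm Omega (p : R) (w h : 'rV[R]_n -> R) : \bar R :=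
  ((\int[@lebesgue_rV R n]_(x in Omega) (`|h x| `^ p * w x)%:E) `^ p^-1)%E.

Definition wLp Omega (p : R) (w h : 'rV[R]_n -> R) : Prop :=
  measurable_fun Omega h /\ (wLpnorm Omega p w h < +oo)%E.

Definition partial_derivative (i : 'I_n) (phi : 'rV[R]_n -> R) :
    'rV[R]_n -> R :=
  fun x => 'D_(delta_mx 0 i) phi x.

(* C^infinity: all iterated partial derivatives exist and are continuous. *)
Definition smooth (phi : 'rV[R]_n -> R) : Prop :=
  forall s : seq 'I_n, let psi := foldr partial_derivative phi s in
    continuous psi /\ forall i x, derivable psi x (delta_mx 0 i).

Definition test_function Omega (phi : 'rV[R]_n -> R) : Prop :=
  let supp := closure [set x | phi x != 0] in
  [/\ smooth phi, compact supp & supp `<=` Omega].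

Definition locally_integrable_rV Omega (h : 'rV[R]_n -> R) : Prop :=
  measurable_fun Omega h /\
  forall K : set 'rV[R]_n, K `<=` Omega -> compact K ->
    (\int[@lebesgue_rV R n]_(x in K) `|h x|%:E < +oo)%E.

(* The distributional gradient of f on Omega is (represented by) the locally
   integrable vector field g. *)
Definition weak_gradient Omega (f : 'rV[R]_n -> R)
    (g : 'rV[R]_n -> 'rV[R]_n) : Prop :=
  [/\ locally_integrable_rV Omega f,
      forall i, locally_integrable_rV Omega (fun x => g x 0 i) &
      forall phi i, test_function Omega phi ->
        (\int[@lebesgue_rV R n]_(x in Omega)
            (f x * partial_derivative i phi x)%:E =
         - \int[@lebesgue_rV R n]_(x in Omega) (g x 0 i * phi x)%:E)%E].

(* A weak gradient is unique almost everywhere, so this infimum is over at most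
   one value; it is +oo when the distributional gradient of f is not a function
   in L^p(Omega, w). *)
Definition grad_wLpnorm Omega (p : R) (w f : 'rV[R]_n -> R) : \bar R :=
  ereal_inf [set wLpnorm Omega p w (fun x => enorm (g x)) | g in
    [set g | weak_gradient Omega f g /\ wLp Omega p w (fun x => enorm (g x))]].

End weighted_poincare.

(* Main.v *)
Require Import Defs.
From mathcomp Require Import all_boot all_order all_algebra.
From mathcomp Require Import all_classical all_reals all_analysis.
From mathcomp Require Import measurable_realfun lra ring.
Import Order.TTheory GRing.Theory Num.Theory numFieldNormedType.Exports.
Set Implicit Arguments.
Unset Strict Implicit.
Unset Printing Implicit Defensive.
Local Open Scope classical_set_scope.
Local Open Scope ring_scope.

(* Let d be the distance to the boundary. Along a John curve from x to the centre x0, averages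
   of f against mollifiers adapted to boxes of size about t at distance t from x telescope, and
   the difference of consecutive averages is an integral of the gradient. This bounds
   |f(x) - c0| almost everywhere by a discrete potential of |grad f| at x, in which only points y
   with |x - y| <= C t and d(y) >= c t contribute at scale t. A Schur test with a power of d
   bounds this potential from L^p(d^((beta+1)p)) to L^p(d^(beta p)); it needs the integral of d^a
   over balls of radius r centred on the boundary to be at most C r^(n+a), which follows for
   a > lambda - n from covering numbers of the boundary with exponent lambda, layer by layer.
   Finally the mean value condition controls the constant c0. *)

(** * Smooth functions of one variable *)

(** The weak gradient is seen only through smooth compactly supported functions. The mollifiers are
    therefore products of one-variable kernels: two kernels of mass one differ by the derivative of
    a compactly supported function, so replacing the factors one coordinate at a time writes the
    difference of two mollifiers as a sum of exact partial derivatives of test functions. Only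
    one-variable calculus and Tonelli are needed for this. In the potential the curve is replaced by
    all points [y] near [x] that are deep enough in the domain. No curve is left in the kernel,
    hence no measurable choice of curves arises, and the exchange of integrals becomes symmetric in
    [x] and [y]. For fixed [y] only scales [t <= 2 d(y) / c] survive the exchange; their geometric
    sum is of order [d(y)], and this is the extra power of [d] on the gradient side. The strict
    dimension hypothesis first yields an admissible exponent [lambda < n + beta p]. Half of the gap
    that is left then pays for the Schur weight, and the other half keeps the exponent of [d] above
    [lambda - n]. *)

Section smooth1.
Context {R : realType}.
Implicit Types a b : R -> R.

Definition smooth1 a := forall m x, derivable (derive1n m a) x 1.

(** A coinduction principle: the closure proofs below exhibit a family stable under differentiation,
    so no formula for higher derivatives is ever computed. *)
Lemma smooth1_coind (P : (R -> R) -> Prop) :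
  (forall a, P a -> (forall x, derivable a x 1) /\ P (derive1 a)) ->
  forall a, P a -> smooth1 a.
Proof.
move=> h a Pa m.
suff : P (derive1n m a) by move=> /h[].
by elim: m => [|m ih]; rewrite ?derive1n0 // derive1nS; have [] := h _ ih.
Qed.

Lemma smooth1_derive a : smooth1 a -> smooth1 (derive1 a).
Proof. by move=> sa m x; have := sa m.+1 x; rewrite derive1Sn. Qed.

Lemma smooth1_derivable a x : smooth1 a -> derivable a x 1.
Proof. by move=> /(_ 0%N x). Qed.

Lemma smooth1_is_derive a (x : R) : smooth1 a -> is_derive x 1 a (derive1 a x).
Proof. by move=> /smooth1_derivable da; apply: DeriveDef; rewrite ?derive1E. Qed.

Lemma smooth1_continuous a : smooth1 a -> continuous a.
Proof.
move=> sa x; apply/differentiable_continuous/derivable1_diffP.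
exact: smooth1_derivable.
Qed.

Lemma is_derive_affine a (c s x : R) : derivable a (s * (x - c)) 1 ->
  is_derive x 1 (fun x => a (s * (x - c))) (derive1 a (s * (x - c)) * s).
Proof.
move=> da; apply: (@is_derive1_comp _ a (fun y => s * (y - c))).
  by apply: DeriveDef; rewrite ?derive1E.
rewrite -[X in is_derive _ _ _ X]mulr1; apply: is_deriveZ.
by rewrite -[X in is_derive _ _ _ X]subr0; apply: is_deriveB.
Qed.

Lemma smooth1_affine a (c s : R) : smooth1 a -> smooth1 (fun x => a (s * (x - c))).
Proof.
move=> sa.
pose P b := exists m k, b = fun x => k * derive1n m a (s * (x - c)).
apply: (@smooth1_coind P) => [_ [m [k ->]]|]; last first.
  by exists 0%N, 1; apply/funext => x; rewrite derive1n0 mul1r.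
have D (x : R) : is_derive x 1 (fun x => k * derive1n m a (s * (x - c)))
    (k * (derive1n m.+1 a (s * (x - c)) * s)).
  by apply: is_deriveZ; rewrite derive1nS; exact/is_derive_affine/sa.
split=> [x|]; first by have [] := D x.
exists m.+1, (k * s); apply/funext => x; rewrite derive1E; have [_ ->] := D x.
by rewrite mulrCA [in RHS]mulrAC -mulrA; ring.
Qed.

Lemma smooth1_cst (k : R) : smooth1 (cst k).
Proof.
apply: (@smooth1_coind (fun a => exists k, a = cst k)); last by exists k.
move=> _ [l ->]; split=> [x|]; first exact: derivable_cst.
by exists 0; apply/funext => x; rewrite derive1_cst.
Qed.

Lemma smooth1B a b : smooth1 a -> smooth1 b -> smooth1 (fun x => a x - b x).
Proof.
move=> sa sb; pose P c := exists a b, [/\ smooth1 a, smooth1 b & c = fun x => a x - b x].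
apply: (@smooth1_coind P) => [_ [a1 [b1 [sa1 sb1 ->]]]|]; last by exists a, b.
have D (x : R) : is_derive x 1 (fun x => a1 x - b1 x) (derive1 a1 x - derive1 b1 x).
  by apply: is_deriveB; exact: smooth1_is_derive.
split=> [x|]; first by have [] := D x.
exists (derive1 a1), (derive1 b1); split; try exact: smooth1_derive.
by apply/funext => x; rewrite derive1E; have [_ ->] := D x.
Qed.

(** Products are not stable under differentiation, but finite sums of products are: the Leibniz rule
    turns a sum of [m] products into a sum of [m + m]. *)
Lemma smooth1M a b : smooth1 a -> smooth1 b -> smooth1 (a * b).
Proof.
move=> sa sb.
pose P c := exists m (u v : 'I_m -> R -> R), [/\ forall i, smooth1 (u i),
  forall i, smooth1 (v i) & c = fun x => \sum_i u i x * v i x].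
apply: (@smooth1_coind P) => [_ [m [u [v [su sv ->]]]]|]; last first.
  exists 1%N, (fun=> a), (fun=> b); split => //.
  by apply/funext => x; rewrite big_ord1.
have D (x : R) : is_derive x 1 (fun x => \sum_i u i x * v i x)
   (\sum_i (u i x * derive1 (v i) x + derive1 (u i) x * v i x)).
  have -> : (fun x => \sum_i u i x * v i x) = \sum_i (u i * v i).
    by apply/funext => y; rewrite fct_sumE.
  apply: is_derive_sum => i; rewrite [derive1 (u i) x * _]mulrC.
  exact: is_deriveM (smooth1_is_derive x (su i)) (smooth1_is_derive x (sv i)).
split=> [x|]; first by have [] := D x.
exists (m + m)%N,
  (fun i : 'I_(m + m) => match fintype.split i with inl j => u j | inr j => derive1 (u j) end),
  (fun i : 'I_(m + m) => match fintype.split i with inl j => derive1 (v j) | inr j => v j end); split.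
- by move=> i; case: (fintype.split i) => j; [exact: su|apply: smooth1_derive; exact: su].
- by move=> i; case: (fintype.split i) => j; [apply: smooth1_derive; exact: sv|exact: sv].
apply/funext => x; rewrite derive1E; have [_ ->] := D x.
rewrite big_split_ord big_split/=; congr (_ + _); apply: eq_bigr => j _.
  by rewrite -[lshift m j]/(unsplit (inl j)) unsplitK.
by rewrite -[rshift m j]/(unsplit (inr j)) unsplitK.
Qed.

(* This family is stable under differentiation, even at [0], which makes its members smooth. *)
Definition flat (P : {poly R}) (x : R) : R :=
  if 0 < x then P.[x^-1] * expR (- x^-1) else 0.

(** The exponent [m] is kept general in the induction on [P]: a factor [t] of the polynomial is
    moved into [t ^+ m], and the constant coefficient is handled by [t ^+ m <= m! * exp t]. *)
Lemma poly_le_expR (P : {poly R}) m :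
  exists2 C : R, 0 <= C & forall t, 0 <= t -> `|P.[t]| * t ^+ m <= C * expR t.
Proof.
elim/poly_ind: P m => [|P c ih] m.
  by exists 0 => // t t0; rewrite horner0 normr0 !mul0r.
have [C C0 h] := ih m.+1.
exists (C + `|c| * m`!%:R); first by rewrite addr_ge0// mulr_ge0.
move=> t t0; rewrite !hornerE.
have tm : t ^+ m <= m`!%:R * expR t.
  case: m {h} => [|m]; first by rewrite expr0 fact0 mul1r -expR0 ler_expR.
  rewrite mulrC -ler_pdivrMr ?ltr0n ?fact_gt0//.
  by apply: le_trans (expR_ge1Dxn m t0); rewrite lerDr.
apply: (@le_trans _ _ (`|P.[t] * t| * t ^+ m + `|c| * t ^+ m)).
  by rewrite -mulrDl ler_wpM2r ?exprn_ge0// ler_normD.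
rewrite normrM (ger0_norm t0) -mulrA -exprS mulrDl lerD ?h//.
by rewrite -mulrA ler_wpM2l.
Qed.

(** This is [poly_le_expR] at [t = x^-1] with [m = 2]. It yields continuity of flat functions at 0,
    and later a crude bound on [bump0]. *)
Lemma flat_bound (P : {poly R}) :
  exists2 C : R, 0 <= C & forall x, `|flat P x| <= C * x ^+ 2.
Proof.
have [C C0 h] := poly_le_expR P 2; exists C => // x.
rewrite /flat; case: ifPn => x0; last by rewrite normr0 mulr_ge0// sqr_ge0.
have ix0 : 0 <= x^-1 by rewrite invr_ge0 ltW.
have := h _ ix0; rewrite -ler_pdivlMr ?exprn_gt0 ?invr_gt0//.
rewrite exprVn invrK => Hx.
rewrite normrM (ger0_norm (expR_ge0 _)) expRN ler_pdivrMr ?expR_gt0//.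
by rewrite mulrAC.
Qed.

(** For [x > 0] the chain rule produces the polynomial [X^2 (P - P')] in [x^-1]. At 0 the difference
    quotient of [flat P] is [flat ('X * P)], which tends to 0 by [flat_bound]; Caratheodory's form
    of differentiability uses exactly this quotient. *)
Lemma is_derive_flat P (x : R) :
  is_derive x 1 (flat P) (flat ('X^2 * (P - P^`())) x).
Proof.
have [x0|x0|x0] := ltgtP 0 x.
- apply: (@near_eq_is_derive R R^o R^o (fun x => P.[x^-1] * expR (- x^-1))).
    near=> y; rewrite /flat ifT//; near: y; exact: lt_nbhsr.
  have xn0 : x != 0 by rewrite gt_eqF.
  have iV : is_derive x 1 (fun y : R => y^-1) (- x ^- 2 *: 1) by exact: is_deriveV.
  have iP : is_derive x 1 (horner P \o (fun y : R => y^-1)) (P^`().[x^-1] * (- x ^- 2 *: 1)).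
    exact: is_derive1_comp.
  have iE : is_derive x 1 (expR \o (fun y : R => - y^-1))
      (expR (- x^-1) * (- (- x ^- 2 *: 1))).
    exact: is_derive1_comp.
  have := is_deriveM iP iE; rewrite /flat x0 => h; apply: is_derive_eq => //.
  rewrite /GRing.scale/= !mulr1 hornerM hornerXn hornerD hornerN -!exprVn; ring.
- apply: (@near_eq_is_derive R R^o R^o (cst 0)).
    near=> y; rewrite /flat ifF//; apply/negbTE; rewrite -leNgt ltW//; near: y.
    exact: lt_nbhsl.
  by rewrite /flat ltNge (ltW x0)/=; exact: is_derive_cst.
- rewrite -x0; apply/is_derive1_caratheodory; exists (flat ('X * P)); split.
  + move=> z; rewrite /flat ltxx !subr0; case: ifPn => z0; last by rewrite mul0r.
    by rewrite !hornerE mulrAC [z^-1 * _]mulrC divfK ?gt_eqF.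
  + have [C C0 h] := flat_bound ('X * P).
    have f0 : flat ('X * P) 0 = 0 by rewrite /flat ltxx.
    suff : `|flat ('X * P) y| @[y --> (0 : R)] --> (0 : R).
      by move/norm_cvg0P; rewrite -[X in _ --> X]f0.
    apply: (@squeeze_cvgr _ _ _ _ (cst 0) (fun x => C * x ^+ 2)).
    * by near=> y; rewrite normr_ge0 h.
    * exact: cvg_cst.
    * rewrite [X in _ --> X](_ : _ = C * 0 ^+ 2); last by rewrite expr0n mulr0.
      apply: cvgM; first exact: cvg_cst.
      exact: exprn_continuous.
  + by rewrite /flat ltxx.
Unshelve. all: by end_near. Qed.

Lemma smooth1_flat P : smooth1 (flat P).
Proof.
apply: (@smooth1_coind (fun a => exists P, a = flat P)); last by exists P.
move=> _ [Q ->]; split=> [x|]; first by have [] := is_derive_flat Q x.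
by eexists; apply/funext => x; rewrite derive1E; have [_ ->] := is_derive_flat Q x.
Qed.

(** On []-1, 1[] this is the classical bump [exp (-2 / (1 - x^2))]. The arguments have the shape
    [s * (x - c)] of [smooth1_affine]. *)
Definition bump0 (x : R) : R := flat 1 (1 * (x - -1)) * flat 1 (-1 * (x - 1)).

Lemma smooth1_bump0 : smooth1 bump0.
Proof.
by apply: smooth1M; apply: smooth1_affine; exact: smooth1_flat.
Qed.

Lemma flat1_ge0 x : 0 <= flat 1 x.
Proof. by rewrite /flat; case: ifP => // _; rewrite hornerC mul1r expR_ge0. Qed.

Lemma bump0_ge0 x : 0 <= bump0 x.
Proof. by rewrite mulr_ge0// flat1_ge0. Qed.

Lemma bump0_gt0 x : -1 < x < 1 -> 0 < bump0 x.
Proof.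
move=> /andP[x1 x2]; rewrite /bump0 /flat !ifT; try lra.
by rewrite !hornerC !mul1r mulr_gt0// expR_gt0.
Qed.

Lemma bump0_eq0 x : 1 <= `|x| -> bump0 x = 0.
Proof.
move=> x1; have {x1} : x <= -1 \/ 1 <= x.
  by move: x1; rewrite ler_normr => /orP[]; [right|left]; lra.
rewrite /bump0 /flat => -[] h; first by rewrite ifF ?mul0r//; apply/negbTE; lra.
by rewrite [X in _ * X]ifF ?mulr0//; apply/negbTE; lra.
Qed.

End smooth1.

(** * A smooth step function *)

Section step.
Context {R : realType}.
Notation mu1 := (@lebesgue_measure R).

Lemma integrable_bump0 : mu1.-integrable setT (EFin \o @bump0 R).
Proof.
have -> : (EFin \o @bump0 R) = (EFin \o @bump0 R) \_ `[-1, 1]%classic.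
  apply/funext => x; rewrite patchE; case: ifPn => // /negP h.
  rewrite /= bump0_eq0//; rewrite leNgt; apply/negP => x1; apply: h.
  by rewrite inE/= in_itv/= -ler_norml ltW.
rewrite -integrable_mkcond//; apply: continuous_compact_integrable => //.
  exact: segment_compact.
by apply: continuous_subspaceT; exact/smooth1_continuous/smooth1_bump0.
Qed.

(** The step is the primitive of [bump0] divided by its total mass. The bound on its derivative
    later becomes the sup bound of the mollifiers. *)
Lemma exists_smooth_step : exists S : R -> R,
  [/\ smooth1 S, forall x, x <= -1 -> S x = 0, forall x, 1 <= x -> S x = 1,
      forall x, 0 <= S x <= 1 &
      (forall x, 0 <= derive1 S x) /\ exists M, forall x, derive1 S x <= M].
Proof.
pose b := @bump0 R; pose I := Rintegral mu1 setT b.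
have ib := integrable_bump0; have cb := smooth1_continuous (@smooth1_bump0 R).
have mb : measurable_fun setT b by exact: continuous_measurable_fun.
have ibS (A : set R) : measurable A -> mu1.-integrable A (EFin \o b).
  by move=> mA; exact: integrableS ib.
pose F x := Rintegral mu1 [set` `]-oo, x]] b.
have dF x : derivable F x 1 /\ derive1 F x = b x.
  by apply: (@continuous_FTC1 _ b -oo%O x (x + 1)); rewrite ?ltrDl//; [exact: ibS|exact: ltNyr|exact: cb].
have IA (A : set R) : measurable A -> 0 <= Rintegral mu1 A b <= I.
  move=> mA; rewrite /I /Rintegral; apply/andP; split.
    by apply/fine_ge0/integral_ge0 => x _; rewrite lee_fin bump0_ge0.
  apply: fine_le; rewrite ?integrable_fin_num//; [exact: ibS| ].
  apply: ge0_subset_integral => //; first exact/measurable_EFinP.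
  by move=> x _; rewrite lee_fin bump0_ge0.
have F0 x : x <= -1 -> F x = 0.
  move=> x1; rewrite /F (@eq_Rintegral _ _ _ mu1 _ (cst 0)); first by rewrite Rintegral_cst//= mul0r.
  move=> y; rewrite inE/= in_itv/= => yx; apply: bump0_eq0.
  by rewrite ler_normr; apply/orP; right; lra.
have F1 x : 1 <= x -> F x = I.
  move=> x1; rewrite /F /I /Rintegral integral_mkcond; congr fine.
  apply: eq_integral => y _; rewrite patchE; case: ifPn => // /negP h.
  congr EFin; apply/esym/bump0_eq0; rewrite ler_normr; apply/orP; left; rewrite leNgt.
  by apply/negP => y1; apply: h; rewrite inE/= in_itv/=; lra.
(* If the mass were 0, the primitive [F] would vanish identically, and so would its derivative at 0,
   which is [b 0 > 0]. *)
have I0 : 0 < I.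
  have /andP[I0 _] := IA _ measurableT; rewrite lt_neqAle I0 andbT; apply/eqP => I00.
  have Fz x : F x = 0.
    have /andP[h1 h2] := IA [set` `]-oo, x]] (measurable_itv _).
    by apply/eqP; rewrite eq_le h1 andbT I00.
  have Fc : F = cst 0 by apply/funext.
  have [_] := dF 0; rewrite Fc derive1_cst => /esym/eqP.
  by apply/negP; rewrite gt_eqF// bump0_gt0// ltrN10 ltr01.
have dS (x : R) : is_derive x 1 (I^-1 *: F) (I^-1 * b x).
  by apply: is_deriveZ; have [? h] := dF x; apply: DeriveDef; rewrite -?derive1E.
have dSE : derive1 (I^-1 *: F) = fun x => I^-1 * b x.
  by apply/funext => x; rewrite derive1E; have [_ ->] := dS x.
have sb : smooth1 (fun x => I^-1 * b x).
  by apply: (@smooth1M _ (cst I^-1) b); [exact: smooth1_cst|exact: smooth1_bump0].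
exists (I^-1 *: F); split.
- move=> [|m] x; first by have [] := dS x.
  by rewrite derive1Sn dSE; exact: sb.
- by move=> x /F0 h; rewrite -[LHS]/(I^-1 * F x) h mulr0.
- by move=> x /F1 h; rewrite -[LHS]/(I^-1 * F x) h mulVf ?gt_eqF.
- move=> x; have /andP[h1 h2] := IA [set` `]-oo, x]] (measurable_itv _).
  rewrite -[(I^-1 *: F) x]/(I^-1 * F x) mulr_ge0 ?invr_ge0 ?(ltW I0)//=.
  by rewrite ler_pdivrMl ?mulr1.
split=> [x|]; first by rewrite dSE mulr_ge0 ?bump0_ge0// invr_ge0 ltW.
(* For [x] in []-1, 1[] both factors of [b] are evaluated at points of []0, 2[], where [flat_bound]
   gives at most [C * 4]. *)
have [M [_ hM]] : exists M, 0 <= M /\ forall x, b x <= M.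
  have [C C0 hC] := @flat_bound R 1.
  exists ((C * 4) * (C * 4)); split; first by rewrite !mulr_ge0.
  move=> x; have [x1|x1] := leP 1 `|x|; first by rewrite /b bump0_eq0// !mulr_ge0.
  move: x1; rewrite ltr_norml => /andP[x1 x2].
  rewrite /b /bump0 ler_pM ?flat1_ge0// (le_trans (ler_norm _))// (le_trans (hC _))// ler_wpM2l//; nra.
by exists (I^-1 * M) => x; rewrite dSE ler_wpM2l// invr_ge0 ltW.
Qed.
End step.

(** * Product functions and boxes in R^n *)

Section tensor.
Context {R : realType} {n : nat}.
Implicit Types (a b : 'I_n -> R -> R) (x y z : 'rV[R]_n).

Definition tensor a y : R := \prod_(i < n) a i (y 0 i).

Definition cbox z (s : R) : set 'rV[R]_n :=
  [set y | forall i, `|y 0 i - z 0 i| <= s].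

Lemma continuous_tensor a : (forall i, continuous (a i)) -> continuous (tensor a).
Proof.
move=> ca; apply: continuous_big => [z|i _ y]; first exact: mul_continuous.
apply: (@continuous_comp _ _ _ (fun y : 'rV[R]_n => y 0 i) (a i)); last exact: ca.
exact: coord_continuous.
Qed.

Lemma is_derive_tensor a i y : smooth1 (a i) ->
  is_derive y (delta_mx 0 i) (tensor a)
    (tensor (fun k => if k == i then derive1 (a k) else a k) y).
Proof.
move=> sa; pose c := \prod_(k < n | k != i) a k (y 0 k).
pose g (h : R) := c * a i (1 * (h - - y 0 i)).
have gE : (fun h : R => tensor a (h *: delta_mx 0 i + y)) = g.
  apply/funext => h; rewrite /tensor (bigD1 i)//= mulrC /g; congr (_ * _).
    by apply: eq_bigr => k ki; rewrite !mxE eqxx/= (negbTE ki) mulr0 add0r.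
  by rewrite !mxE !eqxx mulr1 mul1r opprK.
have dg : is_derive (0 : R) 1 g (c * derive1 (a i) (y 0 i)).
  apply: is_deriveZ.
  have := @is_derive_affine R (a i) (- y 0 i) 1 0 (smooth1_derivable sa).
  by rewrite sub0r opprK mul1r mulr1.
have -> : tensor (fun k => if k == i then derive1 (a k) else a k) y = c * derive1 (a i) (y 0 i).
  rewrite /tensor (bigD1 i)//= eqxx mulrC; congr (_ * _).
  by apply: eq_bigr => k /negbTE ->.
apply: DeriveDef; first by apply: (derivable1P _ _ _).2; rewrite gE; have [] := dg.
have [_ <-] := dg; rewrite -gE /derive.
apply: (congr1 (fun f : R -> R => lim (f h @[h --> 0^']))); apply/funext => h /=.
by rewrite addr0 scale0r add0r [_%:A]mulr1.
Qed.

Lemma partial_derivative_tensor a i : smooth1 (a i) ->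
  partial_derivative i (tensor a) =
  tensor (fun k => if k == i then derive1 (a k) else a k).
Proof.
by move=> sa; apply/funext => y; have [_] := is_derive_tensor y sa.
Qed.

(** A partial derivative of a product function is again a product function with smooth factors, so
    iterated partial derivatives never leave this class. *)
Lemma smooth_tensor a : (forall i, smooth1 (a i)) -> smooth (tensor a).
Proof.
move=> sa s /=.
have [b [sb ->]] : exists b, (forall i, smooth1 (b i)) /\
    foldr partial_derivative (tensor a) s = tensor b.
  elim: s => [|i s [b [sb /= ->]]]; first by exists a.
  exists (fun k => if k == i then derive1 (b k) else b k); split.
    by move=> k; case: ifP => // _; exact: smooth1_derive.
  exact: partial_derivative_tensor.
split; first by apply: continuous_tensor => i; exact: smooth1_continuous.
by move=> i y; have [] := is_derive_tensor y (sb i).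
Qed.

Lemma closed_cbox z s : closed (cbox z s).
Proof.
have -> : cbox z s = \bigcap_(i in setT)
    ((fun y : 'rV[R]_n => `|y 0 i - z 0 i|) @^-1` [set t | t <= s]).
  by apply/seteqP; split => y /= h i; [move=> _|]; apply: h.
apply: closed_bigI => i _; apply: preimage_closed; last exact: closed_le.
move=> y _; apply: (@continuous_comp _ _ _ (fun y : 'rV[R]_n => y 0 i - z 0 i) (fun t : R => `|t|)).
  by apply: continuousB; [exact: coord_continuous|exact: cst_continuous].
exact: norm_continuous.
Qed.

Lemma rV_norm_le x s : 0 <= s -> (forall i, `|x 0 i| <= s) -> `|x| <= s.
Proof.
by move=> s0 h; rewrite [leLHS]mx_normrE; apply/bigmax_leP; split => //= -[j i] _; rewrite ord1.
Qed.

Lemma rV_coord_le_norm x i : `|x 0 i| <= `|x|.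
Proof.
by rewrite [leRHS]mx_normrE; apply/bigmax_geP; right; exists (ord0, i).
Qed.

Lemma compact_cbox z s : compact (cbox z s).
Proof.
apply: bounded_closed_compact; last exact: closed_cbox.
exists (`|s| + `|z|); split; first exact: num_real.
move=> M hM y yz; apply: rV_norm_le => [|i]; first by apply: le_trans (ltW hM); rewrite addr_ge0.
apply: le_trans (ltW hM); rewrite -(subrK (z 0 i) (y 0 i)).
apply: (le_trans (ler_normD _ _)); rewrite lerD//.
  by apply: (le_trans (yz i)); exact: ler_norm.
exact: rV_coord_le_norm.
Qed.

Lemma test_tensor Omega a z s : (forall i, smooth1 (a i)) ->
  (forall i t, s < `|t - z 0 i| -> a i t = 0) -> cbox z s `<=` Omega ->
  test_function Omega (tensor a).
Proof.
move=> sa a0 zO.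
have sup : closure [set y | tensor a y != 0] `<=` cbox z s.
  rewrite [X in _ `<=` X](closure_id _).1; last exact: closed_cbox.
  apply: closure_subset => y /= ty i; rewrite leNgt; apply: contra ty => ti.
  by rewrite /tensor (bigD1 i)//= a0// mul0r.
split; [exact: smooth_tensor| |exact: subset_trans sup zO].
apply: (subclosed_compact _ (@compact_cbox z s)) => //; exact: closed_closure.
Qed.

End tensor.

(** * Measurability and integration of product functions *)

Section rV_measure.
Context {R : realType}.
Notation mu := (@lebesgue_rV R _).

Lemma continuous_measurable_rV n (f : 'rV[R]_n -> R) :
  continuous f -> measurable_fun setT f.
Proof.
move=> cf; apply: (measurability _ (RGenOpens.measurableE R)) => _ [_ [a [b ->]] <-].
rewrite setTI; apply: open_measurable_rV; apply: open_comp; last exact: interval_open.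
by move=> x _; exact: cf.
Qed.

Lemma measurable_cbox n (z : 'rV[R]_n) s : measurable (cbox z s).
Proof.
rewrite -[cbox z s]setCK; apply: measurableC; apply: open_measurable_rV.
exact/closed_openC/closed_cbox.
Qed.

Lemma lebesgue_cbox n (z : 'rV[R]_n) s : 0 <= s ->
  mu (cbox z s) = ((s *+ 2) ^+ n)%:E.
Proof.
move=> s0.
have -> : cbox z s = [set y : 'rV[R]_n | forall i, `[z 0 i - s, z 0 i + s]%classic (y 0 i)].
  by apply/seteqP; split => y h i; have := h i; rewrite /= in_itv/= ler_distl.
rewrite (lebesgue_rV_box (fun=> measurable_itv _)).
rewrite (eq_bigr (fun=> (s *+ 2)%:E)).
  rewrite -[RHS]/((s *+ 2) ^+ n)%:E; elim: n {z} => [|n ih]; first by rewrite big_ord0.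
  by rewrite big_ord_recl ih exprS EFinM.
move=> i _; rewrite lebesgue_measure_itv/= lte_fin.
have [s1|] := ltP (z 0 i - s) (z 0 i + s).
  by rewrite -EFinD; congr EFin; rewrite mulr2n; ring.
move=> s1; have -> : s = 0 by lra.
by rewrite mul0rn.
Qed.

Lemma integral_cst_cbox n (z : 'rV[R]_n) (s r : R) : 0 <= s ->
  (\int[mu]_(_ in cbox z s) r%:E = (r * (s *+ 2) ^+ n)%:E)%E.
Proof.
move=> s0; rewrite EFinM -(lebesgue_cbox z s0).
exact: (integral_cst (@lebesgue_rV R n) (@measurable_cbox n z s) r%:E).
Qed.

(** The measure in dimension [n.+1] is the image under [rV_cons] of a product measure, so Tonelli
    splits off the first coordinate. *)
Lemma ge0_integral_tensor n (a : 'I_n -> R -> R) :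
  (forall i, measurable_fun setT (a i)) -> (forall i t, 0 <= a i t) ->
  (\int[mu]_y (tensor a y)%:E =
   \prod_(i < n) \int[lebesgue_measure]_t (a i t)%:E)%E.
Proof.
elim: n a => [|n ih] a ma a0.
  rewrite big_ord0 integral_dirac//= ?diracT ?mul1e /tensor ?big_ord0//.
  by under eq_fun do rewrite big_ord0; exact: measurable_cst.
have mt m (b : 'I_m -> R -> R) : (forall i, measurable_fun setT (b i)) ->
    measurable_fun setT (tensor b).
  move=> mb; apply: measurable_prod => i _.
  by apply: (measurableT_comp (mb i)); exact: measurable_rV_coord.
have t0 m (b : 'I_m -> R -> R) y : (forall i t, 0 <= b i t) -> 0 <= tensor b y.
  by move=> b0; exact: prodr_ge0.
pose P : {measure set (measurableTypeR R * 'rV[R]_n) -> \bar R} := (lebesgue_measure \x @lebesgue_rV R n)%E.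
have PE : @lebesgue_rV R n.+1 = pushforward P (@rV_cons R n) by [].
apply: etrans.
  apply: (@ge0_integral_pushforward _ _ (measurableTypeR R * 'rV[R]_n)%type _ R
    _ (@measurable_rV_cons R n) P setT (EFin \o tensor a)) => //.
    by apply/measurable_EFinP; exact: mt.
  by move=> y _; rewrite /= lee_fin t0.
rewrite preimage_setT.
pose a' i := a (lift ord0 i).
have mta : measurable_fun setT (tensor a') by apply: mt => i; exact: ma.
under eq_integral => z _.
  rewrite /= /tensor big_ord_recl rV_cons0.
  under eq_bigr do rewrite rV_consS.
  rewrite -/(tensor a' z.2); over.
rewrite fubini_tonelli1//=; last 2 first.
- apply/measurable_EFinP; apply: measurable_funM.
    exact: (measurableT_comp (ma ord0) measurable_fst).
  exact: (measurableT_comp mta measurable_snd).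
- by move=> z; rewrite lee_fin mulr_ge0// t0// => i t; exact: a0.
rewrite /fubini_F/= big_ord_recl.
under eq_integral => x _.
  under eq_integral do rewrite EFinM.
  rewrite ge0_integralZl_EFin//; last 2 first.
  - by move=> y _; rewrite lee_fin t0// => i t; exact: a0.
  - exact/measurable_EFinP.
  rewrite ih; [|by move=> i; exact: ma|by move=> i t; exact: a0].
  over.
rewrite /= ge0_integralZr//.
- by apply/measurable_EFinP; exact: ma.
- by move=> x _; rewrite lee_fin.
- by apply: prode_ge0 => i _; apply: integral_ge0 => t _; rewrite lee_fin; exact: a0.
Qed.

End rV_measure.

(** * Mollifiers and weak gradients *)

Section mollifier.
Context {R : realType}.
Notation mu := (@lebesgue_rV R _).

Definition smooth_step : R -> R := sval (cid (@exists_smooth_step R)).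

Let stepP := svalP (cid (@exists_smooth_step R)).

Lemma smooth1_step : smooth1 smooth_step. Proof. by have [] := stepP. Qed.

Lemma step_eq0 x : x <= -1 -> smooth_step x = 0.
Proof. by have [_ h _ _ _] := stepP; exact: h. Qed.

Lemma step_eq1 x : 1 <= x -> smooth_step x = 1.
Proof. by have [_ _ h _ _] := stepP; exact: h. Qed.

Lemma step_itv x : 0 <= smooth_step x <= 1.
Proof. by have [_ _ _ h _] := stepP; exact: h. Qed.

Lemma derive_step_ge0 x : 0 <= derive1 smooth_step x.
Proof. by have [_ _ _ _ [h _]] := stepP; exact: h. Qed.

Lemma derive_step_bounded : exists2 M : R, 0 < M & forall x, derive1 smooth_step x <= M.
Proof.
have [_ _ _ _ [_ [M h]]] := stepP; exists (`|M| + 1); first by rewrite ltr_wpDl.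
by move=> x; rewrite (le_trans (h x))// (le_trans (ler_norm _))// lerDl.
Qed.

Lemma derive_step_eq0 x : 1 < `|x| -> derive1 smooth_step x = 0.
Proof.
rewrite ltr_normr => x1.
have [k hk] : exists k, \near x, cst k x = smooth_step x.
  case/orP: x1 => x1; [exists 1|exists 0]; near=> y.
    rewrite step_eq1// ltW//; near: y; exact: lt_nbhsr.
  by rewrite step_eq0// ltW//; near: y; apply: lt_nbhsl; lra.
rewrite derive1E -(@near_eq_derive _ R^o R^o _ _ _ _ hk).
exact: (@derive_cst R R^o R^o).
Unshelve. all: by end_near. Qed.

(** A rise from 0 to 1 across [[c - r, c + r]]. Its derivative [rbump c r] is then a kernel of mass
    one at centre [c] and radius [r], with an explicit primitive: the difference of two ramps
    vanishes away from both intervals and differentiates to the difference of two kernels. *)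
Definition ramp (c r t : R) := smooth_step (r^-1 * (t - c)).

Definition rbump (c r : R) := derive1 (ramp c r).

Lemma smooth1_ramp c r : smooth1 (ramp c r).
Proof. exact/smooth1_affine/smooth1_step. Qed.

Lemma smooth1_rbump c r : smooth1 (rbump c r).
Proof. exact/smooth1_derive/smooth1_ramp. Qed.

Lemma rbumpE c r t : rbump c r t = derive1 smooth_step (r^-1 * (t - c)) * r^-1.
Proof.
rewrite /rbump derive1E.
by have [_ ->] := @is_derive_affine R smooth_step c r^-1 t (smooth1_derivable smooth1_step).
Qed.

Lemma ramp_eq0 c r t : 0 < r -> t <= c - r -> ramp c r t = 0.
Proof. by move=> r0 tc; rewrite /ramp step_eq0// ler_pdivrMl//; lra. Qed.

Lemma ramp_eq1 c r t : 0 < r -> c + r <= t -> ramp c r t = 1.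
Proof. by move=> r0 tc; rewrite /ramp step_eq1// ler_pdivlMl//; lra. Qed.

Lemma rbump_ge0 c r t : 0 < r -> 0 <= rbump c r t.
Proof. by move=> r0; rewrite rbumpE mulr_ge0 ?derive_step_ge0// invr_ge0 ltW. Qed.

Lemma rbump_eq0 c r t : 0 < r -> r < `|t - c| -> rbump c r t = 0.
Proof.
move=> r0 rt; rewrite rbumpE derive_step_eq0 ?mul0r//.
by rewrite normrM gtr0_norm ?invr_gt0// ltr_pdivlMl// mulr1.
Qed.

Lemma integral_rbump c r : 0 < r ->
  (\int[lebesgue_measure]_t (rbump c r t)%:E = 1)%E.
Proof.
move=> r0.
have ab : c - r < c + r by lra.
have cb := smooth1_continuous (@smooth1_rbump c r).
have cr := smooth1_continuous (@smooth1_ramp c r).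
transitivity ((ramp c r (c + r))%:E - (ramp c r (c - r))%:E)%E; last first.
  by rewrite (@ramp_eq0 c r (c - r))// (@ramp_eq1 c r (c + r))// sube0.
rewrite -(@continuous_FTC2 R (rbump c r) (ramp c r) _ _ ab)//; last 2 first.
- exact: continuous_subspaceT.
- split.
  + by move=> x _; exact/smooth1_derivable/smooth1_ramp.
  + exact/cvg_at_right_filter/cr.
  + exact/cvg_at_left_filter/cr.
rewrite [RHS]integral_mkcond; apply: eq_integral => t _; rewrite patchE.
case: ifPn => // /negP h; rewrite rbump_eq0// ltNge ler_distl; apply/negP => h'.
by apply: h; rewrite inE/= in_itv/=.
Qed.

Section rV.
Context {n : nat}.
Implicit Types (z w y : 'rV[R]_n).

Definition mollifier z r := tensor (fun i => rbump (z 0 i) r).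

Lemma continuous_mollifier z r : continuous (mollifier z r).
Proof. by apply: continuous_tensor => i; exact/smooth1_continuous/smooth1_rbump. Qed.

Lemma mollifier_ge0 z r y : 0 < r -> 0 <= mollifier z r y.
Proof. by move=> r0; apply: prodr_ge0 => i _; exact: rbump_ge0. Qed.

Lemma mollifier_eq0 z r y : 0 < r -> ~ cbox z r y -> mollifier z r y = 0.
Proof.
move=> r0 /existsNP[i /negP]; rewrite -ltNge => yi.
by rewrite /mollifier /tensor (bigD1 i)//= rbump_eq0// mul0r.
Qed.

Lemma integral_mollifier z r : 0 < r -> (\int[mu]_y (mollifier z r y)%:E = 1)%E.
Proof.
move=> r0; rewrite ge0_integral_tensor.
- by rewrite big1// => i _; exact: integral_rbump.
- by move=> i; apply: continuous_measurable_fun; exact/smooth1_continuous/smooth1_rbump.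
- by move=> i t; exact: rbump_ge0.
Qed.

End rV.
End mollifier.

(** The factors are exchanged one index at a time: in the [i]-th term those before [i] are already
    new, those after [i] still old. The induction splits off the last factor. *)
Lemma prod_telescope (R : comRingType) n (a b : 'I_n -> R) :
  \prod_(i < n) b i - \prod_(i < n) a i =
  \sum_(i < n) \prod_(k < n) (if (k < i)%N then b k else if k == i then b k - a k else a k).
Proof.
elim: n a b => [|n ih] a b; first by rewrite !big_ord0 subrr.
rewrite !big_ord_recr/= ltnn eqxx.
pose w := widen_ord (leqnSn n).
rewrite [X in _ = X + _](eq_bigr (fun i : 'I_n => (\prod_(k < n)
    (if (k < i)%N then b (w k) else if k == i then b (w k) - a (w k) else a (w k)))
    * a ord_max)); last first.
  move=> i _; rewrite big_ord_recr/= ltnNge (ltnW (ltn_ord i))/= -val_eqE/= gtn_eqF//.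
rewrite -big_distrl/= -(ih (a \o w) (b \o w))/=.
rewrite [X in _ = _ + X * _](eq_bigr (b \o w)); last first.
  by move=> i _; rewrite /= ltn_ord.
by rewrite mulrBl mulrBr [RHS]addrC addrA subrK.
Qed.

Section zero_outside.
Context d (T : measurableType d) (R : realType) (mu : {measure set T -> \bar R}).
Variables (K D : set T) (F : T -> \bar R).
Hypotheses (KD : K `<=` D) (F0 : forall y, ~ K y -> F y = 0%E).

Let FE : F \_ D = F \_ K.
Proof.
apply/funext => y; rewrite !patchE; case: ifPn => yD; case: ifPn => yK //.
  by apply: F0 => Ky; move/negP: yK; apply; rewrite inE.
by move/negP : yD; case; rewrite inE; apply: KD; rewrite -inE.
Qed.

Lemma integral_zero_outside : (\int[mu]_(x in D) F x = \int[mu]_(x in K) F x)%E.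
Proof. by rewrite integral_mkcond FE -integral_mkcond. Qed.

Lemma integrable_zero_outside : measurable K -> measurable D ->
  mu.-integrable K F -> mu.-integrable D F.
Proof.
by move=> mK mD; rewrite (integrable_mkcond _ mK) (integrable_mkcond _ mD) FE.
Qed.

End zero_outside.

(** * The weak gradient tested on differences of mollifiers *)

Section weak_gradient.
Context {R : realType} {n : nat}.
Notation mu := (@lebesgue_rV R n).
Implicit Types (w z y : 'rV[R]_n) (Omega : set 'rV[R]_n) (f : 'rV[R]_n -> R)
  (g : 'rV[R]_n -> 'rV[R]_n).

Lemma locally_integrable_cbox Omega f w s : open Omega -> locally_integrable_rV Omega f ->
  cbox w s `<=` Omega -> mu.-integrable (cbox w s) (EFin \o f).
Proof.
move=> oO [mf If] wO; apply/integrableP; split.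
  by apply/measurable_EFinP; apply: measurable_funS mf => //; exact: open_measurable_rV.
by apply: If => //; exact: compact_cbox.
Qed.

Lemma integrable_mul_cont Omega f (phi : 'rV[R]_n -> R) w s :
  open Omega -> locally_integrable_rV Omega f ->
  cbox w s `<=` Omega -> continuous phi -> (forall y, ~ cbox w s y -> phi y = 0) ->
  mu.-integrable Omega (fun y => (f y * phi y)%:E).
Proof.
move=> oO lf wO cphi phi0.
apply: (integrable_zero_outside wO) => [y /phi0 ->|||]; first by rewrite mulr0.
- exact: measurable_cbox.
- exact: open_measurable_rV.
apply: (@integrableMl _ _ _ _ _ _ (EFin \o f) phi); first exact: measurable_cbox.
- exact: locally_integrable_cbox oO lf wO.
- by apply: measurable_funTS; exact: continuous_measurable_rV.
have : bounded_set (phi @` cbox w s).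
  apply: compact_bounded; apply: continuous_compact; last exact: compact_cbox.
  exact: continuous_subspaceT.
by case=> N [Nr hN]; exists N; split => // M NM y wy; apply: (hN M NM); exists y.
Qed.

(* The difference of the two product mollifiers telescopes over the coordinates into
   a sum of i-th partial derivatives of test functions, the i-th factor of the i-th
   test function being a difference of two ramps. *)
Lemma weak_gradient_mollifier_diff Omega f g z z' w (r r' s M : R) :
  open Omega -> weak_gradient Omega f g -> 0 < r' -> r' <= r ->
  (forall i, `|z 0 i - w 0 i| + r <= s) ->
  (forall i, `|z' 0 i - w 0 i| + r' <= s) ->
  cbox w s `<=` Omega ->
  0 < M -> (forall t, derive1 (@smooth_step R) t <= M) ->
  (`|\int[mu]_(y in Omega) (f y * mollifier z' r' y)%:E -
     \int[mu]_(y in Omega) (f y * mollifier z r y)%:E|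
   <= ((M / r') ^+ n.-1)%:E * \sum_(i < n) \int[mu]_(y in cbox w s) `|g y 0 i|%:E)%E.
Proof.
move=> oO [lf lg wg] r'0 rr' zw zw' wO M0 hM.
have r0 : 0 < r by exact: lt_le_trans rr'.
have mO : measurable Omega by exact: open_measurable_rV.
pose T (i k : 'I_n) := if (k < i)%N then rbump (z' 0 k) r'
  else if k == i then (fun t => ramp (z' 0 k) r' t - ramp (z 0 k) r t) else rbump (z 0 k) r.
have sT i k : smooth1 (T i k).
  rewrite /T; case: ifP => _; first exact: smooth1_rbump.
  case: ifP => _; last exact: smooth1_rbump.
  by apply: smooth1B; exact: smooth1_ramp.
have out (c c' rr t : R) : `|c - c'| + rr <= s -> s < `|t - c'| -> rr < `|t - c|.
  by move=> h1 h2; have := ler_distD c t c'; lra.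
have T0 i k t : s < `|t - w 0 k| -> T i k t = 0.
  move=> st; rewrite /T; case: ifP => _.
    by rewrite rbump_eq0//; exact: out _ _ _ _ (zw' k) st.
  case: ifP => _; last by rewrite rbump_eq0//; exact: out _ _ _ _ (zw k) st.
  (* Beyond the common box the two ramps agree: both are 1 on the right and both are 0 on the left.
     A single ramp would not have compact support. *)
  have h1 := out _ _ _ _ (zw k) st; have h2 := out _ _ _ _ (zw' k) st.
  have := zw k; have := zw' k; rewrite -!lerBrDr !ler_distl => /andP[a1 a2] /andP[a3 a4].
  move: st; rewrite ltr_normr => /orP[st|st].
    by rewrite (@ramp_eq1 _ (z' 0 k)) ?(@ramp_eq1 _ (z 0 k)) ?subrr//; lra.
  by rewrite (@ramp_eq0 _ (z' 0 k)) ?(@ramp_eq0 _ (z 0 k)) ?subrr//; lra.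
pose phi i := tensor (T i).
have tphi i : test_function Omega (phi i) by exact: (test_tensor (sT i) (T0 i) wO).
have dphi i y : partial_derivative i (phi i) y = \prod_(k < n)
    (if (k < i)%N then rbump (z' 0 k) r' (y 0 k) else if k == i then
      rbump (z' 0 k) r' (y 0 k) - rbump (z 0 k) r (y 0 k) else rbump (z 0 k) r (y 0 k)).
  rewrite partial_derivative_tensor//; apply: eq_bigr => k _.
  case: (eqVneq k i) => [->|ki].
    rewrite /T ltnn eqxx derive1E deriveB -?derive1E//.
    - exact/smooth1_derivable/smooth1_ramp.
    - exact/smooth1_derivable/smooth1_ramp.
  by rewrite /T (negbTE ki); case: ifP.
have moll_int (x : 'rV[R]_n) (rr : R) : 0 < rr -> (forall i, `|x 0 i - w 0 i| + rr <= s) ->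
    mu.-integrable Omega (fun y => (f y * mollifier x rr y)%:E).
  move=> rr0 xw; apply: (integrable_mul_cont oO lf wO); first exact: continuous_mollifier.
  move=> y wy; apply: mollifier_eq0 => // xy; apply: wy => i.
  by have := xw i; have := xy i; have := ler_distD (x 0 i) (y 0 i) (w 0 i); lra.
have out0 i y : ~ cbox w s y -> phi i y = 0.
  move=> /existsNP[k /negP]; rewrite -ltNge => yk.
  by rewrite /phi /tensor (bigD1 k)//= T0// mul0r.
have out0' i y : ~ cbox w s y -> partial_derivative i (phi i) y = 0.
  move=> /existsNP[k /negP]; rewrite -ltNge => yk.
  rewrite dphi (bigD1 k)//= !rbump_eq0 ?subrr ?mul0r ?if_same ?mul0r//.
  - exact: out _ _ _ _ (zw k) yk.
  - exact: out _ _ _ _ (zw' k) yk.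
have dphi_int i : mu.-integrable Omega (fun y => (f y * partial_derivative i (phi i) y)%:E).
  apply: (integrable_mul_cont oO lf wO); last exact: out0'.
  by have [/(_ [:: i])[]] := tphi i.
rewrite -integralB_EFin//; [|exact: moll_int|exact: moll_int].
have -> : (\int[mu]_(y in Omega) ((f y * mollifier z' r' y)%:E - (f y * mollifier z r y)%:E) =
   \sum_(i < n) \int[mu]_(y in Omega) (f y * partial_derivative i (phi i) y)%:E)%E.
  rewrite -integral_sum//; apply: eq_integral => y _.
  rewrite sumEFin -EFinB -mulrBr /mollifier /tensor prod_telescope mulr_sumr.
  by congr EFin; apply: eq_bigr => i _; rewrite dphi.
apply: (le_trans (lee_abs_sum _ _ _)).
rewrite ge0_sume_distrr; last by move=> i _; exact: integral_ge0.
apply: lee_sum => i _; rewrite wg// abseN.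
rewrite (integral_zero_outside _ wO); last by move=> y wy; rewrite out0// mulr0.
have mgi : measurable_fun (cbox w s) (fun y => g y 0 i).
  by have [mg _] := lg i; apply: measurable_funS mg.
have mphi : measurable_fun (cbox w s) (phi i).
  by apply: measurable_funTS; apply: continuous_measurable_rV; have [/(_ [::])[]] := tphi i.
have mw : measurable (cbox w s) by exact: measurable_cbox.
apply: (le_trans (le_abse_integral _ mw _)).
  by apply/measurable_EFinP; exact: measurable_funM.
rewrite -ge0_integralZl//; last 2 first.
- by apply/measurable_EFinP; exact: measurableT_comp.
- by rewrite lee_fin exprn_ge0// divr_ge0// ltW.
apply: ge0_le_integral => //.
- by apply: measurableT_comp => //; apply/measurable_EFinP; exact: measurable_funM.
- by apply/measurable_EFinP; apply: measurable_funM => //; exact: measurableT_comp.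
move=> y wy; rewrite -EFinM lee_fin normrM mulrC ler_wpM2r//.
rewrite /phi /tensor (bigD1 i)//= normrM.
(* Slot [i] holds a difference of two numbers of [[0, 1]], hence at most 1 in modulus; each of the
   other [n.-1] slots is a kernel bounded by [M / r'], since [r' <= r]. *)
have -> : (M / r') ^+ n.-1 = 1 * \prod_(k < n | k != i) (M / r').
  by rewrite mul1r prodr_const; congr (_ ^+ _); rewrite cardC1 card_ord.
apply: ler_pM => //.
  rewrite /T ltnn eqxx; have /andP[? ?] := step_itv (r'^-1 * (y 0 i - z' 0 i)).
  have /andP[? ?] := step_itv (r^-1 * (y 0 i - z 0 i)).
  by rewrite /ramp ler_norml; lra.
rewrite normr_prod; apply: ler_prod => k ki; rewrite normr_ge0/=.
rewrite /T (negbTE ki).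
have br : M / r <= M / r' by rewrite ler_pM2l// lef_pV2.
case: ifP => _; rewrite ger0_norm ?rbump_ge0// rbumpE.
  by apply: ler_wpM2r => //; rewrite invr_ge0 ltW.
by apply: le_trans br; apply: ler_wpM2r => //; rewrite invr_ge0 ltW.
Qed.

End weak_gradient.

(** * Euclidean norm and distance functions *)

Section enorm.
Context {R : realType} {n : nat}.
Implicit Types (x y z : 'rV[R]_n) (A : set 'rV[R]_n).

Lemma enorm_ge0 x : 0 <= enorm x. Proof. exact: sqrtr_ge0. Qed.

Lemma enorm_sqr x : enorm x ^+ 2 = \sum_i x 0 i ^+ 2.
Proof. by rewrite sqr_sqrtr// sumr_ge0// => i _; exact: sqr_ge0. Qed.

Lemma enormN x : enorm (- x) = enorm x.
Proof. by rewrite /enorm; under eq_bigr do rewrite mxE sqrrN. Qed.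

Lemma enormB x y : enorm (x - y) = enorm (y - x).
Proof. by rewrite -enormN opprB. Qed.

Lemma enorm0 : enorm (0 : 'rV[R]_n) = 0.
Proof. by rewrite /enorm big1 ?sqrtr0// => i _; rewrite mxE expr0n. Qed.

Lemma coord_le_enorm x i : `|x 0 i| <= enorm x.
Proof.
rewrite -(@ler_pXn2r _ 2) ?nnegrE ?enorm_ge0// real_normK ?num_real// enorm_sqr.
by rewrite (bigD1 i)//= lerDl sumr_ge0// => j _; exact: sqr_ge0.
Qed.

Lemma coord_le_enorm_sub x y i : `|x 0 i - y 0 i| <= enorm (x - y).
Proof. by have := coord_le_enorm (x - y) i; rewrite !mxE. Qed.

(** The sharp factor is the square root of [n]; the larger factor [n] keeps roots out of all later
    constants. *)
Lemma enorm_le x (s : R) : 0 <= s -> (forall i, `|x 0 i| <= s) -> enorm x <= n%:R * s.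
Proof.
move=> s0 h; rewrite -(@ler_pXn2r _ 2) ?nnegrE ?enorm_ge0 ?mulr_ge0// enorm_sqr.
apply: (@le_trans _ _ (\sum_(i < n) s ^+ 2)).
  by apply: ler_sum => i _; rewrite -[leLHS]real_normK ?num_real// ler_pXn2r ?nnegrE.
rewrite sumr_const card_ord exprMn -[leLHS]mulr_natl ler_wpM2r ?sqr_ge0//.
by case: n => [|m]; rewrite ?expr0n// ler_eXnr// ler1n.
Qed.

Lemma enorm_eq0 x : enorm x = 0 -> x = 0.
Proof.
move=> x0; apply/rowP => i; rewrite mxE; apply/eqP.
by rewrite -normr_le0 -x0 coord_le_enorm.
Qed.

(** In place of Cauchy-Schwarz, [2 x_i y_i <= t x_i^2 + t^-1 y_i^2] is summed with [t = |y| / |x|],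
    the value for which both sums equal [|x| |y|]. *)
Lemma enorm_triangle x y : enorm (x + y) <= enorm x + enorm y.
Proof.
have [/enorm_eq0 ->|x0] := eqVneq (enorm x) 0; first by rewrite add0r lerDr enorm_ge0.
have [/enorm_eq0 ->|y0] := eqVneq (enorm y) 0; first by rewrite addr0 lerDl enorm_ge0.
have {}x0 : 0 < enorm x by rewrite lt_neqAle eq_sym x0 enorm_ge0.
have {}y0 : 0 < enorm y by rewrite lt_neqAle eq_sym y0 enorm_ge0.
rewrite -(@ler_pXn2r _ 2) ?nnegrE ?addr_ge0 ?enorm_ge0// enorm_sqr sqrrD !enorm_sqr.
pose t := enorm y / enorm x.
have t0 : 0 < t by rewrite divr_gt0.
apply: (@le_trans _ _ (\sum_i (x 0 i ^+ 2 + (t * x 0 i ^+ 2 + t^-1 * y 0 i ^+ 2) + y 0 i ^+ 2))).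
  apply: ler_sum => i _; rewrite mxE sqrrD lerD2r lerD2l.
  rewrite -subr_ge0 (_ : _ - _ = t^-1 * (t * x 0 i - y 0 i) ^+ 2).
    by rewrite mulr_ge0 ?sqr_ge0// invr_ge0 ltW.
  by field; rewrite gt_eqF.
rewrite !big_split/= -!mulr_sumr lerD2r lerD2l -!enorm_sqr.
rewrite (_ : t * _ + _ = enorm x * enorm y *+ 2)//.
by rewrite /t; field; rewrite !gt_eqF.
Qed.

(** For empty [A] the value is 0, by the convention for [inf]; nonnegativity and the Lipschitz bound
    therefore hold for every [A]. *)
Definition infdist A x : R := inf [set enorm (x - y) | y in A].

Let has_inf_dist A x : A !=set0 -> has_inf [set enorm (x - y) | y in A].
Proof.
move=> [y Ay]; split; first by exists (enorm (x - y)), y.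
by exists 0 => _ [z _ <-]; exact: enorm_ge0.
Qed.

Lemma infdist_ge0 A x : 0 <= infdist A x.
Proof.
have [->|/set0P A0] := eqVneq A set0; first by rewrite /infdist image_set0 inf0.
apply: lb_le_inf; first by have [] := has_inf_dist x A0.
by move=> _ [y _ <-]; exact: enorm_ge0.
Qed.

Lemma infdist_le A x y : A y -> infdist A x <= enorm (x - y).
Proof.
move=> Ay; apply: ge_inf; last by exists y.
by have [] := @has_inf_dist A x (ex_intro _ y Ay).
Qed.

Lemma infdist_attained A x (e : R) : A !=set0 -> 0 < e ->
  exists2 y, A y & enorm (x - y) < infdist A x + e.
Proof.
move=> A0 e0; have [_ [y Ay <-] h] := inf_adherent e0 (has_inf_dist x A0).
by exists y.
Qed.

Lemma infdist_lipschitz A x y : infdist A x <= enorm (x - y) + infdist A y.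
Proof.
have [->|/set0P A0] := eqVneq A set0.
  by rewrite /infdist !image_set0 inf0 addr0 enorm_ge0.
apply/ler_addgt0Pr => e e0; have [z Az h] := infdist_attained y A0 e0.
apply: (le_trans (infdist_le x Az)); rewrite -addrA -(subrKA y x).
by apply: (le_trans (enorm_triangle _ _)); rewrite lerD2l ltW.
Qed.

Definition elipschitz (L : R) (phi : 'rV[R]_n -> R) :=
  forall x y, `|phi x - phi y| <= L * enorm (x - y).

Lemma infdist_lipschitz1 A : elipschitz 1 (infdist A).
Proof.
move=> x y; rewrite mul1r ler_distl.
have := infdist_lipschitz A x y; have := infdist_lipschitz A y x; rewrite enormB; lra.
Qed.

Lemma enorm_sub_elipschitz x : elipschitz 1 (fun y => enorm (y - x)).
Proof.
move=> y z; rewrite mul1r ler_distl; have := enorm_triangle (y - z) (z - x).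
by have := enorm_triangle (z - y) (y - x); rewrite !subrKA (enormB z y); lra.
Qed.

Lemma elipschitz_continuous L phi : 0 <= L -> elipschitz L phi -> continuous phi.
Proof.
move=> L0 lip x; apply/(@cvgrPdist_le _ R^o _ (nbhs x)) => e e0.
have L1 : 0 < L * n%:R + 1 by rewrite ltr_wpDl// mulr_ge0.
have d0 : 0 < e / (L * n%:R + 1) by rewrite divr_gt0.
apply/nbhs_ballP; exists (e / (L * n%:R + 1)) => // y /(rV_ballE _ _ d0) xy.
apply: (le_trans (lip x y)).
apply: (@le_trans _ _ (L * (n%:R * (e / (L * n%:R + 1))))).
  rewrite ler_wpM2l// enorm_le ?(ltW d0)// => i.
  by rewrite !mxE ltW//; exact: xy.
by rewrite !mulrA ler_pdivrMr// mulrDr mulr1 [leLHS]mulrC mulrA lerDl ltW.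
Qed.

Lemma infdist_gt0 A x : closed A -> A !=set0 -> ~ A x -> 0 < infdist A x.
Proof.
move=> cA A0 nAx; have : nbhs x (~` A).
  by apply: open_nbhs_nbhs; split => //; exact: closed_openC.
move=> /nbhs_ballP[e /= e0 eA]; apply: (lt_le_trans e0).
apply: lb_le_inf; first by have [] := has_inf_dist x A0.
move=> _ [y Ay <-]; rewrite leNgt; apply/negP => xy; apply: (eA y) => //.
apply/rV_ballE => // i; rewrite /ball/=; apply: le_lt_trans xy.
by have := coord_le_enorm (x - y) i; rewrite !mxE.
Qed.

End enorm.

(** * Approximation by Lipschitz functions and oscillation *)

Section tonelli.
Context {R : realType} {n : nat}.
Notation mu := (@lebesgue_rV R n).
Implicit Types (x y z : 'rV[R]_n).

Lemma cbox_sym x y s : cbox x s y <-> cbox y s x.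
Proof. by split => h i; rewrite distrC; exact: h. Qed.

Lemma measurable_cbox_rel s :
  measurable [set u : 'rV[R]_n * 'rV[R]_n | cbox u.1 s u.2].
Proof.
rewrite [X in measurable X](_ : _ = \bigcap_(i in [set: 'I_n])
    ((fun u : 'rV[R]_n * 'rV[R]_n => `|u.2 0 i - u.1 0 i|) @^-1` [set t | t <= s])).
  apply: fin_bigcap_measurable => // i _.
  rewrite -[X in measurable X]setTI.
  have : measurable_fun setT (fun u : 'rV[R]_n * 'rV[R]_n => `|u.2 0 i - u.1 0 i|).
    apply: measurableT_comp => //; apply: measurable_funB.
      exact: (measurableT_comp (measurable_rV_coord i) measurable_snd).
    exact: (measurableT_comp (measurable_rV_coord i) measurable_fst).
  by apply => //; rewrite -set_itvNyc; exact: measurable_itv.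
by apply/seteqP; split => u /= h i; [move=> _|]; exact: h.
Qed.

(** The relation of lying in the box of radius [s] about the other point is symmetric and
    measurable, so the exchange of integrals keeps the shape of the inner domain. The first
    conclusion alone serves for the measurability of box integrals. *)
Lemma tonelli_cbox (H : 'rV[R]_n * 'rV[R]_n -> \bar R) s :
  measurable_fun setT H -> (forall u, 0 <= H u)%E ->
  measurable_fun setT (fun x => \int[mu]_(y in cbox x s) H (x, y))%E /\
  (\int[mu]_x \int[mu]_(y in cbox x s) H (x, y) =
   \int[mu]_y \int[mu]_(x in cbox y s) H (x, y))%E.
Proof.
move=> mH H0; set E := [set u : 'rV[R]_n * 'rV[R]_n | cbox u.1 s u.2].
have mE : measurable E by exact: measurable_cbox_rel.
have mHE : measurable_fun setT (H \_ E).
  by apply/(measurable_restrictT _ mE); exact: measurable_funTS.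
have HE0 u : (0 <= (H \_ E) u)%E by rewrite patchE; case: ifP.
have E1 : (fun x => \int[mu]_(y in cbox x s) H (x, y))%E = fubini_F mu (H \_ E).
  apply/funext => x; rewrite [LHS]integral_mkcond; apply: eq_integral => y _.
  by rewrite !patchE; congr (if _ then _ else _); apply/idP/idP; rewrite !inE.
have E2 : (fun y => \int[mu]_(x in cbox y s) H (x, y))%E = fubini_G mu (H \_ E).
  apply/funext => y; rewrite [LHS]integral_mkcond; apply: eq_integral => x _.
  rewrite !patchE; congr (if _ then _ else _).
  by apply/idP/idP; rewrite !inE /E/= cbox_sym.
split; first by rewrite E1; exact: measurable_fun_fubini_tonelli_F.
rewrite (congr1 (fun F => integral mu setT F) E1) (congr1 (fun F => integral mu setT F) E2).
by rewrite -fubini_tonelli1// fubini_tonelli2.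
Qed.

End tonelli.

Section lipschitz_dense.
Context {R : realType} {n : nat}.
Notation mu := (@lebesgue_rV R n).
Variable D : set 'rV[R]_n.
Hypotheses (mD : measurable D) (finD : (mu D < +oo)%E).
Implicit Types (h k : 'rV[R]_n -> R).

Definition lip_approx h := forall e : R, 0 < e -> exists L phi,
  [/\ 0 <= L, elipschitz L phi &
   (\int[mu]_(x in D) `|h x - phi x|%:E <= e%:E)%E].

Let mB h k : measurable_fun D h -> measurable_fun D k ->
  measurable_fun D (fun x => `|h x - k x|%:E).
Proof.
by move=> mh mk; apply/measurable_EFinP; apply: measurableT_comp => //; exact: measurable_funB.
Qed.

Lemma integral_dist_triangle h1 h2 h3 : measurable_fun D h1 ->
  measurable_fun D h2 -> measurable_fun D h3 ->
  (\int[mu]_(x in D) `|h1 x - h3 x|%:E <=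
   \int[mu]_(x in D) `|h1 x - h2 x|%:E + \int[mu]_(x in D) `|h2 x - h3 x|%:E)%E.
Proof.
move=> m1 m2 m3.
rewrite -ge0_integralD//; [|exact: mB|exact: mB].
apply: ge0_le_integral => //; [exact: mB| |].
  by apply: emeasurable_funD; exact: mB.
by move=> x _; rewrite -EFinD lee_fin ler_distD.
Qed.

Lemma elipschitz_measurable L (phi : 'rV[R]_n -> R) (A : set 'rV[R]_n) :
  0 <= L -> elipschitz L phi -> measurable_fun A phi.
Proof.
move=> L0 lip; apply: measurable_funTS; apply: continuous_measurable_rV.
exact: elipschitz_continuous lip.
Qed.

Lemma lip_approx_close h : measurable_fun D h ->
  (forall e : R, 0 < e -> exists k, [/\ measurable_fun D k, lip_approx k &
     (\int[mu]_(x in D) `|h x - k x|%:E <= e%:E)%E]) -> lip_approx h.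
Proof.
move=> mh hk e e0; have e20 : 0 < e / 2 by rewrite divr_gt0.
have [k [mk /(_ _ e20)[L [phi [L0 lip kphi]]] hke]] := hk _ e20.
exists L, phi; split => //; have mphi := @elipschitz_measurable _ _ D L0 lip.
apply: (le_trans (integral_dist_triangle mh mk mphi)).
by rewrite [X in (_ <= X%:E)%E]splitr EFinD leeD.
Qed.

Lemma lip_approxD h k : measurable_fun D h -> measurable_fun D k ->
  lip_approx h -> lip_approx k -> lip_approx (fun x => h x + k x).
Proof.
move=> mh mk ah ak e e0; have e20 : 0 < e / 2 by rewrite divr_gt0.
have [L [phi [L0 lip hphi]]] := ah _ e20.
have [L' [psi [L'0 lip' kpsi]]] := ak _ e20.
exists (L + L'), (fun x => phi x + psi x); split; first exact: addr_ge0.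
  move=> x y; rewrite mulrDl opprD addrACA (le_trans (ler_normD _ _))//.
  by rewrite lerD.
have mphi := @elipschitz_measurable _ _ D L0 lip; have mpsi := @elipschitz_measurable _ _ D L'0 lip'.
rewrite [X in (_ <= X%:E)%E]splitr EFinD; apply: le_trans (leeD hphi kpsi).
rewrite -ge0_integralD//; [|exact: mB|exact: mB].
apply: ge0_le_integral => //.
- by apply: mB; exact: measurable_funD.
- by apply: emeasurable_funD; exact: mB.
- by move=> x _; rewrite -EFinD lee_fin opprD addrACA ler_normD.
Qed.

Lemma lip_approxZ c h : measurable_fun D h -> lip_approx h -> lip_approx (fun x => c * h x).
Proof.
move=> mh ah e e0.
have e1 : 0 < e / (`|c| + 1) by rewrite divr_gt0// ltr_wpDl.
have [L [phi [L0 lip hphi]]] := ah _ e1.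
exists (`|c| * L), (fun x => c * phi x); split; first exact: mulr_ge0.
  by move=> x y; rewrite -mulrBr normrM -mulrA ler_wpM2l.
under eq_integral do rewrite -mulrBr normrM EFinM.
rewrite ge0_integralZl_EFin//; last first.
  apply/measurable_EFinP; apply: measurableT_comp => //; apply: measurable_funB => //.
  exact: elipschitz_measurable lip.
apply: (@le_trans _ _ (`|c|%:E * (e / (`|c| + 1))%:E)%E); first by rewrite lee_wpmul2l.
by rewrite -EFinM lee_fin mulrCA ger_pMr// ler_pdivrMr ?ltr_wpDl// mul1r lerDl.
Qed.

(** The Lipschitz functions [min 1 (k * dist (x, complement of U))] converge pointwise to the
    indicator, and the constant 1 dominates because [D] has finite measure. *)
Lemma lip_approx_open (U : set 'rV[R]_n) : open U -> lip_approx \1_U.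
Proof.
move=> oU.
(* When [U] is the whole space, the distance to its empty complement is 0 by convention and the
   approximation would fail; the constant 1 serves instead. *)
have [UT|/set0P U0] := eqVneq (~` U) set0.
  move=> e e0; exists 0, (cst 1); split => // [x y|]; first by rewrite subrr normr0 mul0r.
  rewrite integral0_eq ?lee_fin ?ltW// => x _.
  rewrite indicE mem_set ?subrr ?normr0//.
  by rewrite -[U]setCK UT setC0.
pose phi (k : nat) (x : 'rV[R]_n) := Num.min 1 (k%:R * infdist (~` U) x).
have lphi (k : nat) : elipschitz k%:R (phi k).
  move=> x y; rewrite /phi.
  have := infdist_lipschitz1 (~` U) x y; rewrite mul1r => h.
  apply: (@le_trans _ _ `|k%:R * infdist (~` U) x - k%:R * infdist (~` U) y|).
    have := ler_norm (k%:R * infdist (~` U) x - k%:R * infdist (~` U) y).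
    have := ler_norm (- (k%:R * infdist (~` U) x - k%:R * infdist (~` U) y)).
    rewrite normrN ler_norml /Num.min; do 2 case: ifPn; rewrite -?leNgt; lra.
  by rewrite -mulrBr normrM ger0_norm// ler_wpM2l.
have mphi (k : nat) : measurable_fun D (phi k) by exact: elipschitz_measurable (lphi k).
have m1 : measurable_fun D (\1_U : _ -> R).
  by apply: measurable_funTS; apply: measurable_indic; exact: open_measurable_rV.
have phi_itv (k : nat) x : 0 <= phi k x <= 1.
  rewrite /phi ge_min lexx le_min ler01/= mulr_ge0 ?ler0n//; exact: infdist_ge0.
have cvg : (\int[mu]_(x in D) `|\1_U x - phi k x|%:E @[k --> \oo] -->
            \int[mu]_(x in D) cst 0 x)%E.
  apply: (@dominated_cvg _ _ _ _ _ _ _ _ (cst 1%E)) => //.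
  - by move=> k; apply/measurable_EFinP; apply: measurableT_comp => //; exact: measurable_funB.
  - move=> x _; apply: cvg_near_cst.
    have [xU|xU] := boolP (x \in U).
      have d0 : 0 < infdist (~` U) x.
        by apply: infdist_gt0; [exact: open_closedC|by []|move=> h; apply: h; exact: set_mem].
      exists (Num.truncn (infdist (~` U) x)^-1).+1 => // k /= hk.
      rewrite indicE xU /phi min_l ?subrr ?normr0//.
      rewrite -ler_pdivrMr// div1r; apply: ltW; apply: lt_le_trans (truncnS_gt _) _.
      by rewrite ler_nat.
    near=> k; rewrite indicE (negbTE xU) /phi.
    have -> : infdist (~` U) x = 0.
      apply/eqP; rewrite eq_le infdist_ge0 andbT -[leRHS](@enorm0 R n) -(subrr x).
      by apply: infdist_le => /mem_set; exact/negP.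
    by rewrite mulr0 min_r// subrr normr0.
  - by apply/integrableP; split => //; rewrite /= normr1 integral_cst// mul1e.
  - move=> k x _; rewrite [leLHS]/= normr_id lee_fin; have := phi_itv k x.
    move=> /andP[p1 p2]; rewrite ler_norml indicE.
    by case: (_ \in _) => /=; apply/andP; split; lra.
move=> e e0; move: cvg; rewrite integral0 => /fine_cvgP[fin cvg].
move/cvgrPdist_le : cvg => /(_ e e0) [N1 _ h1]; case: fin => N2 _ h2.
pose k := maxn N1 N2.
exists k%:R, (phi k); split => //.
have := h1 k (leq_maxl _ _); have := h2 k (leq_maxr _ _) => /= f2.
rewrite sub0r normrN => /(le_trans (ler_norm _)) f1.
by rewrite -(fineK f2) lee_fin.
Unshelve. all: by end_near. Qed.

Lemma eq_lip_approx h k : h =1 k -> lip_approx h -> lip_approx k.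
Proof. by move=> /funext ->. Qed.

Let m_indic (A : set 'rV[R]_n) : measurable A -> measurable_fun D (\1_A : _ -> R).
Proof. by move=> mA; apply: measurable_funTS; exact: measurable_indic. Qed.

(** Dynkin's lemma for the open sets, which are stable under intersection and generate the Borel
    sets. Complements subtract indicators; for a disjoint union the finite partial unions are sums
    of indicators and converge by dominated convergence. *)
Lemma lip_approx_indic (A : set 'rV[R]_n) : measurable A -> lip_approx \1_A.
Proof.
move: A; apply: (@dynkin_induction _ 'rV[R]_n (@open 'rV[R]_n) (fun A => lip_approx \1_A)) => //.
- by move=> ? ?; exact: openI.
- by apply: lip_approx_open; exact: openT.
- by move=> U; exact: lip_approx_open.
- move=> S mS aS.
  apply: (@eq_lip_approx (fun x => \1_[set: 'rV[R]_n] x + -1 * \1_S x)).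
    move=> x; rewrite !indicE in_setT in_setC; case: (_ \in _) => /=; lra.
  apply: lip_approxD.
  + exact: m_indic measurableT.
  + by apply: measurable_funM => //; exact: m_indic.
  + by apply: lip_approx_open; exact: openT.
  + by apply: lip_approxZ => //; exact: m_indic.
move=> F mF tF aF.
pose U m := \bigcup_(i in `I_m) F i.
have mU m : measurable (U m) by exact: fin_bigcup_measurable.
have mFF : measurable (\bigcup_k F k) by exact: bigcupT_measurable.
have aU m : lip_approx \1_(U m).
  elim: m => [|m ih].
    by rewrite /U II0 bigcup_set0; apply: lip_approx_open; exact: open0.
  apply: (@eq_lip_approx (fun x => \1_(U m) x + \1_(F m) x)); last first.
    by apply: lip_approxD => //; exact: m_indic.
  move=> x; rewrite !indicE /U.
  have [xm|xm] := pselect (F m x).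
    rewrite (mem_set xm) (mem_set (_ : (\bigcup_(i in `I_m.+1) F i) x)); last by exists m => /=.
    rewrite memNset ?add0r// => -[i /= im Fi].
    by move: tF => /(_ i m I I (ex_intro _ x (conj Fi xm))) im'; rewrite im' ltnn in im.
  rewrite (memNset xm) addr0; congr (nat_of_bool _)%:R; apply/idP/idP; rewrite !inE => -[i /= im Fi].
    by exists i => //=; exact: ltnW.
  exists i => //=; move: im; rewrite ltnS leq_eqVlt => /orP[/eqP im|//].
  by case: xm; rewrite -im.
apply: lip_approx_close; first exact: m_indic.
have cvg : (\int[mu]_(x in D) `|\1_(\bigcup_k F k) x - \1_(U k) x|%:E @[k --> \oo] -->
            \int[mu]_(x in D) cst 0 x)%E.
  apply: (@dominated_cvg _ _ _ _ _ _ _ _ (cst 1%E)) => //.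
  - by move=> k; apply: mB; exact: m_indic.
  - move=> x _; apply: cvg_near_cst.
    have [[i _ Fi]|xU] := pselect ((\bigcup_k F k) x).
      exists i.+1 => // k /= ik; rewrite !indicE !mem_set ?subrr ?normr0//.
        by exists i.
      by exists i.
    near=> k; rewrite !indicE !memNset ?subrr ?normr0// => -[i _ Fi]; apply: xU; exists i => //.
  - by apply/integrableP; split => //; rewrite /= normr1 integral_cst// mul1e.
  - move=> k x _; rewrite [leLHS]/= normr_id lee_fin ler_norml !indicE.
    by case: (_ \in _) => /=; case: (_ \in _) => /=; apply/andP; split; lra.
move=> e e0; move: cvg; rewrite integral0 => /fine_cvgP[fin cvg].
move/cvgrPdist_le : cvg => /(_ e e0) [N1 _ h1]; case: fin => N2 _ h2.
pose k := maxn N1 N2.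
exists \1_(U k); split; [exact: m_indic (mU k)|exact: aU|].
have := h1 k (leq_maxl _ _); have := h2 k (leq_maxr _ _) => /= f2.
rewrite sub0r normrN => /(le_trans (ler_norm _)) f1.
by rewrite -(fineK f2) lee_fin.
Unshelve. all: by end_near. Qed.

Import HBSimple.

(** Simple functions are dense in [L^1], and each is a finite linear combination of indicators. *)
Lemma lip_approx_integrable h : mu.-integrable D (EFin \o h) -> lip_approx h.
Proof.
move=> ih; have [mh _] := integrableP _ _ _ ih; move/measurable_EFinP : mh => mh.
apply: lip_approx_close => // e e0.
have [g [_ _ cvg]] := approximation_sfun_integrable mD ih.
move: cvg => /fine_cvgP[fin cvg].
move/cvgrPdist_le : cvg => /(_ e e0) [N1 _ h1]; case: fin => N2 _ h2.
pose k := maxn N1 N2.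
have := h1 k (leq_maxl _ _); have := h2 k (leq_maxr _ _) => /= f2.
rewrite sub0r normrN => /(le_trans (ler_norm _)) f1.
exists (fun x => g k x); split; last by move: f1; rewrite -lee_fin fineK.
  exact: measurable_funTS.
have [s gs] : exists s : seq R, forall x,
    \sum_(c <- s) c * \1_(g k @^-1` [set c]) x = g k x.
  by exists (finmap.enum_fset (fset_set (range (g k)))) => x; rewrite [RHS]fimfunE fsbig_finite.
apply: (eq_lip_approx gs) => {gs}.
have mI (c : R) : measurable (g k @^-1` [set c]).
  by rewrite -[X in measurable X]setTI; apply: measurable_funP.
have mM (c : R) : measurable_fun D (fun x => c * \1_(g k @^-1` [set c]) x).
  by apply: measurable_funM => //; exact: m_indic.
elim: s => [|c s ih'].
  apply: (@eq_lip_approx \1_set0); first by move=> x; rewrite big_nil indic0.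
  exact: lip_approx_indic.
apply: (@eq_lip_approx (fun x => c * \1_(g k @^-1` [set c]) x +
    \sum_(c <- s) c * \1_(g k @^-1` [set c]) x)); first by move=> x; rewrite big_cons.
apply: lip_approxD => //.
- by apply: measurable_sum => i; exact: mM.
- by apply: lip_approxZ; [exact: m_indic|exact: lip_approx_indic].
Qed.

End lipschitz_dense.

(** * Mean oscillation in L^1 at small scales *)

Section oscillation.
Context {R : realType} {n : nat}.
Notation mu := (@lebesgue_rV R n).
Implicit Types (f : 'rV[R]_n -> R) (D K : set 'rV[R]_n).

Lemma measurable_oscillation f s : measurable_fun setT f ->
  measurable_fun setT (fun x => \int[mu]_(y in cbox x s) `|f y - f x|%:E)%E.
Proof.
move=> mf; have [] := @tonelli_cbox R n (fun u => `|f u.2 - f u.1|%:E) s.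
- apply/measurable_EFinP; apply: measurableT_comp => //; apply: measurable_funB.
    exact: measurableT_comp mf measurable_snd.
  exact: measurableT_comp mf measurable_fst.
- by move=> u; rewrite lee_fin.
- by [].
Qed.

(** With a Lipschitz [phi] close to [f] in [L^1], [|f y - f x|] is at most [|f - phi|] at [y], plus
    [L n s], plus [|f - phi|] at [x]. After Tonelli the first term, like the last, contributes the
    volume [(2 s)^n] of a box times the [L^1] error. *)
Lemma oscillation_small D K f (s0 : R) : measurable D -> measurable K ->
  (mu D < +oo)%E -> measurable_fun setT f -> mu.-integrable D (EFin \o f) ->
  K `<=` D -> 0 < s0 -> (forall x, K x -> cbox x s0 `<=` D) ->
  forall e : R, 0 < e -> exists2 s1 : R, 0 < s1 & forall s, 0 < s -> s <= s1 ->
    (\int[mu]_(x in K) \int[mu]_(y in cbox x s) `|f y - f x|%:E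
     <= (e * s ^+ n)%:E)%E.
Proof.
move=> mD mK finD mf intf KD s00 hK e e0.
have p2 : 0 < (2 : R) ^+ n by rewrite exprn_gt0.
(* Each of the two approximation errors then costs [(2 s)^n * e' = s^n * e / 4], which leaves
   [s^n * e / 2] for the Lipschitz term. *)
pose e' := e / (2 ^+ n * 4); have e'0 : 0 < e' by rewrite divr_gt0// mulr_gt0.
have [L [phi [L0 lip hphi]]] := lip_approx_integrable mD finD intf e'0.
have finK : (mu K < +oo)%E by apply: le_lt_trans finD; rewrite le_measure ?inE.
pose m := fine (mu K).
have mE : mu K = m%:E by rewrite fineK// ge0_fin_numE.
have m0 : 0 <= m by rewrite fine_ge0.
clearbody m.
have e'E : e' * (2 ^+ n * 4) = e by rewrite /e'; field; rewrite gt_eqF.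
clearbody e'.
(* For [s <= e / c] the Lipschitz term, integrated over [K] of measure [m], is at most half of
   [e * s^n]; the summand 1 keeps [c] positive. *)
have [c cE] : exists c, c = L * n%:R * m * 2 ^+ n * 2 + 1 by eexists.
have c0 : 0 < c by rewrite cE ltr_wpDl// !mulr_ge0// ltW.
exists (Num.min s0 (e / c)); first by rewrite lt_min s00 divr_gt0.
move=> s sp; rewrite le_min => /andP[ss0 sc].
have mphi : measurable_fun setT phi by exact: elipschitz_measurable lip.
pose h x := `|f x - phi x|; have h0 x : 0 <= h x by exact: normr_ge0.
have mh : measurable_fun setT h by apply: measurableT_comp => //; exact: measurable_funB.
pose A := (s *+ 2) ^+ n.
have A0 : 0 <= A by rewrite exprn_ge0 ?mulrn_wge0 ?(ltW sp).
have muc (x : 'rV[R]_n) : mu (cbox x s) = A%:E by exact: (lebesgue_cbox _ (ltW sp)).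
have AE : A = 2 ^+ n * s ^+ n by rewrite /A -(mulr_natl s 2) exprMn.
clearbody A.
have mc (x : 'rV[R]_n) : measurable (cbox x s) by exact: measurable_cbox.
have icE (x : 'rV[R]_n) (r : \bar R) : (\int[mu]_(y in cbox x s) r = A%:E * r)%E.
  by rewrite (integral_cst mu (mc x) r) -(muc x) muleC.
have ic (x : 'rV[R]_n) (r : R) : (\int[mu]_(y in cbox x s) r%:E = (A * r)%:E)%E by rewrite icE.
pose hD := (EFin \o h) \_ D.
have mhD : measurable_fun setT hD.
  by apply/(measurable_restrictT _ mD)/measurable_EFinP; exact: measurable_funTS.
have hD0 x : (0 <= hD x)%E by rewrite /hD patchE; case: ifP => // _; rewrite lee_fin.
have hDE y : D y -> hD y = (h y)%:E by move=> Dy; rewrite /hD patchE mem_set.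
have IhD : (\int[mu]_y hD y = \int[mu]_(y in D) (h y)%:E)%E by rewrite /hD -integral_mkcond.
clearbody hD.
have [mF FG] := @tonelli_cbox R n (hD \o snd) s (measurableT_comp mhD measurable_snd) (fun u => hD0 u.2).
have pt x : K x -> (\int[mu]_(y in cbox x s) `|f y - f x|%:E <=
    \int[mu]_(y in cbox x s) hD y + (A * (L * (n%:R * s)) + A * h x)%:E)%E.
  move=> Kx.
  apply: (@le_trans _ _ (\int[mu]_(y in cbox x s) (hD y + (L * (n%:R * s) + h x)%:E))%E).
    apply: ge0_le_integral => //.
    - apply/measurable_EFinP; apply: measurableT_comp => //; apply: measurable_funB => //.
      exact: measurable_funTS.
    - by apply: emeasurable_funD => //; exact: measurable_funTS.
    move=> y xy; rewrite hDE; last first.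
      by apply: (hK _ Kx) => i; apply: (le_trans (xy i)).
    rewrite -EFinD lee_fin /h addrA.
    have h1 : `|phi y - phi x| <= L * (n%:R * s).
      apply: (le_trans (lip y x)); rewrite ler_wpM2l// enorm_le ?(ltW sp)// => i.
      by rewrite !mxE; exact: xy.
    have := ler_distD (phi x) (f y) (f x); have := ler_distD (phi y) (f y) (phi x).
    rewrite (distrC (phi x) (f x)); lra.
  rewrite ge0_integralD//=.
  - by rewrite ic mulrDr.
  - exact: measurable_funTS.
  - by move=> y _; rewrite lee_fin addr_ge0// mulr_ge0// mulr_ge0// ltW.
apply: (@le_trans _ _ (\int[mu]_(x in K) (\int[mu]_(y in cbox x s) hD y +
   (A * (L * (n%:R * s)) + A * h x)%:E))%E).
  apply: ge0_le_integral => //.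
  - by move=> x _; apply: integral_ge0.
  - by apply: measurable_funTS; exact: measurable_oscillation.
  - apply: emeasurable_funD; first exact: measurable_funTS.
    apply/measurable_EFinP/measurable_funTS; apply: measurable_funD => //.
    exact: measurable_funM.
rewrite ge0_integralD//; last 4 first.
- by move=> x _; apply: integral_ge0.
- exact: measurable_funTS.
- by move=> x _; rewrite lee_fin addr_ge0// !mulr_ge0// ltW.
- apply/measurable_EFinP/measurable_funTS; apply: measurable_funD => //.
  exact: measurable_funM.
have I1 : (\int[mu]_(x in K) \int[mu]_(y in cbox x s) hD y <= (A * e')%:E)%E.
  apply: (@le_trans _ _ (\int[mu]_x \int[mu]_(y in cbox x s) hD y)%E).
    by apply: ge0_subset_integral => // x _; exact: integral_ge0.
  rewrite FG/= (eq_integral (fun y => A%:E * hD y)%E); last first.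
    by move=> y _; rewrite icE.
  rewrite ge0_integralZl//.
  by rewrite EFinM lee_wpmul2l ?lee_fin// IhD.
have I2 : (\int[mu]_(x in K) (A * (L * (n%:R * s)) + A * h x)%:E <=
    (A * (L * (n%:R * s)) * m + A * e')%:E)%E.
  under eq_integral do rewrite EFinD.
  rewrite ge0_integralD//=; last 3 first.
  - by move=> x _; rewrite lee_fin !mulr_ge0// ltW.
  - by move=> x _; rewrite lee_fin mulr_ge0.
  - by apply/measurable_EFinP/measurable_funTS; exact: measurable_funM.
  rewrite EFinD leeD//.
    by rewrite (integral_cst mu mK) [leRHS]EFinM -mE.
  under eq_integral do rewrite EFinM.
  rewrite ge0_integralZl_EFin//; last 2 first.
  - by move=> x _; rewrite lee_fin.
  - exact/measurable_EFinP/measurable_funTS.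
  rewrite EFinM lee_wpmul2l ?lee_fin//; apply: le_trans hphi.
  apply: ge0_subset_integral => //.
    exact/measurable_EFinP/measurable_funTS.
  by move=> x _; rewrite lee_fin.
apply: (le_trans (leeD I1 I2)); rewrite -EFinD lee_fin.
rewrite AE; set P := 2 ^+ n; set q := s ^+ n; have q0 : 0 <= q by rewrite exprn_ge0// ltW.
have Pe : P * q * e' = q * (e / 4) by rewrite -e'E -/P; field.
have sce : s * c <= e by rewrite -ler_pdivlMr.
have h1 : P * (L * (n%:R * s)) * m <= e / 2.
  by move: sce; rewrite cE -/P; lra.
rewrite Pe [X in _ + (X + _)](_ : _ = q * (P * (L * (n%:R * s)) * m)); last by ring.
by have := ler_wpM2l q0 h1; lra.
Qed.

End oscillation.

(** * John domains and the chain of averages *)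

Section domain.
Context {R : realType} {n : nat}.
Implicit Types (x y z : 'rV[R]_n) (Omega : set 'rV[R]_n).

Lemma enormZ (t : R) x : enorm (t *: x) = `|t| * enorm x.
Proof.
rewrite /enorm; under eq_bigr do rewrite mxE exprMn.
by rewrite -mulr_sumr sqrtrM ?sqr_ge0// sqrtr_sqr.
Qed.

(** The parameter is the supremum [T] of those up to which the segment stays in [Omega]. The point
    at [T] is a limit of points of [Omega]; were it in [Omega], openness would carry the segment
    past [T], or [T = 1] and [y] would be in [Omega]. *)
Lemma segment_meets_boundary Omega z y : open Omega -> Omega z -> ~ Omega y ->
  exists2 t : R, 0 <= t <= 1 & boundary Omega (z + t *: (y - z)).
Proof.
move=> oO Oz nOy.
pose s (t : R) := z + t *: (y - z).
have s0 : s 0 = z by rewrite /s scale0r addr0.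
have s1 : s 1 = y by rewrite /s scale1r addrC subrK.
have cs : continuous s.
  by move=> t; apply: cvgD; [exact: cvg_cst|exact: scalel_continuous].
pose E := [set t : R | 0 <= t <= 1 /\ forall u, 0 <= u <= t -> Omega (s u)].
have E0 : E 0.
  split; first by rewrite lexx ler01.
  move=> u u0; have -> : u = 0 by apply/eqP; rewrite eq_le andbC.
  by rewrite s0.
have supE : has_sup E.
  by split; [exists 0|exists 1 => t [/andP[]]].
set T := sup E.
have T0 : 0 <= T by exact: sup_upper_bound.
have T1 : T <= 1 by apply: ge_sup; [exists 0|move=> t [/andP[]]].
have near (U : set 'rV[R]_n) : nbhs (s T) U ->
    exists2 e : R, 0 < e & forall t, `|T - t| < e -> U (s t).
  by move=> /(cs T) /nbhs_ballP[e e0 h]; exists e => // t Tt; exact: h.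
exists T; first by rewrite T0 T1.
rewrite -/(s T); split.
  move=> U /near[e e0 eU].
  have [t [t01 tE] eTt] := sup_adherent e0 supE.
  exists (s t); split; first by apply: tE; move: t01 => /andP[-> _]/=.
  apply: eU; rewrite ger0_norm; first by rewrite -/T in eTt; lra.
  by rewrite subr_ge0; apply: sup_upper_bound.
move: (oO) => /interior_id -> OT.
have [e e0 eO] := near _ (open_nbhs_nbhs (conj oO OT)).
have [t [t01 tE] eTt] := sup_adherent e0 supE.
pose t' := Num.min 1 (T + e / 2).
have Et' : E t'.
  split; first by rewrite /t' ge_min lexx le_min ler01/=; lra.
  move=> u /andP[u0]; rewrite /t' le_min => /andP[u1 uT].
  have [ut|tu] := leP u t; first by apply: tE; rewrite u0.
  by apply: eO; rewrite -/T in eTt; rewrite ltr_norml; lra.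
have : t' <= T by exact: sup_upper_bound.
rewrite /t' ge_min => /orP[T1'|]; last by lra.
apply: nOy; rewrite -s1.
have -> : 1 = T by apply/eqP; rewrite eq_le T1' T1.
exact: OT.
Qed.

Lemma bounded_subset_cbox Omega : bounded_set Omega ->
  exists2 B : R, 0 < B & Omega `<=` cbox 0 B.
Proof.
move=> [M [_ hM]]; exists (Num.max M 0 + 1); first by rewrite ltr_wpDl// le_max lexx orbT.
move=> x Ox i; rewrite mxE subr0; apply: (le_trans (rV_coord_le_norm x i)).
by apply: hM => //; rewrite ltr_pwDr// le_max lexx.
Qed.

Lemma bdistE Omega x : bdist Omega x = infdist (boundary Omega) x.
Proof. by []. Qed.

Lemma closed_boundary Omega : closed (boundary Omega).
Proof.
rewrite /boundary setDE; apply: closedI; first exact: closed_closure.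
by apply: open_closedC; exact: open_interior.
Qed.

(** Otherwise the segment from [z] to [y] would contain a boundary point no farther from [z] than
    [y] is. *)
Lemma enorm_lt_bdist Omega z y : open Omega -> Omega z ->
  enorm (z - y) < bdist Omega z -> Omega y.
Proof.
move=> oO Oz zy; apply: contrapT => nOy.
have [t /andP[t0 t1] bt] := segment_meets_boundary oO Oz nOy.
move: zy; apply/negP; rewrite -leNgt; apply: (le_trans (infdist_le z bt)).
rewrite opprD addNKr enormN enormZ enormB ger0_norm// ler_piMl// enorm_ge0//.
Qed.

(** A segment from [z] to a vector with one large constant entry leaves the bounded set. This
    excludes the degenerate case where [bdist] is an infimum over the empty set. *)
Lemma boundary_nonempty Omega z : (0 < n)%N -> open Omega -> bounded_set Omega -> Omega z ->
  boundary Omega !=set0.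
Proof.
move=> n0 oO [M [_ hM]] Oz.
pose M' := Num.max M 0 + 1.
have [t _ bt] : exists2 t : R, 0 <= t <= 1 &
    boundary Omega (z + t *: ((const_mx (M' + 1) : 'rV[R]_n) - z)).
  apply: segment_meets_boundary => // Oy.
  have MM : M < M' by rewrite ltr_pwDr// le_max lexx.
  have := le_trans (rV_coord_le_norm _ (Ordinal n0)) (hM M' MM _ Oy).
  have M0 : 0 < M' by rewrite ltr_wpDl// le_max lexx orbT.
  by rewrite mxE ger0_norm; lra.
by eexists; exact: bt.
Qed.

Lemma bdist_gt0 Omega x : boundary Omega !=set0 -> open Omega -> Omega x ->
  0 < bdist Omega x.
Proof.
move=> b0 oO Ox; apply: infdist_gt0 => //; first exact: closed_boundary.
by move: (oO) => /interior_id OE; rewrite /boundary OE => -[].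
Qed.

(** Appending [t] to a partition of [[0, s]] gives a partition of [[0, t]] whose sum exceeds the old
    one by the chord; passing to suprema, [s] plus the chord is at most [t]. *)
Lemma arclength_curve_lipschitz Omega (gamma : R -> 'rV[R]_n) L s t :
  arclength_curve Omega gamma L -> 0 <= s -> s <= t -> t <= L ->
  enorm (gamma t - gamma s) <= t - s.
Proof.
move=> [_ _ _ len] s0; rewrite le_eqVlt => /predU1P[->|st] tL.
  by rewrite !subrr enorm0.
have ls : curve_length gamma 0 s = s%:E by apply: len; rewrite s0 (le_trans (ltW st)).
have lt : curve_length gamma 0 t = t%:E by apply: len; rewrite tL (le_trans s0)// ltW.
suff : (curve_length gamma 0 s <= (t - enorm (gamma t - gamma s))%:E)%E.
  by rewrite ls lee_fin; lra.
apply: ub_ereal_sup => _ [p [pp /eqP ps] <-].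
rewrite lee_fin lerBrDr -lee_fin -lt; apply: ereal_sup_ubound.
exists (rcons p t); first by split; [rewrite rcons_path pp ps|rewrite last_rcons].
congr EFin; rewrite size_rcons big_nat_recr//=; congr (_ + _).
  apply: eq_big_nat => k /andP[_ kp]; rewrite nth_rcons kp.
  rewrite (set_nth_default s t)//; congr (enorm (_ - gamma _)).
  by case: k kp => //= k kp; rewrite nth_rcons ltnW// (set_nth_default s t)// ltnW.
rewrite nth_rcons ltnn eqxx; congr (enorm (_ - gamma _)).
by rewrite -ps -rcons_cons nth_rcons /= ltnSn (last_nth t).
Qed.

(* The John curves are extended by the constant [x0] beyond their length, so that they
   all share the parameter interval [0, b0]. *)
Lemma john_paths Omega : (0 < n)%N -> bounded_john_domain Omega ->
  exists c b0 x0, [/\ 0 < c <= 1, 0 < b0, Omega x0 &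
    forall x, Omega x -> exists gamma : R -> 'rV[R]_n,
      [/\ gamma 0 = x, gamma b0 = x0,
         forall s t, 0 <= s -> s <= t -> t <= b0 -> enorm (gamma t - gamma s) <= t - s &
         forall t, 0 <= t <= b0 -> Omega (gamma t) /\ c * t <= bdist Omega (gamma t)]].
Proof.
move=> n0 [oO _ bO [a0 [b0 [x0 [a00 ab Ox0 john]]]]].
have bne := boundary_nonempty n0 oO bO Ox0.
have d0 : 0 < bdist Omega x0 by exact: bdist_gt0.
have b00 : 0 < b0 by exact: lt_le_trans ab.
(* The part [a0 / b0] is at most [a0 / L], as [L <= b0]; the part [bdist Omega x0 / b0] serves on
   the constant tail at [x0], where [t] can be as large as [b0]. *)
pose c := Num.min 1 (Num.min a0 (bdist Omega x0) / b0).
have c0 : 0 < c by rewrite /c lt_min ltr01 divr_gt0// lt_min a00.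
have ca : c <= a0 / b0 by rewrite /c ge_min; apply/orP; right; rewrite ler_pM2r ?invr_gt0// ge_min lexx.
have cd : c * b0 <= bdist Omega x0.
  by rewrite -ler_pdivlMr// /c ge_min; apply/orP; right; rewrite ler_pM2r ?invr_gt0// ge_min lexx orbT.
exists c, b0, x0; split => //; first by rewrite c0 /c ge_min lexx.
move=> x Ox; have [->|xx0] := pselect (x = x0).
  exists (cst x0); split => // [s t s0 st tb|t /andP[t0 tb]]; first by rewrite subrr enorm0 subr_ge0.
  by split => //; apply: le_trans cd; rewrite ler_pM2l.
have [gamma [L [arc g0 gL Lb hd]]] := john x Ox xx0.
have [L0 _ gO _] := arc.
exists (fun t => gamma (Num.min t L)); split.
- by rewrite min_l.
- by rewrite min_r.
- move=> s t s0 st tb.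
  apply: (@le_trans _ _ (Num.min t L - Num.min s L)).
    apply: (arclength_curve_lipschitz arc); first by rewrite le_min s0.
      by rewrite le_min !ge_min st lexx !orbT.
    by rewrite ge_min lexx orbT.
  by rewrite /Num.min; do 2 case: ifPn; rewrite -?leNgt; lra.
move=> t /andP[t0 tb]; split.
  by apply: gO; rewrite le_min t0 L0 ge_min lexx orbT.
have [tL|Lt] := leP t L; last first.
  by rewrite gL; apply: le_trans cd; rewrite ler_pM2l.
apply: le_trans (hd t _); last by rewrite t0 tL.
move: t0; rewrite le_eqVlt => /predU1P[<-|t0]; first by rewrite !mulr0.
have L0' : 0 < L by exact: lt_le_trans tL.
rewrite ler_pM2r//; apply: (le_trans ca).
by rewrite ler_pM2l// lef_pV2.
Qed.

End domain.

(** * Averages along a John curve *)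

Section chain.
Context {R : realType} {n : nat}.
Notation mu := (@lebesgue_rV R n).
Implicit Types (x y z : 'rV[R]_n).
Variables (Omega : set 'rV[R]_n) (c b0 M : R) (x0 : 'rV[R]_n).
Hypotheses (n0 : (0 < n)%N) (oO : open Omega) (c01 : 0 < c <= 1) (b00 : 0 < b0).
Hypotheses (M0 : 0 < M) (hM : forall t, derive1 (@smooth_step R) t <= M).

Definition john_path x (gamma : R -> 'rV[R]_n) :=
  [/\ gamma 0 = x, gamma b0 = x0,
   forall s t, 0 <= s -> s <= t -> t <= b0 -> enorm (gamma t - gamma s) <= t - s &
   forall t, 0 <= t <= b0 -> Omega (gamma t) /\ c * t <= bdist Omega (gamma t)].

(* The value makes [n * (2 * chain_step) = c / 2]: the box of radius [2 * chain_step * t]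
   about [gamma t] then keeps distance at least [c * t / 2] from the boundary. *)
Definition chain_step : R := c / (4 * n%:R).
(** With this ratio [tau j - tau j.+1 = kap * tau j]: consecutive centres are at most one box radius
    apart, so the boxes of both fit in the box of twice the radius about the first. The same
    identity makes sums over scales telescope. *)
Definition scale j : R := b0 * (1 - chain_step) ^+ j.

Local Notation kap := chain_step.
Local Notation tau := scale.

Let n1 : 1 <= n%:R :> R. Proof. by rewrite ler1n. Qed.

Lemma chain_step_gt0 : 0 < kap.
Proof. by have /andP[c0 _] := c01; rewrite divr_gt0// mulr_gt0// (lt_le_trans _ n1). Qed.

Lemma chain_step_le : kap <= 4^-1.
Proof.
have /andP[c0 c1] := c01.
rewrite /chain_step ler_pdivrMr; last by rewrite mulr_gt0// (lt_le_trans _ n1).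
by have := n1; lra.
Qed.

Lemma chain_stepE : n%:R * (2 * kap) = c / 2.
Proof. by rewrite /chain_step; field; rewrite gt_eqF// (lt_le_trans _ n1). Qed.

Lemma scale_gt0 j : 0 < tau j.
Proof. by rewrite mulr_gt0// exprn_gt0//; have := chain_step_le; lra. Qed.

Lemma scaleS j : tau j.+1 = (1 - kap) * tau j.
Proof. by rewrite /scale exprS mulrCA. Qed.

Lemma scale_le j : tau j <= b0.
Proof.
rewrite /scale ler_piMr ?(ltW b00)// exprn_ile1//; have := chain_step_le; have := chain_step_gt0; lra.
Qed.

Definition inner j : set 'rV[R]_n := [set y | Omega y /\ c * tau j / 2 <= bdist Omega y].

(** The box reaches at most [c * tau j / 2] from [gamma (tau j)], whose distance to the boundary is
    at least [c * tau j]. It lies near [x] because [gamma (tau j)] is within [tau j] of [x] and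
    [2 * kap <= 1 / 2]. *)
Lemma chain_box x gamma j : john_path x gamma ->
  cbox (gamma (tau j)) (2 * (kap * tau j)) `<=` inner j `&` cbox x (tau j *+ 2).
Proof.
have /andP[c0 c1] := c01.
move=> [g0 gb lip dg] y yz; have t0 := scale_gt0 j; have tb := scale_le j.
have k0 := chain_step_gt0; have k1 := chain_step_le.
have [Og dz] := dg (tau j) ltac:(lra).
have yz' : enorm (gamma (tau j) - y) <= c / 2 * tau j.
  rewrite enormB (_ : c / 2 * tau j = n%:R * (2 * (kap * tau j))); last first.
    by rewrite -chain_stepE; ring.
  apply: enorm_le; first by have := mulr_gt0 k0 t0; lra.
  by move=> i; rewrite !mxE; exact: yz.
have ct : 0 < c * tau j by rewrite mulr_gt0.
split; first split.
- by apply: (enorm_lt_bdist oO Og); lra.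
- have := infdist_lipschitz (boundary Omega) (gamma (tau j)) y.
  rewrite -!bdistE; lra.
move=> i; have := yz i.
have := le_trans (coord_le_enorm _ i) (lip 0 (tau j) (lexx _) (ltW t0) tb).
rewrite g0 !mxE subr0 => h1 h2.
have := ler_distD (gamma (tau j) 0 i) (y 0 i) (x 0 i).
have : kap * tau j <= 4^-1 * tau j by rewrite ler_wpM2r// ltW.
rewrite mulr2n; lra.
Qed.

Let mO : measurable Omega. Proof. exact: open_measurable_rV. Qed.

Lemma measurable_bdist : measurable_fun setT (bdist Omega).
Proof.
exact: elipschitz_measurable ler01 (infdist_lipschitz1 _).
Qed.

Lemma measurable_bdist_ge t : measurable [set x | Omega x /\ t <= bdist Omega x].
Proof.
rewrite (_ : [set _ | _] = Omega `&` (bdist Omega @^-1` [set u | t <= u])); last first.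
  by apply/seteqP; split.
apply: measurableI => //; rewrite -[X in measurable X]setTI.
by apply: measurable_bdist => //; rewrite -set_itvcy; exact: measurable_itv.
Qed.

Lemma measurable_inner j : measurable (inner j).
Proof. exact: measurable_bdist_ge. Qed.

Definition john_term (phi : 'rV[R]_n -> R) j x : \bar R :=
  (((tau j ^+ n.-1)^-1)%:E *
   \int[mu]_(y in cbox x (tau j *+ 2)) (phi y * \1_(inner j) y)%:E)%E.

(* Discrete form of the potential of kernel [|x - y|^(1 - n)] along a John curve from [x];
   replacing the curve by the sets [inner j] makes the kernel symmetric enough for Tonelli. *)
Definition john_op (phi : 'rV[R]_n -> R) x : \bar R :=
  (\sum_(0 <= j <oo) john_term phi j x)%E.

Lemma john_term_ge0 (phi : 'rV[R]_n -> R) j x : (forall y, 0 <= phi y) -> (0 <= john_term phi j x)%E.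
Proof.
move=> phi0; rewrite mule_ge0 ?lee_fin ?invr_ge0 ?exprn_ge0 ?(ltW (scale_gt0 j))//.
by apply: integral_ge0 => y _; rewrite lee_fin mulr_ge0.
Qed.

Lemma john_op_ge0 (phi : 'rV[R]_n -> R) x : (forall y, 0 <= phi y) -> (0 <= john_op phi x)%E.
Proof. by move=> phi0; apply: nneseries_ge0 => j _ _; exact: john_term_ge0. Qed.

Lemma measurable_mul_inner (phi : 'rV[R]_n -> R) j : measurable_fun setT phi ->
  measurable_fun setT (fun y => phi y * \1_(inner j) y).
Proof.
move=> mphi; apply: measurable_funM => //.
by apply: measurable_indic; exact: measurable_inner.
Qed.

Lemma measurable_john_term (phi : 'rV[R]_n -> R) j : measurable_fun setT phi -> (forall y, 0 <= phi y) ->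
  measurable_fun setT (john_term phi j).
Proof.
move=> mphi phi0; apply: measurable_funeM.
have [] := @tonelli_cbox R n (fun u => (phi u.2 * \1_(inner j) u.2)%:E) (tau j *+ 2).
- apply/measurable_EFinP; exact: (measurableT_comp (measurable_mul_inner j mphi) measurable_snd).
- by move=> u; rewrite lee_fin mulr_ge0.
- by [].
Qed.

Lemma measurable_john_op (phi : 'rV[R]_n -> R) : measurable_fun setT phi -> (forall y, 0 <= phi y) ->
  measurable_fun setT (john_op phi).
Proof.
move=> mphi phi0; apply: ge0_emeasurable_sum => [k x _ _|k _]; first exact: john_term_ge0.
exact: measurable_john_term.
Qed.

Section estimate.
Variables (f : 'rV[R]_n -> R) (g : 'rV[R]_n -> 'rV[R]_n).
Hypothesis wg : weak_gradient Omega f g.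

(** Extension by 0 makes the modulus of the gradient measurable on the whole space, as Tonelli
    requires; the sets [inner j] lie in [Omega], so the potential only sees the true gradient. *)
Definition ext_grad y : R := ((fun y => enorm (g y)) \_ Omega) y.

Definition average z r : R := fine (\int[mu]_(y in Omega) (f y * mollifier z r y)%:E).

Definition osc j x : \bar R :=
  (\int[mu]_(y in cbox x (tau j *+ 2)) `|(f \_ Omega) y - (f \_ Omega) x|%:E)%E.

(** The power is the mollifier bound at radius [kap * tau j.+1 = kap * (1 - kap) * tau j], without
    its power of [tau j]; the factor [n] comes from bounding each coordinate of the gradient by its
    norm. Likewise [oscC] is the sup of the mollifier at radius [kap * tau j], times
    [tau j ^+ n]. *)
Definition stepC : R := n%:R * (M / ((1 - kap) * kap)) ^+ n.-1.
Definition oscC : R := (M / kap) ^+ n.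

Local Notation chain_term := (john_term ext_grad).
Local Notation chain_sum := (john_op ext_grad).

Lemma measurable_ext_grad : measurable_fun setT ext_grad.
Proof.
apply/(measurable_restrictT _ mO); have [_ lg _] := wg.
have sm : measurable_fun Omega (fun y => \sum_(i < n) g y 0 i ^+ 2).
  by apply: measurable_sum => i; apply: measurable_funX; have [] := lg i.
apply: (measurableT_comp (f := @Num.sqrt R)) sm.
by apply: continuous_measurable_fun; exact: sqrt_continuous.
Qed.

Lemma ext_grad_ge0 y : 0 <= ext_grad y.
Proof. by rewrite /ext_grad patchE; case: ifP => // _; exact: enorm_ge0. Qed.

Lemma integrable_mollifier x z r s : 0 < r -> (forall i, `|x 0 i - z 0 i| + r <= s) ->
  cbox z s `<=` Omega -> mu.-integrable Omega (fun y => (f y * mollifier x r y)%:E).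
Proof.
move=> r0 xz zO; have [lf _ _] := wg.
apply: (integrable_mul_cont oO lf zO); first exact: continuous_mollifier.
move=> y zy; apply: mollifier_eq0 => // xy; apply: zy => i.
by have := xz i; have := xy i; have := ler_distD (x 0 i) (y 0 i) (z 0 i); lra.
Qed.

Lemma averageE x gamma j : john_path x gamma ->
  (average (gamma (tau j)) (kap * tau j))%:E =
  (\int[mu]_(y in Omega) (f y * mollifier (gamma (tau j)) (kap * tau j) y)%:E)%E.
Proof.
move=> jp; have t0 : 0 < kap * tau j by rewrite mulr_gt0 ?chain_step_gt0 ?scale_gt0.
rewrite /average fineK//; apply: integrable_fin_num => //.
apply: (@integrable_mollifier _ (gamma (tau j)) _ (2 * (kap * tau j))) => //.
  by move=> i; rewrite subrr normr0; lra.
by move=> y /(chain_box jp) [[]].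
Qed.

Lemma average_step x gamma j : john_path x gamma ->
  (`|average (gamma (tau j.+1)) (kap * tau j.+1) -
     average (gamma (tau j)) (kap * tau j)|%:E <= stepC%:E * chain_term j x)%E.
Proof.
move=> jp; have t0 := scale_gt0 j; have k0 := chain_step_gt0; have k1 := chain_step_le.
have [g0 gb lip dg] := jp.
have kt0 : 0 < kap * tau j by rewrite mulr_gt0.
have kt1 : 0 < kap * tau j.+1 by rewrite mulr_gt0 ?scale_gt0.
have tS : tau j.+1 <= tau j by rewrite scaleS ger_pMl//; lra.
have ktS : kap * tau j.+1 <= kap * tau j by rewrite ler_pM2l.
have boxO : cbox (gamma (tau j)) (2 * (kap * tau j)) `<=` Omega.
  by move=> y /(chain_box jp) [[]].
have := @weak_gradient_mollifier_diff R n Omega f g (gamma (tau j)) (gamma (tau j.+1)) (gamma (tau j))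
  (kap * tau j) (kap * tau j.+1) (2 * (kap * tau j)) M oO wg kt1 ktS.
rewrite -!(averageE _ jp) -EFinB => /(_ _ _ boxO M0 hM) h.
apply: (le_trans (h _ _)).
- by move=> i; rewrite subrr normr0; lra.
- move=> i; have := le_trans (coord_le_enorm _ i) (lip _ _ (ltW (scale_gt0 j.+1)) tS (scale_le j)).
  by rewrite !mxE distrC {2}scaleS; lra.
have -> : ((M / (kap * tau j.+1)) ^+ n.-1)%:E =
   ((M / ((1 - kap) * kap)) ^+ n.-1 * (tau j ^+ n.-1)^-1)%:E.
  rewrite -exprVn -exprMn scaleS; congr (_ ^+ _)%:E.
  by field; rewrite !gt_eqF//; lra.
set B := (M / _) ^+ _; set T := (tau j ^+ _)^-1.
have BT : 0 <= B * T.
  have k10 : 0 < (1 - kap) * kap by apply: mulr_gt0 => //; lra.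
  by rewrite mulr_ge0 ?invr_ge0 ?exprn_ge0 ?(ltW t0)// divr_ge0 ?(ltW M0) ?(ltW k10).
have -> : (stepC%:E * chain_term j x = (B * T)%:E * (n%:R%:E *
    \int[mu]_(y in cbox x (tau j *+ 2)) (ext_grad y * \1_(inner j) y)%:E))%E.
  rewrite /stepC /john_term !muleA -!EFinM; congr (_%:E * _)%E.
  by rewrite -/B -/T; ring.
rewrite lee_wpmul2l ?lee_fin//.
have natmul m (I : \bar R) : (m%:R%:E * I = \sum_(i < m) I)%E.
  elim: m => [|m ih]; first by rewrite big_ord0 mul0e.
  by rewrite big_ord_recr/= -ih -natr1 EFinD ge0_muleDl ?lee_fin// mul1e.
rewrite natmul.
apply: lee_sum => i _.
have [_ lg _] := wg.
have mB : measurable (cbox (gamma (tau j)) (2 * (kap * tau j))) by exact: measurable_cbox.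
have mH : measurable_fun setT (fun y => ext_grad y * \1_(inner j) y).
  exact: measurable_mul_inner measurable_ext_grad.
have H0 y : 0 <= ext_grad y * \1_(inner j) y.
  by rewrite mulr_ge0// ext_grad_ge0.
apply: (@le_trans _ _ (\int[mu]_(y in cbox (gamma (tau j)) (2 * (kap * tau j)))
    (ext_grad y * \1_(inner j) y)%:E)%E).
  apply: ge0_le_integral => //.
  - apply/measurable_EFinP; apply: measurableT_comp => //.
    by have [mg _] := lg i; apply: measurable_funS mg.
  - by apply/measurable_EFinP; exact: measurable_funTS.
  move=> y yz; have [yI _] := chain_box jp yz.
  rewrite lee_fin /ext_grad patchE (mem_set (boxO y yz)) indicE (mem_set yI) mulr1.
  exact: coord_le_enorm.
apply: ge0_subset_integral => //.
- exact: measurable_cbox.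
- by apply/measurable_EFinP; exact: measurable_funTS.
- by move=> y _; rewrite lee_fin.
- by move=> y /(chain_box jp)[].
Qed.

Lemma mollifier_le z r y : 0 < r -> mollifier z r y <= (M / r) ^+ n.
Proof.
move=> r0; rewrite /mollifier /tensor -[in leRHS](card_ord n) -prodr_const.
apply: ler_prod => i _; rewrite rbump_ge0//= rbumpE.
by apply: ler_wpM2r => //; rewrite invr_ge0 ltW.
Qed.

(** The mollifier has mass one, so [f x] goes under the integral; then the mollifier is replaced by
    its maximum and its support by the larger box about [x]. *)
Lemma average_osc x gamma j : Omega x -> john_path x gamma ->
  (`|average (gamma (tau j)) (kap * tau j) - f x|%:E <=
   (oscC / tau j ^+ n)%:E * osc j x)%E.
Proof.
move=> Ox jp; have t0 := scale_gt0 j; have k0 := chain_step_gt0.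
have kt0 : 0 < kap * tau j by rewrite mulr_gt0.
set z := gamma (tau j); set r := kap * tau j; set m := mollifier z r.
have rr : cbox z r `<=` cbox z (2 * r).
  by move=> y yz i; apply: (le_trans (yz i)); have : 0 < r by []; lra.
have boxO : cbox z r `<=` Omega.
  by apply: (subset_trans rr) => y /(chain_box jp) [[]].
have mbox : measurable (cbox z r) by exact: measurable_cbox.
have cm : measurable_fun setT m by apply: continuous_measurable_rV; exact: continuous_mollifier.
have m0 y : 0 <= m y by exact: mollifier_ge0.
have out y : ~ cbox z r y -> m y = 0 by exact: mollifier_eq0.
have Im : (\int[mu]_(y in Omega) (m y)%:E = 1)%E.
  rewrite -(integral_mollifier z kt0) (integral_zero_outside mu boxO); last by move=> y /out ->.
  by rewrite [RHS](integral_zero_outside mu (@subsetT _ (cbox z r)))// => y /out my; congr EFin.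
have im : mu.-integrable Omega (EFin \o m).
  apply/integrableP; split; first by apply/measurable_EFinP; exact: measurable_funTS.
  by under eq_integral do rewrite /= ger0_norm//; rewrite Im ltry.
have ifm : mu.-integrable Omega (fun y => (f y * m y)%:E).
  apply: (@integrable_mollifier _ z _ (2 * r)) => //.
    by move=> i; rewrite subrr normr0 add0r; have : 0 < r by []; lra.
  by move=> y /(chain_box jp) [[]].
have icm : mu.-integrable Omega (fun y => (f x * m y)%:E).
  by under eq_fun do rewrite EFinM; exact: integrableZl.
have [[mf _] _ _] := wg.
have -> : `|average z r - f x|%:E =
    `|\int[mu]_(y in Omega) ((f y * m y)%:E - (f x * m y)%:E)|%E.
  rewrite integralB_EFin//; under [X in (_ - X)%E]eq_integral do rewrite EFinM.
  by rewrite integralZl// Im mule1 -(averageE _ jp).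
apply: (le_trans (le_abse_integral _ _ _)) => //.
  by apply: emeasurable_funB; [case/integrableP: ifm|case/integrableP: icm].
rewrite (integral_zero_outside mu boxO); last by move=> y /out ->; rewrite !mulr0 subee// abse0.
have mf1 : measurable_fun setT (f \_ Omega) by exact/(measurable_restrictT _ mO).
have mosc : measurable_fun setT (fun y => `|(f \_ Omega) y - (f \_ Omega) x|%:E).
  by apply/measurable_EFinP; apply: measurableT_comp => //; exact: measurable_funB.
have -> : oscC / tau j ^+ n = (M / r) ^+ n.
  by rewrite /oscC -exprVn -exprMn; congr (_ ^+ _); rewrite /r; field; rewrite !gt_eqF.
apply: (@le_trans _ _ (((M / r) ^+ n)%:E * \int[mu]_(y in cbox z r)
    `|(f \_ Omega) y - (f \_ Omega) x|%:E)%E); last first.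
  rewrite lee_wpmul2l ?lee_fin ?exprn_ge0 ?divr_ge0 ?(ltW M0) ?(ltW kt0)//.
  apply: ge0_subset_integral => //; [exact: measurable_cbox|exact: measurable_funTS|].
  by move=> y /rr /(chain_box jp) [].
rewrite -ge0_integralZl//; last 2 first.
- exact: measurable_funTS.
- by rewrite lee_fin exprn_ge0 ?divr_ge0 ?(ltW M0) ?(ltW kt0).
apply: ge0_le_integral => //.
- apply: measurableT_comp => //; apply: emeasurable_funB; apply: measurable_funS boxO _ => //.
    by case/integrableP: ifm.
  by case/integrableP: icm.
- by apply: measurable_funeM; exact: measurable_funTS.
move=> y yz; rewrite -EFinB -EFinM lee_fin -mulrBl normrM.
rewrite !patchE (mem_set (boxO _ yz)) (mem_set Ox) mulrC ler_wpM2r//.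
by rewrite ger0_norm// mollifier_le.
Qed.

Lemma stepC_ge0 : 0 <= stepC.
Proof.
have k1 := chain_step_le; have k0 := chain_step_gt0.
rewrite mulr_ge0// exprn_ge0// divr_ge0 ?(ltW M0)//.
by apply: ltW; apply: mulr_gt0 => //; lra.
Qed.

Lemma oscC_ge0 : 0 <= oscC.
Proof. by rewrite exprn_ge0// divr_ge0 ?(ltW M0) ?(ltW chain_step_gt0). Qed.

(** The chain starts at [tau 0 = b0], where every curve is at [x0]; the first average is therefore
    the same for all [x], and the differences telescope. *)
Lemma chain_bound x gamma j : Omega x -> john_path x gamma ->
  (`|f x - average x0 (kap * b0)|%:E <=
   stepC%:E * chain_sum x + (oscC / tau j ^+ n)%:E * osc j x)%E.
Proof.
move=> Ox jp; have [_ gb _ _] := jp.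
have [a [a0E ast aosc]] : exists a : nat -> R, [/\ average x0 (kap * b0) = a 0%N,
    forall i, (`|a i.+1 - a i|%:E <= stepC%:E * chain_term i x)%E &
    forall i, (`|a i - f x|%:E <= (oscC / tau i ^+ n)%:E * osc i x)%E].
  exists (fun i => average (gamma (tau i)) (kap * tau i)); split.
  - by rewrite /scale expr0 mulr1 gb.
  - by move=> i; exact: average_step jp.
  - by move=> i; exact: average_osc jp.
have tel i : (`|a i - a 0%N|%:E <= stepC%:E * \sum_(0 <= k < i) chain_term k x)%E.
  elim: i => [|i ih]; first by rewrite big_geq// subrr normr0 mule0.
  have ct0 k : (0 <= chain_term k x)%E by apply: john_term_ge0; exact: ext_grad_ge0.
  rewrite big_nat_recr//= ge0_muleDr ?sume_ge0//.
  have := leeD ih (ast i); rewrite -EFinD; apply: le_trans.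
  by rewrite lee_fin [leRHS]addrC ler_distD.
apply: (@le_trans _ _ (`|a j - a 0%N|%:E + `|a j - f x|%:E)%E).
  by rewrite -EFinD lee_fin a0E [leRHS]addrC (distrC (a j) (f x)) ler_distD.
apply: leeD; last exact: aosc.
apply: (le_trans (tel j)); rewrite lee_wpmul2l ?lee_fin ?stepC_ge0//.
by apply: nneseries_lim_ge => k _ _; apply: john_term_ge0; exact: ext_grad_ge0.
Qed.

Lemma scale_small (e : R) : 0 < e -> exists j, tau j <= e.
Proof.
move=> e0; have k0 := chain_step_gt0; have k1 := chain_step_le.
have : (1 - kap) ^+ j @[j --> \oo] --> (0 : R).
  by apply: cvg_expr; rewrite ger0_norm; lra.
move/cvgrPdist_le => /(_ (e / b0) (divr_gt0 e0 b00)) [j _ /(_ j (leqnn j))].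
rewrite sub0r normrN => /(le_trans (ler_norm _)) h.
by exists j; rewrite /scale mulrC -ler_pdivlMr.
Qed.

(** The set is closed although [Omega] is open: a point of the closure outside [Omega] is a boundary
    point, where [bdist] is 0. *)
Lemma compact_bdist_ge (d : R) : bounded_set Omega -> 0 < d ->
  compact [set x | Omega x /\ d <= bdist Omega x].
Proof.
move=> bO d0; apply: bounded_closed_compact.
  by case: bO => N [Nr hN]; exists N; split => // B NB x [Ox _]; exact: hN.
rewrite (_ : [set _ | _] = closure Omega `&` (bdist Omega @^-1` [set t | d <= t])).
  apply: closedI; first exact: closed_closure.
  apply: preimage_closed; last exact: closed_ge.
  by move=> x _; exact: (elipschitz_continuous ler01 (infdist_lipschitz1 _)).
apply/seteqP; split => x [Ox dx]; split => //; first exact: subset_closure.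
apply: contrapT => nOx.
have bx : boundary Omega x.
  by split => //; move: (oO) => /interior_id ->.
have := infdist_le x bx; rewrite subrr enorm0 -bdistE; move: dx => /=; lra.
Qed.

(* Telescoping the averages along the curve leaves the oscillation of [f] at scale [tau j];
   its integral over compact subsets tends to [0], which avoids Lebesgue's differentiation
   theorem. *)
Lemma chain_ae : bounded_set Omega -> (forall x, Omega x -> exists gamma, john_path x gamma) ->
  {ae mu, forall x, Omega x ->
    (`|f x - average x0 (kap * b0)|%:E <= stepC%:E * chain_sum x)%E}.
Proof.
move=> bO paths; have [lf _ _] := wg.
have t0 := scale_gt0.
set a := average _ _.
have mf1 : measurable_fun setT (f \_ Omega) by have [mf _] := lf; exact/(measurable_restrictT _ mO).
have sc0 x : (0 <= stepC%:E * chain_sum x)%E.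
  by rewrite mule_ge0 ?lee_fin ?stepC_ge0// john_op_ge0//; exact: ext_grad_ge0.
(* The excess over the claimed bound, cut off at 0. Being measurable and nonnegative, it vanishes
   almost everywhere once its integrals do. *)
pose e x := maxe (`|(f \_ Omega) x - a|%:E - stepC%:E * chain_sum x)%E 0%E.
have e0 x : (0 <= e x)%E by rewrite le_max lexx orbT.
have me : measurable_fun setT e.
  apply: measurable_maxe => //; apply: emeasurable_funB.
    by apply/measurable_EFinP; apply: measurableT_comp => //; exact: measurable_funB.
  by apply: measurable_funeM; apply: measurable_john_op; [exact: measurable_ext_grad|exact: ext_grad_ge0].
pose D (d : R) := [set x | Omega x /\ d <= bdist Omega x].
have mD d : measurable (D d) by exact: measurable_bdist_ge.
(* Integrating over [D (d + d)] leaves room [d]: small boxes about its points stay in [D d], on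
   which [f] is integrable by compactness. *)
have eK (d : R) : 0 < d -> (\int[mu]_(x in D (d + d)%R) e x = 0)%E.
  move=> d0; apply/eqP; rewrite eq_le integral_ge0// andbT.
  have cD := compact_bdist_ge bO d0.
  have finD : (mu (D d) < +oo)%E.
    have [B B0 OB] := bounded_subset_cbox bO.
    apply: (@le_lt_trans _ _ (mu (cbox 0 B))); last by rewrite lebesgue_cbox ?ltry// ltW.
    by rewrite le_measure ?inE//; [exact: measurable_cbox|move=> x [/OB]].
  have iD : mu.-integrable (D d) (EFin \o (f \_ Omega)).
    apply/integrableP; split; first by apply/measurable_EFinP; exact: measurable_funTS.
    rewrite (eq_integral (fun x => `|f x|%:E)); first by apply: lf.2 => // x [].
    by move=> x; rewrite inE => -[Ox _]; rewrite /= patchE mem_set.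
  have s00 : 0 < d / n%:R by rewrite divr_gt0// (lt_le_trans _ n1).
  have DD : D (d + d) `<=` D d by move=> x [Ox dx]; split => //; lra.
  have boxD x : D (d + d) x -> cbox x (d / n%:R) `<=` D d.
    move=> [Ox dx] y xy.
    have xy' : enorm (x - y) <= d.
      have -> : d = n%:R * (d / n%:R) by field; rewrite gt_eqF// (lt_le_trans _ n1).
      by rewrite enormB; apply: enorm_le => [|i]; [exact: ltW|rewrite !mxE; exact: xy].
    split; first by apply: (enorm_lt_bdist oO Ox); lra.
    by have := infdist_lipschitz (boundary Omega) x y; rewrite -!bdistE; lra.
  have small := oscillation_small (mD d) (mD (d + d)) finD mf1 iD DD s00 boxD.
  apply/lee_addgt0Pr => eps eps0; rewrite add0e.
  have K0 : 0 < oscC * 2 ^+ n + 1.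
    by rewrite ltr_wpDl// mulr_ge0 ?oscC_ge0// exprn_ge0.
  (* The boxes have radius [2 * tau j], whence the factor [2 ^+ n] here and [s1 / 2] in the choice
     of [j]. The factor [oscC / tau j ^+ n] cancels the power of the scale and leaves at most
     [eps]. *)
  have [s1 s10 hs1] := small (eps / (oscC * 2 ^+ n + 1)) (divr_gt0 eps0 K0).
  have [j tj] := scale_small (divr_gt0 s10 (ltr0n _ 2)).
  have := hs1 (tau j *+ 2); rewrite pmulrn_lgt0// t0 => /(_ isT).
  rewrite mulr2n => /(_ ltac:(lra)); rewrite -mulr2n => hj.
  have oc0 : 0 <= oscC / tau j ^+ n.
    by rewrite divr_ge0 ?oscC_ge0// exprn_ge0 ?(ltW (t0 j)).
  apply: (@le_trans _ _ (\int[mu]_(x in D (d + d)%R) ((oscC / tau j ^+ n)%:E * osc j x))%E).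
    apply: ge0_le_integral => //.
    - exact: measurable_funTS.
    - by apply: measurable_funeM; apply: measurable_funTS; exact: measurable_oscillation.
    move=> x [Ox _]; rewrite /e ge_max; apply/andP; split; last first.
      by rewrite mule_ge0 ?lee_fin//; exact: integral_ge0.
    have [gamma jp] := paths x Ox.
    have := chain_bound j Ox jp; rewrite -/a patchE mem_set//.
    have := sc0 x.
    case: (stepC%:E * chain_sum x)%E => [r _| _ _|//]; last exact: leNye.
    by rewrite leeBlDl.
  rewrite ge0_integralZl//; last 2 first.
  - by apply: measurable_funTS; exact: measurable_oscillation.
  - by move=> x _; exact: integral_ge0.
  apply: (le_trans (lee_wpmul2l _ hj)); first by rewrite lee_fin.
  have -> : (tau j *+ 2) ^+ n = 2 ^+ n * tau j ^+ n by rewrite -(mulr_natl (tau j) 2); exact: exprMn.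
  rewrite -EFinM lee_fin.
  set T := tau j ^+ n; have T0 : 0 < T by apply: exprn_gt0; exact: t0.
  rewrite [leLHS](_ : _ = eps * (oscC * 2 ^+ n / (oscC * 2 ^+ n + 1))); last first.
    by field; rewrite !gt_eqF.
  by rewrite ger_pMr// ler_pdivrMr// mul1r lerDl.
(* The sets [D (2 / k.+1)] exhaust [Omega], because [bdist] is positive there. *)
pose N k := [set x | D (k.+1%:R^-1 + k.+1%:R^-1) x /\ e x != 0%E].
have negN k : mu.-negligible (N k).
  have k0 : 0 < k.+1%:R^-1 :> R by [].
  have mk := mD (k.+1%:R^-1 + k.+1%:R^-1).
  have /(ae_eq_integral_abs mu mk (measurable_funTS me)) : (\int[mu]_(x in D (k.+1%:R^-1 + k.+1%:R^-1)%R) `|e x| = 0)%E.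
    by rewrite -[RHS](eK _ k0); apply: eq_integral => x _; rewrite gee0_abs.
  apply: negligibleS => x [Dx /eqP ex] h; exact: ex (h Dx).
apply: (negligibleS _ (negligible_bigcup negN)) => x /= /not_implyP[Ox hx].
have bne : boundary Omega !=set0.
  apply: boundary_nonempty n0 oO bO Ox.
have dx : 0 < bdist Omega x by exact: bdist_gt0.
exists (Num.truncn (2 / bdist Omega x)) => //; split.
  split => //.
  have h := truncnS_gt (2 / bdist Omega x).
  set K := (Num.truncn _).+1%:R in h *; have K0 : 0 < K by rewrite ltr0n.
  rewrite (_ : K^-1 + K^-1 = 2 / K); last by ring.
  by rewrite ler_pdivrMr// mulrC -ler_pdivrMr// ltW.
apply/eqP => ex; apply: hx.
have : (`|(f \_ Omega) x - a|%:E - stepC%:E * chain_sum x <= 0)%E.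
  by rewrite -[leRHS]ex le_max lexx.
rewrite patchE mem_set//.
have := sc0 x.
by case: (stepC%:E * chain_sum x)%E => [r| |] // _; rewrite ?leey// leeBlDl// adde0.
Qed.

End estimate.
End chain.

(** * Powers of the distance to the boundary *)

Section real_bounds.
Context {R : realType}.

(** Comparability is asked on both sides because the exponent may have either sign: the upper bound
    on [u] serves for [a >= 0], the lower one for [a < 0]. *)
Lemma powR_comparable (K u v a : R) : 1 <= K -> 0 < v -> v <= K * u -> u <= K * v ->
  u `^ a <= K `^ `|a| * v `^ a.
Proof.
move=> K1 v0 vu uv.
have K0 : 0 < K by exact: lt_le_trans K1.
have u0 : 0 < u by rewrite -(pmulr_rgt0 _ K0); exact: lt_le_trans vu.
have [a0|a0] := leP 0 a.
  by rewrite ger0_norm// -powRM ?(ltW K0) ?(ltW v0)// ge0_ler_powR ?nnegrE ?(ltW u0) ?mulr_ge0 ?(ltW K0) ?(ltW v0).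
rewrite ltr0_norm// -[a in leLHS]opprK -[X in _ * _ `^ X]opprK !(powRN _ (- a)).
rewrite ler_pdivlMr ?powR_gt0// mulrC ler_pdivrMr ?powR_gt0//.
by rewrite -powRM ?(ltW K0) ?(ltW u0)// ge0_ler_powR ?nnegrE ?(ltW v0) ?oppr_ge0 ?mulr_ge0 ?(ltW K0) ?(ltW u0) ?(ltW a0).
Qed.

Lemma nneseries_le_bound (u : nat -> R) (B : R) : (forall j, 0 <= u j) ->
  (forall J, \sum_(0 <= j < J) u j <= B) -> (\sum_(0 <= j <oo) (u j)%:E <= B%:E)%E.
Proof.
move=> u0 uB; apply: lime_le.
  by apply: is_cvg_nneseries => j _ _; rewrite lee_fin.
by apply: nearW => J; rewrite sumEFin lee_fin.
Qed.

Lemma geometric_sum_le (t : R) J : 0 <= t < 1 -> \sum_(0 <= j < J) t ^+ j <= (1 - t)^-1.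
Proof.
move=> /andP[t0 t1]; have t1' : 0 < 1 - t by rewrite subr_gt0.
suff -> : \sum_(0 <= j < J) t ^+ j = (1 - t ^+ J) / (1 - t).
  by rewrite -[leRHS]mul1r ler_pM2r ?invr_gt0// gerBl exprn_ge0.
elim: J => [|J ih]; first by rewrite big_geq// expr0 subrr mul0r.
by rewrite big_nat_recr//= ih exprS; field; rewrite gt_eqF.
Qed.

End real_bounds.

(** * Integrals of powers of the distance from covering numbers *)

Section assouad.
Context {R : realType} {n : nat}.
Notation mu := (@lebesgue_rV R n).
Implicit Types (x y z xi : 'rV[R]_n).
Variables (Omega : set 'rV[R]_n) (lam C0 : R).
Hypotheses (oO : open Omega) (bne : boundary Omega !=set0).
Hypotheses (lam0 : 0 <= lam) (C00 : 0 < C0).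
Hypothesis cov : forall r rho : R, 0 < r -> r < rho ->
  (ereal_sup [set covering_number r (eball x rho `&` boundary Omega) | x in boundary Omega]
   <= (C0 * (rho / r) `^ lam)%:E)%E.

(* A point of [A] is within [s] of the boundary, so that doubling the radii of a cover of the
   boundary near [xi] covers [A]; [C0 + 1] absorbs the rounding in the covering number. *)
Lemma boundary_layer_measure (A : set 'rV[R]_n) xi (s rho : R) :
  measurable A -> boundary Omega xi -> 0 < s -> s <= rho ->
  (forall x, A x -> enorm (x - xi) < rho /\ bdist Omega x < s) ->
  (mu A <= ((C0 + 1) * (2 * rho / s) `^ lam * (s * 4) ^+ n)%:E)%E.
Proof.
move=> mA bxi s0 srho hA.
have rho0 : 0 < rho by exact: lt_le_trans srho.
have s2 : s < 2 * rho by lra.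
have q1 : 1 <= 2 * rho / s by rewrite ler_pdivlMr// mul1r ltW.
have p1 : 1 <= (2 * rho / s) `^ lam by have := ler_powR q1 lam0; rewrite powRr0.
set v := C0 * (2 * rho / s) `^ lam.
(* The boundary points used below lie within [s] of a point of [A], hence within
   [s + rho <= 2 * rho] of [xi]. *)
have cv : (covering_number s (eball xi (2 * rho) `&` boundary Omega) <= v%:E)%E.
  apply: le_trans (cov s0 s2); apply: ereal_sup_ubound; exists xi => //.
have [k [c kc] kv] : exists2 k : nat, (exists c : 'I_k -> 'rV[R]_n,
    eball xi (2 * rho) `&` boundary Omega `<=` \bigcup_i eball (c i) s) & k%:R <= v + 1.
  have fin : covering_number s (eball xi (2 * rho) `&` boundary Omega) \is a fin_num.
    rewrite ge0_fin_numE; first by apply: le_lt_trans cv _; rewrite ltry.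
    by apply: le_ereal_inf_tmp => _ [k _ <-]; rewrite lee_fin.
  have [_ [k hk <-] kv] := lb_ereal_inf_adherent (@ltr01 R) fin.
  exists k => //; rewrite -lee_fin EFinD; apply: ltW; apply: (lt_le_trans kv).
  by rewrite leeD2r.
pose B j : set 'rV[R]_n := if insub j is Some i then cbox (c i) (s * 2) else set0.
have AB : A `<=` \big[setU/set0]_(j < k) B j.
  move=> x /hA[xxi dx].
  have [|y by_ xy] := @infdist_attained _ _ _ x (s - bdist Omega x) bne; first by rewrite subr_gt0.
  have {}xy : enorm (x - y) < s by move: xy; rewrite -bdistE; lra.
  have yxi : enorm (y - xi) < 2 * rho.
    rewrite -[y - xi](subrKA x); apply: (le_lt_trans (enorm_triangle _ _)).
    rewrite (enormB y x); lra.
  have [i _ yi] := kc y (conj yxi by_).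
  rewrite -bigcup_mkord; exists (i : nat) => /=; first exact: ltn_ord.
  rewrite /B valK => l; apply: (le_trans (coord_le_enorm_sub _ _ _)).
  rewrite -[x - c i](subrKA y); apply: (le_trans (enorm_triangle _ _)).
  by move: yi; rewrite /eball /= => yi; lra.
have mB j : measurable (B j).
  by rewrite /B; case: insubP => // i _ _; exact: measurable_cbox.
apply: (le_trans (content_subadditive mu (fun j _ => mB j) mA AB)).
apply: (@le_trans _ _ (\sum_(j < k) ((s * 4) ^+ n)%:E)%E).
  apply: lee_sum => j _; have muB : mu (B j) = ((s * 4) ^+ n)%:E.
    rewrite /B valK lebesgue_cbox; last by lra.
    by rewrite mulr2n; congr (_ ^+ _)%:E; ring.
  by rewrite -muB; exact: lexx.
rewrite sumEFin lee_fin sumr_const card_ord -[leLHS]mulr_natl.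
apply: ler_wpM2r; first by rewrite exprn_ge0//; lra.
by apply: (le_trans kv); rewrite mulrDl lerD2l mul1r.
Qed.

(** Dyadic layers [d ~ s = 2^-k rho]: each has measure of order [(rho / s)^lam * s^n] and carries
    the value [s^a], which together make [rho^(n + a) * t^k] with [t = 2^-(n + a - lam)]. The series
    converges because [a > lam - n]. *)
Lemma integral_bdist_pow (a : R) : lam - n%:R < a -> exists2 C : R, 0 < C &
  forall xi rho, boundary Omega xi -> 0 < rho ->
  (\int[mu]_(x in Omega `&` eball xi rho) (bdist Omega x `^ a)%:E <= (C * rho `^ (n%:R + a))%:E)%E.
Proof.
move=> la; have ga : 0 < n%:R + a - lam by lra.
pose t := 2^-1 `^ (n%:R + a - lam).
have t0 : 0 < t by rewrite powR_gt0.
have t1 : t < 1.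
  have : t < 1 `^ (n%:R + a - lam).
    by apply: gt0_ltr_powR; rewrite ?nnegrE ?invr_ge0 ?invf_lt1 ?ltr1n.
  by rewrite powR1.
pose K := 2 `^ `|a| * (C0 + 1) * 2 `^ lam * 4 ^+ n.
have C01 : 0 < C0 + 1 by rewrite ltr_wpDl ?ltW.
have K0 : 0 < K by rewrite !mulr_gt0 ?powR_gt0 ?exprn_gt0.
exists (K / (1 - t)); first by rewrite divr_gt0//; lra.
move=> xi rho bxi rho0.
pose s k := 2^-1 ^+ k * rho.
have s0 k : 0 < s k by rewrite mulr_gt0// exprn_gt0.
have sS k : s k.+1 = s k / 2 by rewrite /s exprS; ring.
have sle k : s k <= rho by rewrite /s ger_pMl// exprn_ile1//; lra.
have mO : measurable Omega by exact: open_measurable_rV.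
have md : measurable_fun setT (bdist Omega) by exact: measurable_bdist.
have me := @elipschitz_measurable R n _ _ setT ler01 (enorm_sub_elipschitz xi).
pose L k := [set x | [/\ Omega x, enorm (x - xi) < rho & s k.+1 <= bdist Omega x < s k]].
have mL k : measurable (L k).
  rewrite (_ : L k = Omega `&` ((fun x => enorm (x - xi)) @^-1` `]-oo, rho[ `&`
      bdist Omega @^-1` `[s k.+1, s k[)); last first.
    apply/seteqP; split => [x [Ox xr dx]|x [Ox /= []]].
      by split=> //; split; rewrite /= in_itv.
    by rewrite !in_itv/= => xr dx; split.
  apply: measurableI => //; apply: measurableI; rewrite -[X in measurable X]setTI.
    by apply: me => //; exact: measurable_itv.
  by apply: md => //; exact: measurable_itv.
have LE : Omega `&` eball xi rho = \bigcup_k L k.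
  apply/seteqP; split => [x [Ox xr]|x [k _ [Ox xr _]]]; last by split.
  have dx0 : 0 < bdist Omega x by exact: bdist_gt0.
  (* As [xi] is on the boundary, no point of the ball has distance [rho] or more, so the layers from
     [s 0 = rho] downwards suffice. *)
  have dxr : bdist Omega x < rho by exact: le_lt_trans (infdist_le x bxi) xr.
  have ex : exists k, s k.+1 <= bdist Omega x.
    have : (2^-1 : R) ^+ j @[j --> \oo] --> (0 : R).
      by apply: cvg_expr; rewrite ger0_norm; lra.
    move/cvgrPdist_le => /(_ (bdist Omega x / rho) (divr_gt0 dx0 rho0)) [j _ /(_ j.+1 (leqnSn j))].
    rewrite sub0r normrN => /(le_trans (ler_norm _)) h.
    by exists j; rewrite /s -ler_pdivlMr.
  case: (ex_minnP ex) => k hk kmin; exists k => //; split => //; rewrite hk /=.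
  case: k hk kmin => [_ _|k _ kmin]; first by rewrite /s expr0 mul1r.
  by rewrite ltNge; apply/negP => /kmin; rewrite ltnn.
have tL : trivIset setT L.
  have smono i j : (i < j)%N -> s j <= s i.+1.
    by move=> ij; rewrite /s ler_pM2r// ler_wiXn2l//; lra.
  move=> i j _ _ [x [[_ _ /andP[i1 i2]] [_ _ /andP[j1 j2]]]].
  by have [/smono h|/smono h|//] := ltngtP i j; exfalso; lra.
have mda : measurable_fun setT (fun x => bdist Omega x `^ a) by exact: (measurableT_comp (measurable_powR a) md).
rewrite LE ge0_integral_bigcup//; last 2 first.
- by apply/measurable_EFinP/measurable_funTS.
- by move=> x _; rewrite lee_fin powR_ge0.
have layer k : (\int[mu]_(x in L k) (bdist Omega x `^ a)%:E <=
    (K * rho `^ (n%:R + a) * t ^+ k)%:E)%E.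
  apply: (@le_trans _ _ (\int[mu]_(x in L k) (2 `^ `|a| * s k `^ a)%:E)%E).
    apply: ge0_le_integral => //.
    - by move=> x _; rewrite lee_fin powR_ge0.
    - by apply/measurable_EFinP/measurable_funTS.
    move=> x [_ _ /andP[d1 d2]]; rewrite lee_fin powR_comparable ?ler1n//.
      by move: d1; rewrite sS; lra.
    by have := s0 k; lra.
  rewrite (integral_cst mu (mL k)).
  apply: (@le_trans _ _ ((2 `^ `|a| * s k `^ a)%:E * ((C0 + 1) * (2 * rho / s k) `^ lam * (s k * 4) ^+ n)%:E)%E).
    rewrite lee_wpmul2l ?lee_fin ?mulr_ge0 ?powR_ge0//.
    by apply: (boundary_layer_measure (mL k) bxi (s0 k) (sle k)) => x [_ ? /andP[]].
  rewrite -EFinM lee_fin le_eqVlt; apply/orP; left; apply/eqP.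
  have sp := s0 k.
  have E1 : (2 * rho / s k) `^ lam = 2 `^ lam * rho `^ lam * (s k `^ lam)^-1.
    rewrite powRM ?mulr_ge0 ?invr_ge0 ?(ltW rho0) ?(ltW sp)// powRM ?(ltW rho0)//.
    by rewrite -(powR_inv1 (ltW sp)) -powRrM mulN1r powRN.
  have E2 : s k `^ a * s k ^+ n = s k `^ lam * s k `^ (n%:R + a - lam).
    by rewrite -powR_mulrn ?(ltW sp)// -!powRD ?(gt_eqF sp) ?implybT//; congr (powR _ _); ring.
  have E3 : s k `^ (n%:R + a - lam) = t ^+ k * rho `^ (n%:R + a - lam).
    rewrite /s powRM ?exprn_ge0 ?(ltW rho0)//; congr (_ * _).
    have h0 : 0 <= 2^-1 :> R by rewrite invr_ge0.
    by rewrite -(powR_mulrn k h0) powRAC powR_mulrn// powR_ge0.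
  have E4 : rho `^ (n%:R + a) = rho `^ lam * rho `^ (n%:R + a - lam).
    by rewrite -powRD ?(gt_eqF rho0) ?implybT//; congr (powR _ _); ring.
  rewrite E1 E4 /K exprMn.
  transitivity (2 `^ `|a| * (C0 + 1) * 2 `^ lam * 4 ^+ n * rho `^ lam * (s k `^ lam)^-1 * (s k `^ a * s k ^+ n)).
    by ring.
  rewrite E2 E3; field; rewrite gt_eqF ?powR_gt0//.
apply: (@le_trans _ _ (\sum_(0 <= k <oo) (K * rho `^ (n%:R + a) * t ^+ k)%:E)%E).
  apply: lee_nneseries => [k _ _|k _]; last exact: layer.
  by apply: integral_ge0 => x _; rewrite lee_fin powR_ge0.
apply: nneseries_le_bound => [k|J].
  by rewrite !mulr_ge0 ?powR_ge0 ?exprn_ge0 ?ltW.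
rewrite -mulr_sumr mulrAC ler_wpM2r ?powR_ge0// ler_wpM2l ?(ltW K0)//.
by apply: geometric_sum_le; rewrite (ltW t0).
Qed.

Let mO : measurable Omega. Proof. exact: open_measurable_rV. Qed.

Lemma measurable_bdist_pow (a : R) : measurable_fun setT (fun x => (bdist Omega x `^ a)%:E).
Proof.
have md : measurable_fun setT (bdist Omega) by exact: measurable_bdist.
by apply/measurable_EFinP; exact: (measurableT_comp (measurable_powR a) md).
Qed.

Lemma measurable_eball x r : measurable (eball x r).
Proof.
have me := @elipschitz_measurable R n _ _ setT ler01 (enorm_sub_elipschitz x).
rewrite (_ : eball x r = (fun y => enorm (y - x)) @^-1` `]-oo, r[); last first.
  by apply/seteqP; split=> y; rewrite /eball /= in_itv.
by rewrite -[X in measurable X]setTI; apply: me => //; exact: measurable_itv.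
Qed.

Lemma integrable_bdist_pow (a : R) : bounded_set Omega -> lam - n%:R < a ->
  (\int[mu]_(x in Omega) (bdist Omega x `^ a)%:E < +oo)%E.
Proof.
move=> bO /integral_bdist_pow[C C1 hC]; have [xi bxi] := bne.
have [B B0 OB] := bounded_subset_cbox bO.
pose rho := n%:R * B + enorm xi + 1.
have rho0 : 0 < rho.
  have nB : 0 <= n%:R * B by rewrite mulr_ge0 ?(ltW B0).
  by have := enorm_ge0 xi; rewrite /rho; lra.
have OE : Omega `&` eball xi rho = Omega.
  apply/seteqP; split => [x []//|x Ox]; split => //; rewrite /eball/=.
  have h1 : enorm x <= n%:R * B.
    by apply: (enorm_le (ltW B0)) => i; have := OB x Ox i; rewrite mxE subr0.
  by have := enorm_triangle x (- xi); rewrite enormN /rho; lra.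
by have := le_lt_trans (hC xi rho bxi rho0) (ltry _); rewrite OE.
Qed.

(** Two cases. If [d(y) >= 4 n tau], then [d] is comparable to [d(y)] on the whole box. Otherwise
    [d(y)] is comparable to [tau], by the assumed lower bound, and the box lies in a ball of radius
    of order [tau] centred on the boundary. *)
Lemma integral_bdist_cbox (c a : R) : (0 < n)%N -> 0 < c -> lam - n%:R < a ->
  exists2 C : R, 0 < C & forall y (tau : R), Omega y -> 0 < tau -> c * tau / 2 <= bdist Omega y ->
  (\int[mu]_(x in Omega `&` cbox y (tau *+ 2)) (bdist Omega x `^ a)%:E <=
   (C * (tau ^+ n * bdist Omega y `^ a))%:E)%E.
Proof.
move=> n0 c0 /integral_bdist_pow[C1 C10 hC1].
have n1 : 1 <= n%:R :> R by rewrite ler1n.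
pose K := 4 * n%:R + 2 / c.
have c20 : 0 < 2 / c by rewrite divr_gt0.
have K1 : 1 <= K by rewrite /K; lra.
have K0 : 0 < K by exact: lt_le_trans K1.
pose Ca := 2 `^ `|a| * 4 ^+ n; pose Cb := C1 * (10 * n%:R) `^ (n%:R + a) * K `^ `|a|.
have Ca0 : 0 < Ca by rewrite mulr_gt0 ?powR_gt0 ?exprn_gt0.
have Cb0 : 0 < Cb by rewrite !mulr_gt0 ?powR_gt0//; lra.
exists (Ca + Cb); first exact: addr_gt0.
move=> y tau Oy tau0 ct; set d := bdist Omega y.
have d0 : 0 < d by exact: bdist_gt0.
have P0 : 0 <= tau ^+ n * d `^ a by rewrite mulr_ge0 ?powR_ge0// exprn_ge0 ?(ltW tau0).
have near x : cbox y (tau *+ 2) x -> enorm (x - y) <= 2 * n%:R * tau.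
  move=> xy; rewrite mulrAC mulrC; apply: enorm_le; first by lra.
  by move=> i; rewrite !mxE mulr_natl; exact: xy.
have mI : measurable (Omega `&` cbox y (tau *+ 2)) by apply: measurableI => //; exact: measurable_cbox.
have mp A : measurable_fun A (fun x => (bdist Omega x `^ a)%:E).
  by apply: measurable_funTS; exact: measurable_bdist_pow.
have [small|large] := leP (4 * n%:R * tau) d.
  apply: (@le_trans _ _ (\int[mu]_(x in Omega `&` cbox y (tau *+ 2)) (2 `^ `|a| * d `^ a)%:E)%E).
    apply: ge0_le_integral => //.
    - by move=> x _; rewrite lee_fin powR_ge0.
    move=> x [Ox /near xy]; rewrite lee_fin powR_comparable ?ler1n//.
      have := infdist_lipschitz (boundary Omega) y x; rewrite -!bdistE enormB -/d; lra.
    have := infdist_lipschitz (boundary Omega) x y; rewrite -!bdistE -/d; lra.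
  rewrite (integral_cst mu mI).
  apply: (@le_trans _ _ ((2 `^ `|a| * d `^ a)%:E * mu (cbox y (tau *+ 2)))%E).
    rewrite lee_wpmul2l ?lee_fin ?mulr_ge0 ?powR_ge0//.
    by rewrite le_measure ?inE//; exact: measurable_cbox.
  rewrite lebesgue_cbox; last by rewrite mulrn_wge0// ltW.
  rewrite -EFinM lee_fin (_ : tau *+ 2 *+ 2 = 4 * tau); last by rewrite !mulr2n; ring.
  rewrite exprMn [leLHS](_ : _ = Ca * (tau ^+ n * d `^ a)); last by rewrite /Ca; ring.
  by rewrite ler_wpM2r// lerDl ltW.
(* This boundary point is within [2 d(y) < 8 n tau] of [y]; the box adds [2 n tau], which explains
   the radius [10 n tau]. *)
have [xi bxi yxi] := infdist_attained y bne d0.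
rewrite -bdistE -/d in yxi.
pose rho := 10 * n%:R * tau; have rho0 : 0 < rho by rewrite !mulr_gt0//; lra.
apply: (@le_trans _ _ (\int[mu]_(x in Omega `&` eball xi rho) (bdist Omega x `^ a)%:E)%E).
  apply: ge0_subset_integral => //.
  - by apply: measurableI => //; exact: measurable_eball.
  - by move=> x _; rewrite lee_fin powR_ge0.
  move=> x [Ox /near xy]; split => //; rewrite /eball/=.
  by have := enorm_triangle (x - y) (y - xi); rewrite subrKA /rho; lra.
apply: (le_trans (hC1 xi rho bxi rho0)); rewrite lee_fin.
have E1 : rho `^ (n%:R + a) = (10 * n%:R) `^ (n%:R + a) * (tau ^+ n * tau `^ a).
  rewrite /rho powRM ?(ltW tau0)//; congr (_ * _).
  by rewrite powRD ?(gt_eqF tau0) ?implybT// powR_mulrn ?(ltW tau0).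
have E2 : tau `^ a <= K `^ `|a| * d `^ a.
  apply: powR_comparable => //.
    apply: (le_trans (ltW large)); rewrite ler_wpM2r ?(ltW tau0)// /K lerDl ltW// divr_gt0//.
  have h : tau <= 2 / c * d by rewrite mulrAC ler_pdivlMr//; lra.
  apply: (le_trans h); rewrite ler_wpM2r ?(ltW d0)// /K lerDr; lra.
rewrite E1.
apply: (@le_trans _ _ (Cb * (tau ^+ n * d `^ a))); last by rewrite ler_wpM2r// lerDr ltW.
rewrite /Cb -!mulrA ler_wpM2l ?(ltW C10)// ler_wpM2l ?powR_ge0//.
by rewrite [leRHS]mulrCA ler_wpM2l// exprn_ge0 ?(ltW tau0).
Qed.

End assouad.

(** * Weighted bounds for the potential *)

Section inequalities.
Context {R : realType}.

(** The right-hand side is the integral of [t^(-1-e)] over [[u, v]], the left-hand side its lower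
    bound by the smallest value. With [s = v / u] it reduces to
    [1 - 1/s <= ln s <= (s^e - 1) / e]. *)
Lemma powR_drop (e u v : R) : 0 < e -> 0 < u -> u <= v ->
  (v - u) * v `^ (- (1 + e)) <= (u `^ (- e) - v `^ (- e)) / e.
Proof.
move=> e0 u0 uv; have v0 : 0 < v by exact: lt_le_trans uv.
pose s := v / u; have s0 : 0 < s by rewrite divr_gt0.
have E1 : (v - u) * v `^ (- (1 + e)) = v `^ (- e) * (1 - s^-1).
  rewrite opprD powRD ?(gt_eqF v0) ?implybT// powR_inv1 ?(ltW v0)// /s.
  by field; rewrite !gt_eqF.
have E2 : u `^ (- e) = v `^ (- e) * s `^ e.
  have -> : v = s * u by rewrite /s divfK// gt_eqF.
  rewrite powRM ?(ltW s0) ?(ltW u0)// mulrAC -powRD ?(gt_eqF s0) ?implybT//.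
  by rewrite addNr powRr0 mul1r.
rewrite E1 E2 -[X in (_ - X) / _]mulr1 -mulrBr -[leRHS]mulrA ler_wpM2l ?powR_ge0//.
rewrite ler_pdivlMr// mulrC.
apply: (@le_trans _ _ (e * ln s)).
  rewrite ler_wpM2l ?(ltW e0)//.
  have := expR_ge1Dx (ln s^-1); rewrite lnK ?posrE ?invr_gt0// lnV ?posrE//; lra.
have := expR_ge1Dx (e * ln s); rewrite -{2}ln_powR lnK ?posrE ?powR_gt0//; lra.
Qed.

(* Minimising the right-hand side of the hypothesis over [T] replaces Hoelder's inequality. *)
Lemma optimize_split (p F u v : R) : 1 < p -> 0 <= F -> 0 <= u -> 0 < v ->
  (forall T, 0 < T -> F <= T * v + T `^ (1 - p) * u) ->
  F `^ p <= 2 `^ p * v `^ (p - 1) * u.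
Proof.
move=> p1 F0 u0 v0 h; have p0 : 0 < p by lra.
have [u00|un0] := eqVneq u 0.
  have -> : F = 0.
    apply/eqP; rewrite eq_le F0 andbT; apply/ler_addgt0Pr => e e0; rewrite add0r.
    by have := h (e / v) (divr_gt0 e0 v0); rewrite u00 mulr0 addr0 divfK// gt_eqF.
  by rewrite powR0 ?u00 ?mulr0// gt_eqF.
have {un0}u0 : 0 < u by rewrite lt_neqAle eq_sym un0.
(* The value of [T] at which the two terms of the hypothesis are equal. *)
pose T := (u / v) `^ p^-1.
have T0 : 0 < T by rewrite powR_gt0// divr_gt0.
have Tp : T `^ p = u / v by rewrite /T -powRrM mulVf ?gt_eqF// powRr1// divr_ge0 ?ltW.
have TE : T `^ (1 - p) * u = T * v.
  rewrite powRD ?(gt_eqF T0) ?implybT// powRr1 ?(ltW T0)// powRN Tp.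
  by field; rewrite !gt_eqF.
have F2 : F <= 2 * (T * v) by have := h T T0; rewrite TE; lra.
apply: (@le_trans _ _ ((2 * (T * v)) `^ p)).
  by rewrite ge0_ler_powR ?nnegrE ?(ltW p0)// !mulr_ge0 ?(ltW T0) ?(ltW v0).
rewrite powRM ?mulr_ge0 ?(ltW T0) ?(ltW v0)// -mulrA ler_wpM2l ?powR_ge0//.
rewrite powRM ?(ltW T0) ?(ltW v0)// Tp powRB ?(gt_eqF v0) ?implybT// powRr1 ?(ltW v0)//.
by rewrite le_eqVlt; apply/orP; left; apply/eqP; field; rewrite gt_eqF.
Qed.

(** Either [G <= T h], or [G = G^p G^(1-p) <= G^p (T h)^(1-p)], since the exponent [1 - p] is
    negative. *)
Lemma split_le (p G T h : R) : 1 < p -> 0 <= G -> 0 < T -> 0 < h ->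
  G <= T * h + T `^ (1 - p) * (G `^ p * h `^ (1 - p)).
Proof.
move=> p1 G0 T0 h0; have Th : 0 < T * h by rewrite mulr_gt0.
have [GT|TG] := leP G (T * h).
  by apply: (le_trans GT); rewrite lerDl !mulr_ge0 ?powR_ge0.
have G0' : 0 < G by exact: lt_trans TG.
apply: (@le_trans _ _ (T `^ (1 - p) * (G `^ p * h `^ (1 - p)))); last by rewrite lerDr ltW.
rewrite mulrCA -powRM ?(ltW T0) ?(ltW h0)//.
rewrite -[leLHS](powRr1 (ltW G0')) -[X in G `^ X <= _](subrKC p).
rewrite powRD ?(gt_eqF G0') ?implybT// ler_wpM2l ?powR_ge0//.
rewrite -(opprB p) !powRN lef_pV2 ?posrE ?powR_gt0//.
by rewrite ge0_ler_powR ?nnegrE ?(ltW G0') ?(ltW Th) ?(ltW TG)//; lra.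
Qed.

End inequalities.

(** * The Schur test for the potential *)

Section schur.
Context {R : realType} {n : nat}.
Notation mu := (@lebesgue_rV R n).
Implicit Types (x y z : 'rV[R]_n).
Variables (Omega : set 'rV[R]_n) (c b0 lam C0 : R).
Hypotheses (n0 : (0 < n)%N) (oO : open Omega) (c01 : 0 < c <= 1) (b00 : 0 < b0).
Hypotheses (bne : boundary Omega !=set0) (lam0 : 0 <= lam) (C00 : 0 < C0).
Hypothesis cov : forall r rho : R, 0 < r -> r < rho ->
  (ereal_sup [set covering_number r (eball x rho `&` boundary Omega) | x in boundary Omega]
   <= (C0 * (rho / r) `^ lam)%:E)%E.

Local Notation kap := (@chain_step R n c).
Local Notation tau := (@scale R n c b0).
Local Notation inn := (@inner R n Omega c b0).
Local Notation jop := (@john_op R n Omega c b0).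
Local Notation d := (bdist Omega).

Let n1 : 1 <= n%:R :> R. Proof. by rewrite ler1n. Qed.
Let mO : measurable Omega. Proof. exact: open_measurable_rV. Qed.
Let k0 : 0 < kap. Proof. exact: chain_step_gt0. Qed.
Let k1 : kap <= 4^-1. Proof. exact: chain_step_le. Qed.
Let t0 j : 0 < tau j. Proof. exact: scale_gt0. Qed.
Let tS j : kap * tau j = tau j - tau j.+1. Proof. by rewrite scaleS; ring. Qed.
Let tle j : tau j.+1 <= tau j.
Proof. by rewrite -subr_ge0 -tS mulr_ge0 ?(ltW k0) ?(ltW (t0 j)). Qed.

(** As [kap * tau j] is the gap between consecutive scales, [powR_drop] bounds [kap * e] times each
    term by an increment of [(D + tau j)^(-e)], and the sum telescopes. *)
Lemma sum_scale_power (e D : R) J : 0 < e -> 0 < D ->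
  \sum_(0 <= j < J) tau j * (D + tau j) `^ (- (1 + e)) <= D `^ (- e) / (kap * e).
Proof.
move=> e0 D0; have ke0 : 0 < kap * e by exact: mulr_gt0.
pose h j := (D + tau j) `^ (- e).
apply: (@le_trans _ _ ((h J - h 0%N) / (kap * e))).
  elim: J => [|J ih]; first by rewrite big_geq// subrr mul0r.
  rewrite big_nat_recr//= -[h J.+1 - _](subrKA (h J)) mulrDl addrC lerD//.
  have := @powR_drop R e (D + tau J.+1) (D + tau J) e0 (addr_gt0 D0 (t0 _)).
  rewrite lerD2l tle => /(_ isT) hh.
  have E : D + tau J - (D + tau J.+1) = kap * tau J by rewrite tS; ring.
  rewrite E ler_pdivlMr// in hh; rewrite ler_pdivlMr//.
  by apply: le_trans hh; rewrite le_eqVlt; apply/orP; left; apply/eqP; ring.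
rewrite ler_pM2r ?invr_gt0//.
apply: (@le_trans _ _ (h J)); first by rewrite gerBl powR_ge0.
rewrite /h !powRN lef_pV2 ?posrE ?powR_gt0 ?addr_gt0//.
by rewrite ge0_ler_powR ?nnegrE ?(ltW e0) ?(ltW D0) ?addr_ge0 ?(ltW D0) ?(ltW (t0 J))// lerDl ltW.
Qed.

(** For [tau j <= D], the quantity [min (tau j) D] drops by exactly [kap * tau j] at step [j]; it
    never increases, and its total drop is at most [D]. *)
Lemma sum_scale_cutoff (D : R) J : 0 <= D ->
  \sum_(0 <= j < J) (if tau j <= D then tau j else 0) <= D / kap.
Proof.
move=> D0; pose h j := Num.min (tau j) D.
apply: (@le_trans _ _ ((h 0%N - h J) / kap)).
  elim: J => [|J ih]; first by rewrite big_geq// subrr mul0r.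
  rewrite big_nat_recr//= -[h 0%N - _](subrKA (h J)) mulrDl lerD//.
  rewrite ler_pdivlMr// mulrC /h; case: ifPn => [tD|]; last first.
    by rewrite mulr0 subr_ge0 le_min !ge_min tle lexx orbT.
  by rewrite tS (min_l tD) min_l ?(le_trans (tle _)).
rewrite ler_pM2r ?invr_gt0// lerBlDr /h ge_min; apply/orP; right.
by rewrite lerDl le_min D0 ltW.
Qed.

(** One half of the Schur test. At scale [tau j] the contributing points satisfy
    [d x + tau j <= K * d y], so the term is of order [tau j * (d x + tau j)^(-1-e)]. *)
Lemma john_op_bdist_pow (e : R) : 0 < e -> exists2 C : R, 0 < C &
  forall x, Omega x -> (jop (fun y => d y `^ (- (1 + e)))%R x <= (C * d x `^ (- e))%:E)%E.
Proof.
move=> e0; have /andP[c0 c1] := c01.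
(* From [tau j <= (2 / c) d y] and [d x <= d y + 2 n tau j]: the summand [2 / c] bounds [tau j], the
   other two bound [d x]. *)
pose K := 1 + 4 * n%:R / c + 2 / c.
have c20 : 0 < 2 / c by rewrite divr_gt0.
have c40 : 0 < 4 * n%:R / c by rewrite divr_gt0// mulr_gt0//; have := n1; lra.
have K1 : 1 <= K by rewrite /K; lra.
have K0 : 0 < K by exact: lt_le_trans K1.
pose B := 4 ^+ n * K `^ (1 + e).
have B0 : 0 < B by rewrite mulr_gt0 ?powR_gt0 ?exprn_gt0.
exists (B / (kap * e)); first by rewrite divr_gt0// mulr_gt0.
move=> x Ox; have d0 : 0 < d x by exact: bdist_gt0.
have term j : (john_term Omega c b0 (fun y => d y `^ (- (1 + e)))%R j x <=
    (B * (tau j * (d x + tau j) `^ (- (1 + e))))%:E)%E.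
  have dt0 : 0 < d x + tau j by rewrite addr_gt0.
  have mc : measurable (cbox x (tau j *+ 2)) by exact: measurable_cbox.
  set q := (d x + tau j) `^ _.
  apply: (@le_trans _ _ (((tau j ^+ n.-1)^-1)%:E *
    \int[mu]_(y in cbox x (tau j *+ 2)) (K `^ (1 + e) * q)%:E)%E).
    rewrite lee_wpmul2l ?lee_fin ?invr_ge0 ?exprn_ge0 ?(ltW (t0 j))//.
    apply: ge0_le_integral => //.
    - by move=> y _; rewrite lee_fin mulr_ge0// powR_ge0.
    - apply/measurable_EFinP/measurable_funTS; apply: (measurable_mul_inner c b0 oO).
      by have /measurable_EFinP := measurable_bdist_pow Omega (- (1 + e)).
    move=> y xy; rewrite lee_fin indicE.
    have [/set_mem[Oy dy]|_] := boolP (y \in inn j); last by rewrite mulr0 mulr_ge0 ?powR_ge0.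
    have dy0 : 0 < d y by exact: bdist_gt0.
    rewrite mulr1 /q !powRN ler_pdivlMr ?powR_gt0// mulrC ler_pdivrMr ?powR_gt0//.
    rewrite -powRM ?(ltW K0) ?(ltW dy0)//.
    have e1 : 0 <= 1 + e by rewrite addr_ge0 ?(ltW e0).
    rewrite ge0_ler_powR ?nnegrE ?(ltW dt0) ?mulr_ge0 ?(ltW K0) ?(ltW dy0)//.
    have xy' : enorm (x - y) <= n%:R * (2 * tau j).
      rewrite enormB; apply: enorm_le; first by have := t0 j; lra.
      by move=> i; rewrite !mxE mulr_natl; exact: xy.
    have h1 : d x <= n%:R * (2 * tau j) + d y.
      by apply: (le_trans (infdist_lipschitz _ x y)); rewrite lerD2r.
    have h2 : tau j <= 2 / c * d y by rewrite mulrAC ler_pdivlMr//; move: dy; lra.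
    have h3 : n%:R * (2 * tau j) <= 4 * n%:R / c * d y.
      apply: (@le_trans _ _ (n%:R * (2 * (2 / c * d y)))).
        by rewrite ler_wpM2l// ler_wpM2l.
      by rewrite le_eqVlt; apply/orP; left; apply/eqP; field; rewrite gt_eqF.
    by rewrite /K; lra.
  rewrite integral_cst_cbox; last by rewrite mulrn_wge0// ltW.
  rewrite -!EFinM lee_fin.
  have -> : (tau j *+ 2 *+ 2) ^+ n = 4 ^+ n * (tau j ^+ n.-1 * tau j).
    by rewrite -exprSr prednK// -mulrnA -(mulr_natl (tau j)); exact: exprMn.
  rewrite le_eqVlt; apply/orP; left; apply/eqP; rewrite /B; field.
  by rewrite gt_eqF// exprn_gt0.
apply: (@le_trans _ _ (\sum_(0 <= j <oo) (B * (tau j * (d x + tau j) `^ (- (1 + e))))%:E)%E).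
  by apply: lee_nneseries => [j _ _|j _]; [apply: (john_term_ge0 _ n0 c01 b00) => y; exact: powR_ge0|exact: term].
apply: nneseries_le_bound => [j|J].
  by apply: mulr_ge0; [exact: ltW|apply: mulr_ge0; [exact: ltW|exact: powR_ge0]].
rewrite -mulr_sumr -mulrA ler_wpM2l ?(ltW B0)//.
by rewrite mulrC; exact: sum_scale_power.
Qed.

(** The dual half of the Schur test. Tonelli moves [d^a] into a box about [y], where
    [integral_bdist_cbox] gives [tau j ^ n * d(y)^a]; against the kernel weight one factor [tau j]
    remains, and its sum over [tau j <= (2 / c) d(y)] gives the additional power of [d]. *)
Lemma integral_john_op (a : R) : lam - n%:R < a -> exists2 C : R, 0 < C &
  forall psi : 'rV[R]_n -> R, measurable_fun setT psi -> (forall y, 0 <= psi y) ->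
  (\int[mu]_(x in Omega) ((d x `^ a)%:E * jop psi x) <=
   C%:E * \int[mu]_(y in Omega) (psi y * d y `^ (a + 1))%:E)%E.
Proof.
move=> la; have /andP[c0 c1] := c01.
have [C1 C10 hC1] := @integral_bdist_cbox R n Omega lam C0 oO bne lam0 C00 cov c a n0 c0 la.
pose C := C1 * (2 / c / kap).
have ck0 : 0 < 2 / c / kap by rewrite divr_gt0// divr_gt0.
have C'0 : 0 < C by exact: mulr_gt0.
exists C => // psi mpsi psi0.
have mda : measurable_fun setT (fun x => d x `^ a).
  by have /measurable_EFinP := measurable_bdist_pow Omega a.
have mOi : measurable_fun setT (\1_Omega : 'rV[R]_n -> R) by exact: measurable_indic.
have [A AE] : exists A : 'rV[R]_n -> R, forall x, A x = d x `^ a * \1_Omega x by eexists.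
have A0 x : 0 <= A x by rewrite AE mulr_ge0// powR_ge0.
have mA : measurable_fun setT A.
  by rewrite (_ : A = fun x => d x `^ a * \1_Omega x); [exact: measurable_funM|apply/funext].
have [S SE] : exists S : nat -> 'rV[R]_n -> R, forall j x, S j x = psi x * \1_(inn j) x by eexists.
have S0 j x : 0 <= S j x by rewrite SE mulr_ge0.
have mS j : measurable_fun setT (S j).
  by rewrite (_ : S j = fun x => psi x * \1_(inn j) x); [exact: measurable_mul_inner|apply/funext].
have iA y s : (\int[mu]_(x in cbox y s) (A x)%:E =
    \int[mu]_(x in Omega `&` cbox y s) (d x `^ a)%:E)%E.
  rewrite [LHS]integral_mkcond [RHS]integral_mkcond; apply: eq_integral => x _.
  rewrite !patchE in_setI AE indicE; case: (x \in cbox y s); rewrite ?andbT ?andbF//.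
  by case: (x \in Omega); rewrite ?mulr1 ?mulr0.
have termE j x : john_term Omega c b0 psi j x =
    (((tau j ^+ n.-1)^-1)%:E * \int[mu]_(y in cbox x (tau j *+ 2)) (S j y)%:E)%E.
  by congr (_ * _)%E; apply: eq_integral => y _; rewrite SE.
have term0 j x : (0 <= john_term Omega c b0 psi j x)%E by exact: (john_term_ge0 _ n0 c01 b00).
have mterm j : measurable_fun setT (john_term Omega c b0 psi j) by exact: measurable_john_term.
rewrite integral_mkcond.
rewrite (eq_integral (fun x => \sum_(0 <= j <oo) ((A x)%:E * john_term Omega c b0 psi j x))%E); last first.
  move=> x _; rewrite nneseriesZl// patchE AE indicE; case: (x \in Omega); rewrite ?mulr1 ?mulr0//.
  by rewrite mul0e.
rewrite integral_nneseries//; last 2 first.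
- by move=> j; apply: emeasurable_funM => //; exact/measurable_EFinP.
- by move=> j x _; rewrite mule_ge0 ?lee_fin.
have T0 j : 0 <= (tau j ^+ n.-1)^-1 by rewrite invr_ge0 exprn_ge0// ltW.
have step j : (\int[mu]_x ((A x)%:E * john_term Omega c b0 psi j x) <=
    \int[mu]_y (C1 * (tau j * (S j y * d y `^ a)))%:E)%E.
  have [mF1 FG1] := @tonelli_cbox R n (fun u => (A u.1 * S j u.2)%:E) (tau j *+ 2)
    ltac:(by apply/measurable_EFinP; apply: measurable_funM;
      [exact: measurableT_comp mA measurable_fst|exact: measurableT_comp (mS j) measurable_snd])
    ltac:(by move=> u; rewrite lee_fin mulr_ge0).
  have [mF2 _] := @tonelli_cbox R n (fun u => (A u.2 * S j u.1)%:E) (tau j *+ 2)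
    ltac:(by apply/measurable_EFinP; apply: measurable_funM;
      [exact: measurableT_comp mA measurable_snd|exact: measurableT_comp (mS j) measurable_fst])
    ltac:(by move=> u; rewrite lee_fin mulr_ge0).
  rewrite (eq_integral (fun x => ((tau j ^+ n.-1)^-1)%:E *
      \int[mu]_(y in cbox x (tau j *+ 2)) (A x * S j y)%:E)%E); last first.
    move=> x _; rewrite termE muleCA; congr (_ * _)%E.
    under [in RHS]eq_integral do rewrite EFinM.
    rewrite ge0_integralZl_EFin//; [exact: measurable_cbox|by move=> y _; rewrite lee_fin|].
    by apply/measurable_EFinP/measurable_funTS.
  rewrite ge0_integralZl_EFin//; last by move=> x _; apply: integral_ge0 => y _; rewrite lee_fin mulr_ge0.
  rewrite FG1/=.
  rewrite -ge0_integralZl_EFin//; last by move=> x _; apply: integral_ge0 => y _; rewrite lee_fin mulr_ge0.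
  apply: ge0_le_integral => //.
  - by move=> y _; rewrite mule_ge0 ?lee_fin//; apply: integral_ge0 => x _; rewrite lee_fin mulr_ge0.
  - exact: measurable_funeM mF2.
  - apply/measurable_EFinP; apply: measurable_funM => //; apply: measurable_funM => //.
    exact: measurable_funM.
  move=> y _.
  have -> : (\int[mu]_(x in cbox y (tau j *+ 2)) (A x * S j y)%:E =
      (S j y)%:E * \int[mu]_(x in Omega `&` cbox y (tau j *+ 2)) (d x `^ a)%:E)%E.
    under eq_integral do rewrite mulrC EFinM.
    rewrite ge0_integralZl_EFin ?iA//; [exact: measurable_cbox|by move=> x _; rewrite lee_fin|].
    by apply/measurable_EFinP/measurable_funTS.
  have [/set_mem[Oy dy]|ny] := boolP (y \in inn j); last first.
    by rewrite SE indicE (negbTE ny) mulr0 mul0e mule0 mul0r !mulr0.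
  apply: (@le_trans _ _ (((tau j ^+ n.-1)^-1)%:E * ((S j y)%:E *
    (C1 * (tau j ^+ n * d y `^ a))%:E))%E).
    rewrite lee_wpmul2l ?lee_fin// lee_wpmul2l ?lee_fin//.
    exact: hC1.
  rewrite -!EFinM lee_fin le_eqVlt; apply/orP; left; apply/eqP.
  have -> : tau j ^+ n = tau j ^+ n.-1 * tau j by rewrite -exprSr prednK.
  by field; rewrite gt_eqF// exprn_gt0.
apply: (@le_trans _ _ (\sum_(0 <= j <oo) \int[mu]_y (C1 * (tau j * (S j y * d y `^ a)))%:E)%E).
  apply: lee_nneseries => [j _ _|j _]; last exact: step.
  by apply: integral_ge0 => x _; apply: mule_ge0; rewrite ?lee_fin.
have mts j : measurable_fun setT (fun y => (C1 * (tau j * (S j y * d y `^ a)))%:E).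
  apply/measurable_EFinP; apply: measurable_funM => //; apply: measurable_funM => //.
  exact: measurable_funM.
have ts0 j y : 0 <= C1 * (tau j * (S j y * d y `^ a)).
  by apply: mulr_ge0; [exact: ltW|apply: mulr_ge0; [exact: ltW|rewrite mulr_ge0// powR_ge0]].
rewrite -integral_nneseries//; last by move=> j y _; rewrite lee_fin.
have mpd : measurable_fun setT (fun y => (psi y * d y `^ (a + 1))%:E).
  apply/measurable_EFinP/measurable_funM => //.
  by have /measurable_EFinP := measurable_bdist_pow Omega (a + 1).
have mpdO : measurable_fun Omega (fun y => (psi y * d y `^ (a + 1))%:E) by exact: measurable_funTS.
have pd0 y : Omega y -> (0 <= (psi y * d y `^ (a + 1))%:E)%E by rewrite lee_fin mulr_ge0// powR_ge0.
rewrite -(ge0_integralZl_EFin mu mO pd0 mpdO (ltW C'0)).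
rewrite [leRHS]integral_mkcond; apply: ge0_le_integral => //.
- by move=> y _; apply: nneseries_ge0 => j _ _; rewrite lee_fin.
- by apply: ge0_emeasurable_sum => // j y _ _; rewrite lee_fin.
- by apply/(measurable_restrictT _ mO); exact: measurable_funeM mpdO.
move=> y _; rewrite patchE; case: ifPn => [/set_mem Oy|/negP nO]; last first.
  rewrite eseries0// => j _ _; rewrite SE indicE memNset ?mulr0 ?mul0r ?mulr0//.
  by move=> [Oy _]; apply: nO; rewrite inE.
have dy0 : 0 < d y by exact: bdist_gt0.
apply: nneseries_le_bound => // J.
apply: (@le_trans _ _ (C1 * (psi y * d y `^ a) * \sum_(0 <= j < J) (if tau j <= 2 / c * d y then tau j else 0))).
  rewrite mulr_sumr; apply: ler_sum => j _.
  rewrite SE indicE; case: (boolP (y \in inn j)) => [/set_mem[_ dy]|_]; last first.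
    by rewrite mulr0 mul0r !mulr0 mulr_ge0 ?mulr_ge0 ?(ltW C10) ?powR_ge0//; case: ifP => // _; rewrite ltW.
  rewrite ifT; first by rewrite mulr1 le_eqVlt; apply/orP; left; apply/eqP; ring.
  by rewrite mulrAC ler_pdivlMr//; lra.
apply: (@le_trans _ _ (C1 * (psi y * d y `^ a) * (2 / c * d y / kap))).
  rewrite ler_wpM2l ?mulr_ge0 ?(ltW C10) ?powR_ge0//.
  by apply: sum_scale_cutoff; rewrite mulr_ge0 ?(ltW dy0)// ltW// divr_gt0.
rewrite powRD ?(gt_eqF dy0) ?implybT// powRr1 ?(ltW dy0)// /C.
by rewrite le_eqVlt; apply/orP; left; apply/eqP; ring.
Qed.

(** This is [split_le] integrated against the kernel. The parameter [T] stays free because it is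
    optimised separately at each [x]. *)
Lemma john_op_split (p T : R) (h G : 'rV[R]_n -> R) x : 1 < p -> 0 < T ->
  measurable_fun setT h -> measurable_fun setT G -> (forall y, 0 <= h y) ->
  (forall y, 0 <= G y) -> (forall y, Omega y -> 0 < h y) ->
  (jop G x <= T%:E * jop h x +
    (T `^ (1 - p))%:E * jop (fun y => G y `^ p * h y `^ (1 - p))%R x)%E.
Proof.
move=> p1 T0 mh mG h0 G0 hO.
pose K y := G y `^ p * h y `^ (1 - p).
have K0 y : 0 <= K y by rewrite mulr_ge0// powR_ge0.
have mK : measurable_fun setT K.
  by apply: measurable_funM; [exact: (measurableT_comp (measurable_powR p) mG)
    |exact: (measurableT_comp (measurable_powR (1 - p)) mh)].
have q0 : 0 <= T `^ (1 - p) by exact: powR_ge0.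
have jt0 (f : 'rV[R]_n -> R) : (forall y, 0 <= f y) -> forall j, (0 <= john_term Omega c b0 f j x)%E.
  by move=> f0 j; exact: (john_term_ge0 _ n0 c01 b00).
rewrite -[in leRHS]nneseriesZl; last by move=> j _; exact: jt0.
rewrite -[in leRHS]nneseriesZl; last by move=> j _; exact: jt0.
rewrite -nneseriesD; last 2 first.
- by move=> j _ _; apply: mule_ge0; [rewrite lee_fin ltW|exact: jt0].
- by move=> j _ _; apply: mule_ge0; [rewrite lee_fin|exact: jt0].
apply: lee_nneseries => [j _ _|j _]; first exact: jt0.
have mb := @measurable_cbox R n x (tau j *+ 2).
have mi (f : 'rV[R]_n -> R) : measurable_fun setT f ->
    measurable_fun (cbox x (tau j *+ 2)) (fun y => (f y * \1_(inn j) y)%:E).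
  move=> mf; apply/measurable_EFinP/measurable_funTS; exact: (measurable_mul_inner c b0 oO).
have i0 (f : 'rV[R]_n -> R) y : (forall y, 0 <= f y) -> (0 <= (f y * \1_(inn j) y)%:E)%E.
  by move=> f0; rewrite lee_fin mulr_ge0.
have t1 : (0 <= ((tau j ^+ n.-1)^-1)%:E)%E by rewrite lee_fin invr_ge0 exprn_ge0// ltW.
rewrite /john_term muleCA [X in (_ <= _ + X)%E]muleCA -ge0_muleDr; last 2 first.
- by apply: mule_ge0; [rewrite lee_fin ltW|apply: integral_ge0 => y _; exact: (i0 h y h0)].
- by apply: mule_ge0; [rewrite lee_fin|apply: integral_ge0 => y _; exact: (i0 K y K0)].
apply: lee_wpmul2l => //.
rewrite -(ge0_integralZl_EFin mu mb (fun y _ => i0 h y h0) (mi h mh) (ltW T0)).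
rewrite -(ge0_integralZl_EFin mu mb (fun y _ => i0 K y K0) (mi K mK) q0).
rewrite -ge0_integralD//; last 4 first.
- by move=> y _; apply: mule_ge0; [rewrite lee_fin ltW|exact: i0].
- exact: measurable_funeM (mi h mh).
- by move=> y _; apply: mule_ge0; [rewrite lee_fin|exact: i0].
- exact: measurable_funeM (mi K mK).
apply: ge0_le_integral => //.
- by move=> y _; exact: i0.
- exact: mi.
- by apply: emeasurable_funD; apply: measurable_funeM; exact: mi.
move=> y _; rewrite -!EFinM -EFinD lee_fin indicE.
have [/set_mem[Oy _]|_] := boolP (y \in inn j); last by rewrite !mulr0 addr0.
by rewrite !mulr1; exact: split_le (G0 y) T0 (hO y Oy).
Qed.

(* Schur test with the weight [h = d^(-(1 + e))], where [e * (p - 1)] is half of the room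
   in the hypothesis [lam - n < b]. *)
Lemma john_op_weighted (p b S : R) : 1 < p -> lam - n%:R < b -> 0 < S ->
  exists2 C : R, 0 < C & forall F G : 'rV[R]_n -> R,
  measurable_fun Omega F -> measurable_fun setT G -> (forall y, 0 <= G y) ->
  {ae mu, forall x, Omega x -> (`|F x|%:E <= S%:E * jop G x)%E} ->
  (\int[mu]_(x in Omega) (`|F x| `^ p * d x `^ b)%:E <=
   C%:E * \int[mu]_(x in Omega) (G x `^ p * d x `^ (b + p))%:E)%E.
Proof.
move=> p1 lb S0.
pose delta := (b - (lam - n%:R)) / 2; pose a := b - delta.
have de0 : 0 < delta by rewrite /delta; lra.
have la : lam - n%:R < a by rewrite /a /delta; lra.
pose e := delta / (p - 1).
have p10 : 0 < p - 1 by lra.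
have e0 : 0 < e by rewrite divr_gt0.
have [CV CV0 hV] := john_op_bdist_pow e0.
have [CU CU0 hU] := integral_john_op la.
pose K := 2 `^ p * (S * CV) `^ (p - 1) * S.
have K0 : 0 < K.
  by apply: mulr_gt0 => //; apply: mulr_gt0; apply: powR_gt0 => //; exact: mulr_gt0.
exists (K * CU); first exact: mulr_gt0.
move=> F G mF mG G0 FG.
pose h y := d y `^ (- (1 + e)).
have mpow (r : R) : measurable_fun setT (fun x => d x `^ r).
  by have /measurable_EFinP := measurable_bdist_pow Omega r.
have mh : measurable_fun setT h by exact: mpow.
have h0 y : 0 <= h y by exact: powR_ge0.
pose psi y := G y `^ p * h y `^ (1 - p).
have psi0 y : 0 <= psi y by rewrite mulr_ge0// powR_ge0.
have mpsi : measurable_fun setT psi.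
  by apply: measurable_funM; [exact: (measurableT_comp (measurable_powR p) mG)
    |exact: (measurableT_comp (measurable_powR (1 - p)) mh)].
have dpos y : Omega y -> 0 < d y by move=> Oy; exact: bdist_gt0.
apply: (@le_trans _ _ (\int[mu]_(x in Omega) (K%:E * ((d x `^ a)%:E * jop psi x)))%E).
  apply: ae_ge0_le_integral => //.
  - by move=> x _; rewrite lee_fin mulr_ge0// powR_ge0.
  - apply/measurable_EFinP/measurable_funM; last exact: measurable_funTS.
    exact: (measurableT_comp (measurable_powR p) (measurableT_comp (@normr_measurable R setT) mF)).
  - move=> x _; apply: mule_ge0; first by rewrite lee_fin ltW.
    by apply: mule_ge0; [rewrite lee_fin powR_ge0|exact: (john_op_ge0 _ n0 c01 b00)].
  - apply: measurable_funeM; apply: emeasurable_funM.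
      by apply: measurable_funTS; exact/measurable_EFinP.
    by apply: measurable_funTS; exact: measurable_john_op.
  apply: filterS FG => x FG Ox; have d0 := dpos x Ox.
  have U0 := @john_op_ge0 R n Omega c b0 n0 c01 b00 psi x psi0.
  have da0 : 0 < d x `^ a by exact: powR_gt0.
  case UE : (jop psi x) U0 => [U| |] // U0; last first.
    by rewrite !gt0_muley ?lte_fin// leey.
  rewrite -!EFinM lee_fin.
  have {}U0 : 0 <= U by [].
  (* [optimize_split] with [v] the bound of the potential of [h] at [x] and [u] the potential of
     [psi] at [x], both multiplied by [S]. *)
  have main : `|F x| `^ p <= 2 `^ p * (S * (CV * d x `^ (- e))) `^ (p - 1) * (S * U).
    apply: optimize_split => // [||T T0].
    - by rewrite mulr_ge0// ltW.
    - by rewrite mulr_gt0// mulr_gt0// powR_gt0.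
    rewrite -lee_fin; apply: (le_trans (FG Ox)).
    have hpos y : Omega y -> 0 < h y by move=> Oy; exact: powR_gt0 (dpos y Oy).
    have sp := @john_op_split p T h G x p1 T0 mh mG h0 G0 hpos.
    apply: (@le_trans _ _ (S%:E * (T%:E * (CV * d x `^ (- e))%:E + (T `^ (1 - p))%:E * U%:E))%E).
      apply: lee_wpmul2l; first by rewrite lee_fin ltW.
      apply: (le_trans sp); rewrite UE; apply: leeD => //.
      by apply: lee_wpmul2l; [rewrite lee_fin ltW|exact: hV].
    by rewrite -!EFinM lee_fin le_eqVlt; apply/orP; left; apply/eqP; ring.
  apply: (@le_trans _ _ (2 `^ p * (S * (CV * d x `^ (- e))) `^ (p - 1) * (S * U) * d x `^ b)).
    by rewrite ler_wpM2r// powR_ge0.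
  rewrite (mulrA S CV) powRM ?mulr_ge0 ?(ltW S0) ?(ltW CV0) ?powR_ge0//.
  have -> : d x `^ a = d x `^ (- e) `^ (p - 1) * d x `^ b.
    rewrite -powRrM -powRD ?(gt_eqF d0) ?implybT//; congr (_ `^ _).
    by rewrite /a /e; field; rewrite gt_eqF.
  by rewrite /K le_eqVlt; apply/orP; left; apply/eqP; ring.
have mV : measurable_fun Omega (fun x => (d x `^ a)%:E * jop psi x)%E.
  apply: emeasurable_funM.
    by apply: measurable_funTS; exact/measurable_EFinP.
  by apply: measurable_funTS; exact: measurable_john_op.
rewrite ge0_integralZl_EFin//; last 2 first.
- move=> x _; apply: mule_ge0; first by rewrite lee_fin powR_ge0.
  exact: (john_op_ge0 _ n0 c01 b00).
- exact: ltW.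
rewrite (EFinM K CU) -muleA; apply: lee_wpmul2l; first by rewrite lee_fin ltW.
apply: (le_trans (hU psi mpsi psi0)); rewrite le_eqVlt; apply/orP; left; apply/eqP.
congr (_ * _)%E; apply: eq_integral => x /set_mem Ox; congr (_%:E).
have d0 := dpos x Ox.
(* The exponents add up: [(1 + e) (p - 1) + a + 1 = b + p], as [e (p - 1) = delta] and
   [a = b - delta]. *)
rewrite /psi /h -powRrM -mulrA -powRD ?(gt_eqF d0) ?implybT//.
by congr (_ * _ `^ _); rewrite /a /e; field; rewrite gt_eqF.
Qed.

End schur.

(** * The Poincare inequality *)

Lemma powRD_le {R : realType} (p u v : R) : 0 <= p -> 0 <= u -> 0 <= v ->
  (u + v) `^ p <= 2 `^ p * (u `^ p + v `^ p).
Proof.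
move=> p0; wlog uv : u v / u <= v => [hw u0 v0|u0 v0].
  have [/hw|/ltW/hw] := leP u v; first exact.
  by rewrite addrC [v `^ p + _]addrC; exact.
apply: (@le_trans _ _ ((2 * v) `^ p)).
  by rewrite ge0_ler_powR ?nnegrE ?addr_ge0 ?mulr_ge0//; lra.
by rewrite powRM// ler_wpM2l ?powR_ge0// lerDr powR_ge0.
Qed.

(* The mean value [c0] is controlled by testing [split_le] at [T = |c0| / 2],
   so that half of the left-hand side can be absorbed. *)
Lemma mean_zero_norm_le d (T : measurableType d) (R : realType)
    (mu : {measure set T -> \bar R}) (D : set T) (p c0 : R) (f w : T -> R) :
  measurable D -> 1 < p -> measurable_fun D f -> measurable_fun D w ->
  (forall x, 0 <= w x) -> (\int[mu]_(x in D) (w x)%:E < +oo)%E ->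
  (\int[mu]_(x in D) (`|f x| `^ p * w x)%:E < +oo)%E ->
  (\int[mu]_(x in D) (f x * w x)%:E = 0)%E ->
  (\int[mu]_(x in D) (`|f x| `^ p * w x)%:E <=
   (2 `^ p * (1 + 2 `^ p))%:E * \int[mu]_(x in D) (`|f x - c0| `^ p * w x)%:E)%E.
Proof.
move=> mD p1 mf mw w0 Wfin Lfin f0; have p0 : 0 < p by lra.
have mpow (h : T -> R) : measurable_fun D h -> measurable_fun D (fun x => `|h x| `^ p * w x).
  move=> mh; apply: measurable_funM => //.
  exact: (measurableT_comp (measurable_powR p) (measurableT_comp (@normr_measurable R setT) mh)).
have mfc : measurable_fun D (fun x => f x - c0) by apply: measurable_funB.
have pw0 (h : T -> R) x : 0 <= `|h x| `^ p * w x by rewrite mulr_ge0// powR_ge0.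
have W0 : (0 <= \int[mu]_(x in D) (w x)%:E)%E by apply: integral_ge0 => x _; rewrite lee_fin.
have E0 : (0 <= \int[mu]_(x in D) (`|f x - c0| `^ p * w x)%:E)%E.
  by apply: integral_ge0 => x _; rewrite lee_fin (pw0 (fun x => f x - c0)).
have ip0 : 0 < 2 `^ p :> R by exact: powR_gt0.
case EE : (\int[mu]_(x in D) (`|f x - c0| `^ p * w x)%:E)%E E0 => [E| |] // E0; last first.
  by rewrite gt0_muley ?lte_fin ?mulr_gt0 ?addr_gt0// leey.
case WE : (\int[mu]_(x in D) (w x)%:E)%E W0 Wfin => [W| |] // W0 _.
rewrite !lee_fin in E0 W0.
have iw : mu.-integrable D (EFin \o w).
  apply/integrableP; split; first exact/measurable_EFinP.
  by under eq_integral do rewrite /= ger0_norm//; rewrite WE ltry.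
(* [split_le] at [T = h = 1] gives [|f| <= 1 + |f|^p], and both [w] and [|f|^p * w] are
   integrable. *)
have ifw : mu.-integrable D (EFin \o (fun x => f x * w x)).
  have ig : mu.-integrable D (EFin \o (fun x => `|f x| `^ p * w x)).
    apply/integrableP; split; first by apply/measurable_EFinP; exact: mpow.
    by under eq_integral do rewrite /= ger0_norm//.
  apply: (le_integrable mD _ _ (integrableD mD iw ig)).
    by apply/measurable_EFinP; exact: measurable_funM.
  move=> x _; rewrite /= !lee_fin normrM (ger0_norm (w0 x)).
  rewrite [leRHS]ger0_norm ?addr_ge0// -[X in _ <= X + _]mul1r -mulrDl ler_wpM2r//.
  have := @split_le R p `|f x| 1 1 p1 (normr_ge0 _) ltr01 ltr01.
  by rewrite !powR1 !mulr1 mul1r.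
have icw : mu.-integrable D (EFin \o (fun x => c0 * w x)).
  by have := integrableZl mD c0 iw; apply: eq_integrable.
have comb (k l : R) : 0 <= k -> 0 <= l ->
    (\int[mu]_(x in D) (k * (`|f x - c0| `^ p * w x) + l * w x)%:E = (k * E + l * W)%:E)%E.
  move=> k0 l0; rewrite EFinD !EFinM -EE -WE.
  rewrite -!ge0_integralZl_EFin//; last 4 first.
  - by move=> x _; rewrite lee_fin.
  - exact/measurable_EFinP.
  - by move=> x _; rewrite lee_fin (pw0 (fun x => f x - c0)).
  - by apply/measurable_EFinP; exact: mpow.
  rewrite -ge0_integralD//.
  - by move=> x _; rewrite lee_fin mulr_ge0// (pw0 (fun x => f x - c0)).
  - by apply/measurable_EFinP/measurable_funM => //; exact: mpow.
  - by move=> x _; rewrite lee_fin mulr_ge0.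
  - by apply/measurable_EFinP/measurable_funM.
have mcomb (k l : R) : measurable_fun D (fun x => (k * (`|f x - c0| `^ p * w x) + l * w x)%:E).
  apply/measurable_EFinP/measurable_funD; apply: measurable_funM => //; exact: mpow.
have cW : `|c0| `^ p * W <= 2 `^ p * E.
  have [->|c00] := eqVneq c0 0.
    by rewrite normr0 powR0 ?gt_eqF// mul0r mulr_ge0// ltW.
  pose t := `|c0| / 2; have t0 : 0 < t by rewrite divr_gt0// normr_gt0.
  (* Since [f] has weighted mean 0, [|c0| * W] is the modulus of the integral of [(c0 - f) * w].
     With [t = |c0| / 2] the term [t * W] is half of the left-hand side. *)
  have h : `|c0| * W <= t `^ (1 - p) * E + t * W.
    have -> : `|c0| * W = fine `|\int[mu]_(x in D) ((c0 * w x)%:E - (f x * w x)%:E)|%E.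
      rewrite integralB_EFin// f0 sube0.
      under eq_integral do rewrite EFinM.
      by rewrite (integralZl mD iw) WE /= normrM (ger0_norm W0).
    rewrite -lee_fin -comb ?powR_ge0 ?(ltW t0)// fineK; last first.
      by rewrite abse_fin_num; apply: integrable_fin_num => //; exact: integrableB.
    have mB : measurable_fun D (fun x => (c0 * w x)%:E - (f x * w x)%:E)%E.
      by apply/measurable_EFinP/measurable_funB; exact: measurable_funM.
    apply: (le_trans (le_abse_integral mu mD mB)).
    apply: ge0_le_integral => //; first exact: measurableT_comp.
    move=> x _; rewrite /= lee_fin -mulrBl normrM (ger0_norm (w0 x)) mulrA -mulrDl ler_wpM2r//.
    have := @split_le R p `|f x - c0| t 1 p1 (normr_ge0 _) t0 ltr01.
    by rewrite powR1 !mulr1 distrC [X in _ <= X]addrC.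
  have -> : `|c0| = 2 * t by rewrite /t; field.
  rewrite powRM ?(ltW t0)// -mulrA ler_wpM2l ?(ltW ip0)//.
  have {}h : t * W <= t `^ (1 - p) * E by rewrite /t in h *; lra.
  have -> : t `^ p = t `^ (p - 1) * t.
    by rewrite -[X in _ = _ * X](powRr1 (ltW t0)) -powRD ?(gt_eqF t0) ?implybT// subrK.
  have -> : E = t `^ (p - 1) * (t `^ (1 - p) * E).
    by rewrite mulrA -powRD ?(gt_eqF t0) ?implybT// addrA subrK subrr powRr0 mul1r.
  by rewrite -mulrA ler_wpM2l ?powR_ge0.
apply: (@le_trans _ _ (2 `^ p * E + 2 `^ p * `|c0| `^ p * W)%:E).
  rewrite -comb ?mulr_ge0 ?(ltW ip0) ?powR_ge0//; apply: ge0_le_integral => //.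
  - by move=> x _; rewrite lee_fin.
  - by apply/measurable_EFinP; exact: mpow.
  move=> x _; rewrite lee_fin mulrA -mulrDl ler_wpM2r// -mulrDr.
  apply: le_trans (powRD_le (ltW p0) (normr_ge0 _) (normr_ge0 _)).
  by rewrite ge0_ler_powR ?nnegrE ?addr_ge0 ?(ltW p0)// -{1}(subrK c0 (f x)) ler_normD.
rewrite -EFinM lee_fin -mulrA -mulrDr -mulrA ler_wpM2l ?(ltW ip0)//; lra.
Qed.

(** The inequality between [p]-th powers, for a single gradient; roots and the infimum over
    gradients are left to the final theorem. The hypothesis places the dimension strictly below
    [n + b], so the infimum defining it has a member [lam < n + b] with an actual covering
    constant. *)
Lemma weighted_poincare_powers (R : realType) (n : nat) (p b : R) (Omega : set 'rV[R]_n) :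
  (0 < n)%N -> 1 < p -> bounded_john_domain Omega ->
  (- (n%:R%:E - assouad_dim (boundary Omega)) < b%:E)%E ->
  exists2 K : R, 0 < K & forall (f : 'rV[R]_n -> R) (g : 'rV[R]_n -> 'rV[R]_n),
    measurable_fun Omega f -> weak_gradient Omega f g ->
    (\int[@lebesgue_rV R n]_(x in Omega) (`|f x| `^ p * dist_weight Omega b x)%:E < +oo)%E ->
    (\int[@lebesgue_rV R n]_(x in Omega) (f x * dist_weight Omega b x)%:E = 0)%E ->
    (\int[@lebesgue_rV R n]_(x in Omega) (`|f x| `^ p * dist_weight Omega b x)%:E <=
     K%:E * \int[@lebesgue_rV R n]_(x in Omega)
       (`|enorm (g x)| `^ p * dist_weight Omega (b + p) x)%:E)%E.
Proof.
move=> n0 p1 jO dimb.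
have [oO _ bO _] := jO.
have [c [b0 [x0 [c01 b00 Ox0 paths]]]] := john_paths n0 jO.
have bne := boundary_nonempty n0 oO bO Ox0.
have dim_lt : (assouad_dim (boundary Omega) < (n%:R + b)%:E)%E.
  case: (assouad_dim _) dimb => [r| |] dimb; rewrite ?ltNyr //.
  by move: dimb; rewrite -EFinB -EFinN !lte_fin; lra.
have [_ [lam [lam0 [C0 C00 cov]] <-]] := ereal_inf_lt dim_lt.
rewrite lte_fin => lam_lt.
have lb : lam - n%:R < b by lra.
have [M M0 hM] := @derive_step_bounded R.
(* The summand 1 turns the nonnegativity of [stepC] into the strict positivity asked by
   [john_op_weighted]. *)
have S0 : 0 < @stepC R n c M + 1 by rewrite ltr_wpDl// (stepC_ge0 n0 c01 M0).
have [K1 K10 hK] := john_op_weighted n0 oO c01 b00 bne lam0 C00 cov p1 lb S0.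
have K20 : 0 < 2 `^ p * (1 + 2 `^ p) :> R by rewrite mulr_gt0 ?addr_gt0 ?powR_gt0.
exists (2 `^ p * (1 + 2 `^ p) * K1); first exact: mulr_gt0.
move=> f g mf wg ffin f0.
have mO : measurable Omega by exact: open_measurable_rV.
have mw : measurable_fun Omega (dist_weight Omega b).
  by apply: measurable_funTS; have /measurable_EFinP := measurable_bdist_pow Omega b.
have wfin := integrable_bdist_pow oO bne lam0 C00 cov bO lb.
have w0 x : 0 <= dist_weight Omega b x by exact: powR_ge0.
set c0 := average Omega f x0 (@chain_step R n c * b0).
apply: (le_trans (mean_zero_norm_le c0 mO p1 mf mw w0 wfin ffin f0)).
rewrite (EFinM _ K1) -muleA; apply: lee_wpmul2l; first by rewrite lee_fin ltW.
have mfc : measurable_fun Omega (fun x => f x - c0) by apply: measurable_funB.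
apply: (le_trans (hK (fun x => f x - c0) (ext_grad Omega g) mfc
  (measurable_ext_grad oO wg) (ext_grad_ge0 Omega g) _)).
  apply: filterS (chain_ae n0 oO c01 b00 M0 hM wg bO paths) => x h Ox.
  apply: (le_trans (h Ox)); apply: lee_wpmul2r.
    by apply: (john_op_ge0 _ n0 c01 b00) => y; exact: ext_grad_ge0.
  by rewrite lee_fin lerDl.
rewrite le_eqVlt; apply/orP; left; apply/eqP; congr (_ * _)%E.
apply: eq_integral => x Ox.
by rewrite /ext_grad patchE Ox ger0_norm// enorm_ge0.
Qed.

Theorem theorem5p3 (R : realType) (n : nat) (p beta : R)
    (Omega : set 'rV[R]_n) :
  (2 <= n)%N -> 1 < p -> bounded_john_domain Omega ->
  (- (n%:R%:E - assouad_dim (boundary Omega)) < (beta * p)%:E)%E ->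
  exists C : R, 0 < C /\
    forall f : 'rV[R]_n -> R,
      wLp Omega p (dist_weight Omega (beta * p)) f ->
      (\int[@lebesgue_rV R n]_(x in Omega)
          (f x * dist_weight Omega (beta * p) x)%:E = 0)%E ->
      (wLpnorm Omega p (dist_weight Omega (beta * p)) f <=
       C%:E *
       grad_wLpnorm Omega p (dist_weight Omega ((beta + 1) * p)) f)%E.
Proof.
move=> n2 p1 jO dimb; have p0 : 0 < p by lra.
have [K K0 hK] := weighted_poincare_powers (ltnW n2) p1 jO dimb.
have C0 : 0 < K `^ p^-1 by exact: powR_gt0.
exists (K `^ p^-1); split=> // f [mf nf] f0.
have I0 (h : 'rV[R]_n -> R) a :
    (0 <= \int[@lebesgue_rV R n]_(x in Omega) (`|h x| `^ p * dist_weight Omega a x)%:E)%E.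
  by apply: integral_ge0 => x _; rewrite lee_fin mulr_ge0 ?powR_ge0.
have ffin : (\int[@lebesgue_rV R n]_(x in Omega)
    (`|f x| `^ p * dist_weight Omega (beta * p) x)%:E < +oo)%E.
  by apply: (lty_poweRy _ nf); rewrite invr_eq0 gt_eqF.
(* Dividing by the constant leaves a lower bound for an infimum, checked on each admissible
   gradient; without any, the infimum is [+oo]. *)
rewrite -lee_pdivrMl//; apply: le_ereal_inf_tmp => _ [g [wg _] <-].
rewrite lee_pdivrMl// /wLpnorm -poweR_EFin -poweRM ?lee_fin ?(ltW K0)//.
apply: gt0_ler_poweR.
- by rewrite invr_ge0 ltW.
- by rewrite in_itv/= I0 leey.
- by rewrite in_itv/= leey andbT mule_ge0 ?lee_fin ?(ltW K0).
by have := hK f g mf wg ffin f0; rewrite mulrDl mul1r.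
Qed.
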